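(* Let $n\ge1$, $0<s<1$ and $u\in L^\infty(\mathbb{R}^n)$. (a) Assume that $(-\Delta)^su=f\in C^{0,\alpha}(\mathbb{R}^n)$ for some $0<\alpha\le1$. Then: (i) if $\alpha+2s<1$ then $u\in C^{0,\alpha+2s}(\mathbb{R}^n)$ and $\|u\|_{C^{0,\alpha+2s}(\mathbb{R}^n)}\le C\big(\|u\|_{L^\infty(\mathbb{R}^n)}+\|f\|_{C^{0,\alpha}(\mathbb{R}^n)}\big)$; (ii) if $1<\alpha+2s<2$ then $u\in C^{1,\alpha+2s-1}(\mathbb{R}^n)$ and $\|u\|_{C^{1,\alpha+2s-1}(\mathbb{R}^n)}\le C\big(\|u\|_{L^\infty(\mathbb{R}^n)}+\|f\|_{C^{0,\alpha}(\mathbb{R}^n)}\big)$; (iii) if $2<\alpha+2s<3$ then $u\in C^{2,\alpha+2s-2}(\mathbb{R}^n)$ and $\|u\|_{C^{2,\alpha+2s-2}(\mathbb{R}^n)}\le C\big(\|u\|_{L^\infty(\mathbb{R}^n)}+\|f\|_{C^{0,\alpha}(\mathbb{R}^n)}\big)$; (iv) if $\alpha+2s=k$, $k=1,2$, then $u\in\Lambda_\ast^k$ and $\|u\|_{\Lambda_\ast^k}\le C\big(\|u\|_{L^\infty(\mathbb{R}^n)}+\|f\|_{C^{0,\alpha}(\mathbb{R}^n)}\big)$. Here the constants $C>0$ depend only on $n$, $s$ and $\alpha$. (b) Assume that $(-\Delta)^su=f\in L^\infty(\mathbb{R}^n)$. Then: (i) if $2s<1$ then $u\in C^{0,2s}(\mathbb{R}^n)$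 and $\|u\|_{C^{0,2s}(\mathbb{R}^n)}\le C\big(\|u\|_{L^\infty(\mathbb{R}^n)}+\|f\|_{L^\infty(\mathbb{R}^n)}\big)$; (ii) if $2s=1$ then $u\in\Lambda_\ast$ and $\|u\|_{\Lambda_\ast}\le C\big(\|u\|_{L^\infty(\mathbb{R}^n)}+\|f\|_{L^\infty(\mathbb{R}^n)}\big)$; (iii) if $2s>1$ then $u\in C^{1,2s-1}(\mathbb{R}^n)$ and $\|u\|_{C^{1,2s-1}(\mathbb{R}^n)}\le C\big(\|u\|_{L^\infty(\mathbb{R}^n)}+\|f\|_{L^\infty(\mathbb{R}^n)}\big)$. Here the constants $C>0$ depend only on $n$ and $s$.
   Context: The right-hand side $f$ is not assumed to have compact support. Regularity of $u\in L^\infty(\mathbb{R}^n)$ is understood up to modification on a null set. For $u\in L^\infty(\mathbb{R}^n)$, $(-\Delta)^su$ is understood in the sense of distributions: $\langle(-\Delta)^su,\varphi\rangle=\int_{\mathbb{R}^n}u\,(-\Delta)^s\varphi\,dx$ for every Schwartz function $\varphi$, where $\widehat{(-\Delta)^s\varphi}(\xi)=|\xi|^{2s}\widehat{\varphi}(\xi)$ (Fourier transform normalized so that $\widehat{(-\Delta)\varphi}(\xi)=|\xi|^2\widehat\varphi(\xi)$). The integral makes sense because $(-\Delta)^s\varphi$ is smooth and $(1+|x|^{n+2s})(-\Delta)^s\varphi(x)$ is bounded. For an integer $k\ge0$ and $0<\beta\le1$, $C^{k,\beta}(\mathbb{R}^n)$ is the space of functions with bounded continuous derivatives up to order $k$ whose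 derivatives of order $k$ are globally $\beta$-Hölder continuous, with its usual full norm; $C^k(\mathbb{R}^n)$ carries the norm given by sup norms of all derivatives up to order $k$. Zygmund spaces: $\Lambda_\ast=\Lambda_\ast^1$ is the set of $u\in L^\infty(\mathbb{R}^n)$ with $$[u]_{\Lambda_\ast}=\sup_{x,h\in\mathbb{R}^n,\ h\neq0}\frac{|u(x+h)+u(x-h)-2u(x)|}{|h|}<\infty,\qquad \|u\|_{\Lambda_\ast}=\|u\|_{L^\infty(\mathbb{R}^n)}+[u]_{\Lambda_\ast}.$$ For an integer $k\ge2$, $\Lambda_\ast^k=\{u\in C^{k-1}(\mathbb{R}^n):D^\gamma u\in\Lambda_\ast\text{ for all }|\gamma|=k-1\}$ with norm $\|u\|_{\Lambda_\ast^k}=\|u\|_{C^{k-1}(\mathbb{R}^n)}+\max_{|\gamma|=k-1}[D^\gamma u]_{\Lambda_\ast}$. *)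

(* Defs.v *)
From HB Require Import structures.
From mathcomp Require Import all_boot all_order all_algebra complex.
From mathcomp Require Import all_classical all_reals all_analysis.

Set Implicit Arguments.
Unset Strict Implicit.
Unset Printing Implicit Defensive.

Import Order.TTheory GRing.Theory Num.Theory numFieldNormedType.Exports.

Local Open Scope classical_set_scope.
Local Open Scope ring_scope.

(* The space R^n is ['rV[R]_n]. The library puts no sigma-algebra on row
   vectors; the one generated by the coordinates is the Borel one. *)
Definition rV_display : measure_display -> measure_display.
Proof. exact. Qed.

Section rV_measurable.
Context {R : realType} {n : nat}.

Let coord (i : 'I_n) (x : 'rV[R]_n) : measurableTypeR R := x ord0 i.

Let rV_measurable0 : g_sigma_preimage coord set0.
Proof. exact: sigma_algebra0. Qed.

Let rV_measurableC A : g_sigma_preimage coord A -> g_sigma_preimage coord (~` A).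
Proof. exact: sigma_algebraC. Qed.

Let rV_measurable_bigcup (F : _^nat) : (forall i, g_sigma_preimage coord (F i)) ->
  g_sigma_preimage coord (\bigcup_i (F i)).
Proof. exact: sigma_algebra_bigcup. Qed.

HB.instance Definition _ := @isMeasurable.Build (rV_display default_measure_display)
  'rV[R]_n (g_sigma_preimage coord)
  rV_measurable0 rV_measurableC rV_measurable_bigcup.

Lemma measurable_rV_coord (i : 'I_n) :
  measurable_fun [set: 'rV[R]_n] (fun x => x ord0 i : measurableTypeR R).
Proof.
move=> _ Y mY; rewrite setTI; apply: sub_sigma_algebra => /=.
rewrite -bigcup_seq/=; exists i => /=; first by rewrite mem_index_enum.
by exists Y => //; rewrite setTI.
Qed.

Lemma measurable_fun_rVP d (T : measurableType d) (f : T -> 'rV[R]_n) :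
  (forall i, measurable_fun [set: T] (fun t => f t ord0 i : measurableTypeR R)) ->
  measurable_fun [set: T] f.
Proof.
move=> mf.
have : g_sigma_preimage (fun i => coord i \o f) `<=` measurable.
  apply: smallest_sub; first exact: sigma_algebra_measurable.
  rewrite -bigcup_seq; apply: bigcup_sub => i _ A [B mB <-]; exact: mf.
rewrite g_sigma_preimage_comp => prefS _ A mA; apply: prefS.
by exists A.
Qed.

End rV_measurable.

(* [leb_cons m] is the product of the one-dimensional Lebesgue measure and of
   [m], transported to row vectors by prepending the first coordinate. *)
Section leb_cons.
Context {R : realType} {n : nat}.

Definition rV_cons (p : measurableTypeR R * 'rV[R]_n) : 'rV[R]_n.+1 :=
  row_mx (const_mx p.1 : 'rV[R]_1) p.2.

Lemma rV_cons0 p : rV_cons p ord0 ord0 = p.1.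
Proof.
by rewrite /rV_cons mxE; case: splitP => // j _; rewrite mxE.
Qed.

Lemma rV_consS p i : rV_cons p ord0 (lift ord0 i) = p.2 ord0 i.
Proof.
rewrite /rV_cons mxE; case: splitP => [[[]//]|k [ki]].
by congr (p.2 _ _); exact/val_inj/esym.
Qed.

Lemma measurable_rV_cons : measurable_fun setT rV_cons.
Proof.
apply: measurable_fun_rVP => i; case: (unliftP ord0 i) => [j ->|->].
- under eq_fun do rewrite rV_consS.
  exact: (measurableT_comp (measurable_rV_coord j) measurable_snd).
- by under eq_fun do rewrite rV_cons0; exact: measurable_fst.
Qed.

Definition rV_uncons (x : 'rV[R]_n.+1) : measurableTypeR R * 'rV[R]_n :=
  (x ord0 ord0, \row_i x ord0 (lift ord0 i)).

Lemma rV_consK : cancel rV_cons rV_uncons.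
Proof.
move=> p; rewrite [RHS]surjective_pairing; congr pair; first exact: rV_cons0.
by apply/rowP => i; rewrite mxE rV_consS.
Qed.

Lemma measurable_rV_uncons : measurable_fun setT rV_uncons.
Proof.
apply: measurable_fun_pair; first exact: measurable_rV_coord.
apply: measurable_fun_rVP => i; under eq_fun do rewrite mxE.
exact: measurable_rV_coord.
Qed.

Variable m : {sigma_finite_measure set 'rV[R]_n -> \bar R}.

Definition leb_cons : set 'rV[R]_n.+1 -> \bar R :=
  pushforward (@lebesgue_measure R \x m)%E rV_cons.

HB.instance Definition _ := Measure.copy leb_cons
  (measure_function_pushforward__canonical__measure_function_Measure
     (@lebesgue_measure R \x m)%E measurable_rV_cons).

Let leb_cons_sigma_finite : sigma_finite setT leb_cons.
Proof.
have /sigma_finiteP[F [TF ndF Foo]] := sigma_finiteT (@lebesgue_measure R).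
have /sigma_finiteP[G [TG ndG Goo]] := sigma_finiteT m.
exists (fun k => rV_uncons @^-1` (F k `*` G k)).
  rewrite -preimage_bigcup (_ : \bigcup_k _ = setT) ?preimage_setT//.
  rewrite -subTset => -[x y] _.
  have [i _ Fx] : (\bigcup_i F i) x by rewrite -TF.
  have [j _ Gy] : (\bigcup_j G j) y by rewrite -TG.
  exists (maxn i j) => //; split => /=.
    by move: x Fx; exact/subsetPset/ndF/leq_maxl.
  by move: y Gy; exact/subsetPset/ndG/leq_maxr.
move=> k; have [mF muF] := Foo k; have [mG muG] := Goo k.
have mFG : measurable (F k `*` G k) by exact: measurableX.
split; first by rewrite -[X in measurable X]setTI; exact: measurable_rV_uncons.
rewrite /leb_cons /pushforward -comp_preimage.
rewrite (_ : rV_uncons \o rV_cons = id); last by apply/funext => p; exact: rV_consK.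
by rewrite preimage_id product_measure1E// lte_mul_pinfty// ge0_fin_numE.
Qed.

HB.instance Definition _ := Measure_isSigmaFinite.Build _ _ _ leb_cons
  leb_cons_sigma_finite.

End leb_cons.

Fixpoint lebesgue_rV {R : realType} (n : nat) :
    {sigma_finite_measure set 'rV[R]_n -> \bar R} :=
  if n is m.+1 then leb_cons (lebesgue_rV m)
  else dirac (0 : 'rV[R]_0).

Lemma lebesgue_rV_box {R : realType} (n : nat) (A : 'I_n -> set R) :
  (forall i, measurable (A i : set (measurableTypeR R))) ->
  lebesgue_rV n [set x : 'rV[R]_n | forall i, A i (x ord0 i)] =
  (\prod_(i < n) @lebesgue_measure R (A i))%E.
Proof.
elim: n A => [|n IH] A mA.
  by rewrite big_ord0 /= diracE mem_set//= => -[].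
rewrite big_ord_recl -IH//.
pose B : set 'rV[R]_n := [set x : 'rV[R]_n | forall i, A (lift ord0 i) (x ord0 i)].
transitivity ((@lebesgue_measure R \x lebesgue_rV n)%E (A ord0 `*` B)); last first.
  rewrite product_measure1E//.
  rewrite (_ : B = \bigcap_(i in [set: 'I_n])
      ((fun x : 'rV[R]_n => x ord0 i) @^-1` A (lift ord0 i))); last first.
    by apply/seteqP; split => [x Bx i _|x Bx i]; exact: Bx.
  apply: fin_bigcap_measurable => // i _; rewrite -[X in measurable X]setTI.
  exact: (@measurable_rV_coord R n i).
rewrite [LHS]/= /leb_cons /pushforward; congr product_measure1.
apply/seteqP; split => [p Ap|p [A0 AS] i].
  by split=> [|i] /=; [rewrite -rV_cons0|rewrite -rV_consS]; exact: Ap.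
case: (unliftP ord0 i) => [j ->|->]; first by rewrite rV_consS; exact: AS.
by rewrite rV_cons0.
Qed.

Section euclidean.
Context {R : realType} {n : nat}.
Implicit Types x y : 'rV[R]_n.

Definition dot x y : R := \sum_(i < n) x ord0 i * y ord0 i.

(* The library norm of ['rV[R]_n] is the sup norm. *)
Definition enorm x : R := Num.sqrt (dot x x).

End euclidean.

Section function_spaces.
Context {R : realType} {n : nat}.
Local Notation Rn := 'rV[R]_n.
Implicit Types (f u : Rn -> R) (g : seq 'I_n) (k : nat) (b : R).

Definition Linfty u : Prop := u \in Lfun (lebesgue_rV n) +oo%E.

Definition Linfty_norm u : \bar R := ('N[lebesgue_rV n]_+oo[EFin \o u])%E.

Definition ae_equal u v : Prop := {ae lebesgue_rV n, forall x, u x = v x}.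

(* Partial derivatives are indexed by words of coordinates:
   [partials [:: i1; ..; ik] f] is d_i1 .. d_ik f. The derivatives D^gamma f
   with |gamma| = k are those indexed by the words of length k. *)
Definition partial (i : 'I_n) f : Rn -> R := fun x => 'D_(delta_mx ord0 i) f x.

Definition partials g f : Rn -> R := foldr partial f g.

Definition continuously_derivable k f : Prop :=
  (forall g, (size g < k)%N ->
     forall i x, derivable (partials g f) x (delta_mx ord0 i)) /\
  (forall g, (size g <= k)%N -> continuous (partials g f)).

Definition Ck_norm k f : \bar R :=
  ereal_sup [set (`|partials p.1 f p.2|)%:E
            | p in [set p : seq 'I_n * Rn | (size p.1 <= k)%N]].

Definition Ck k f : Prop :=
  continuously_derivable k f /\ (Ck_norm k f < +oo)%E.

Definition holder_seminorm b f : \bar R :=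
  ereal_sup [set (`|f p.1 - f p.2| / enorm (p.1 - p.2) `^ b)%:E
            | p in [set p : Rn * Rn | p.1 != p.2]].

Definition holder_norm k b f : \bar R :=
  (Ck_norm k f +
   ereal_sup [set holder_seminorm b (partials g f) | g in [set g | size g = k]])%E.

Definition holder k b f : Prop :=
  continuously_derivable k f /\ (holder_norm k b f < +oo)%E.

Definition zygmund_seminorm f : \bar R :=
  ereal_sup [set (`|f (p.1 + p.2) + f (p.1 - p.2) - 2 * f p.1| / enorm p.2)%:E
            | p in [set p : Rn * Rn | p.2 != 0]].

Definition zygmund1 u : Prop := Linfty u /\ (zygmund_seminorm u < +oo)%E.

(* Only meaningful for [k >= 1]. *)
Definition zygmund k u : Prop :=
  if k is j.+2 then
    Ck j.+1 u /\ (forall g, size g = j.+1 -> zygmund1 (partials g u))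
  else zygmund1 u.

Definition zygmund_norm k u : \bar R :=
  if k is j.+2 then
    (Ck_norm j.+1 u +
     ereal_sup [set zygmund_seminorm (partials g u) | g in [set g | size g = j.+1]])%E
  else (Linfty_norm u + zygmund_seminorm u)%E.

End function_spaces.

Section fractional_laplacian.
Context {R : realType} {n : nat}.
Local Notation Rn := 'rV[R]_n.
Local Open Scope complex_scope.
Implicit Types phi psi : Rn -> R[i].

Definition schwartz_real (f : Rn -> R) : Prop :=
  (forall k, continuously_derivable k f) /\
  (forall (m : nat) (g : seq 'I_n),
     exists M : R, forall x, enorm x ^+ m * `|partials g f x| <= M).

Definition schwartz phi : Prop :=
  schwartz_real (fun x => complex.Re (phi x)) /\
  schwartz_real (fun x => complex.Im (phi x)).

Definition Cintegral phi : R[i] :=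
  (\int[lebesgue_rV n]_x complex.Re (phi x)) +i*
  (\int[lebesgue_rV n]_x complex.Im (phi x)).

Definition cis (t : R) : R[i] := cos t +i* sin t.

Definition fourier phi : Rn -> R[i] :=
  fun xi => Cintegral (fun x => phi x * cis (- dot x xi)).

Definition inverse_fourier psi : Rn -> R[i] :=
  fun x => (((2 * pi) ^- n)%:C) * Cintegral (fun xi => psi xi * cis (dot x xi)).

(* For a Schwartz function [phi], the function whose Fourier transform is
   |xi|^(2s) fourier phi; that transform is integrable. *)
Definition frac_laplacian (s : R) phi : Rn -> R[i] :=
  inverse_fourier (fun xi => ((enorm xi `^ (2 * s))%:C) * fourier phi xi).

(* (-Delta)^s u = f in the sense of distributions. *)
Definition frac_laplacian_eq (s : R) (u f : Rn -> R) : Prop :=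
  forall phi, schwartz phi ->
    Cintegral (fun x => (u x)%:C * frac_laplacian s phi x) =
    Cintegral (fun x => (f x)%:C * phi x).

End fractional_laplacian.

(* Main.v *)
(* Let u_t be the convolution of u with the heat kernel.  Testing the equation
   against translated heat kernels, whose Fourier transforms are Gaussians, and
   writing |xi|^(2s) as Gamma(1-s)^-1 times the integral of
   |xi|^2 exp(-v |xi|^2) v^(-s) over v > 0, turns it into
     f_t = - Gamma(1-s)^-1 * int_0^oo v^(-s) (Laplacian u_(t+v)) dv
         = - Gamma(1-s)^-1 * int_0^oo v^(-s) (d/dt u_(t+v)) dv,
   an Abel integral equation in t, which may be differentiated in x and then
   inverted.  Since D^g f_t = O(t^((alpha-|g|)/2)) for |g| >= 1 when f is
   alpha-Hoelder, inversion yields D^g u_t = O(t^((alpha+2s-|g|)/2)) for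
   |g| > alpha+2s.  Integrating these bounds in t, the derivatives of u_t of
   order at most k converge uniformly as t -> 0, where k < alpha+2s <= k+1; and
   comparing increments over a distance r with those of u_t for t = r^2 gives
   the Hoelder (or, if alpha+2s = k+1, the Zygmund) estimate of the limit.
   This limit is u almost everywhere because u_t tends to u weakly.  Bounded f
   is the case alpha = 0, where the Hoelder seminorm is at most 2 sup |f|. *)
Require Import Defs.
From mathcomp Require Import all_boot all_order all_algebra complex ring lra.
From mathcomp Require Import all_classical all_reals all_analysis measurable_realfun ess_sup_inf.
Set Implicit Arguments.
Unset Strict Implicit.
Unset Printing Implicit Defensive.
Import Order.TTheory GRing.Theory Num.Theory numFieldNormedType.Exports.
Local Open Scope classical_set_scope.
Local Open Scope ring_scope.

(** * Real-valued integrals *)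

(** Inverting Abel's equation needs decay for large t. This is why it is applied to D^g u_t with |g|
    >= 1, which is O(t^(-|g|/2)) for bounded u, and not to u_t itself. The inversion integrates
    v^(s-1) against D^g f_(t+v), and convergence at infinity is exactly the restriction |g| >
    alpha+2s. The time derivative of u_t is its Laplacian, of order 2, and for alpha+2s >= 2 it
    violates this restriction. There f is treated as merely bounded: the exponent obtained is weaker
    but still sufficient. All kernels are dominated by products of Cauchy kernels s/(s^2+x^2) at the
    scale s = sqrt t. Their mass does not depend on s and, unlike Gaussians, they absorb a
    translation by s or a doubling of s into a constant factor; this provides every majorant for
    differentiating in x and in t under the integral sign. Weak convergence of u_t to u is tested on
    indicators of orthants times a Cauchy weight. The heat flow of such a product is again a
    product, and orthants form a generating family closed under intersection. *)

Notation rintegrable mu f := (mu.-integrable setT (EFin \o f)) (only parsing).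

Section real_integrals.
Context d (T : measurableType d) (R : realType) (mu : {measure set T -> \bar R}).
Implicit Types f g : T -> R.

Lemma rintegrable_measurable f : rintegrable mu f -> measurable_fun setT f.
Proof. by move=> /integrableP[/measurable_EFinP]. Qed.

Lemma le_rintegrable f g : measurable_fun setT f -> rintegrable mu g ->
  (forall x, `|f x| <= g x) -> rintegrable mu f.
Proof.
move=> mf ig fg; apply: (le_integrable measurableT _ _ ig) => //.
  exact/measurable_EFinP.
by move=> x _ /=; rewrite lee_fin (le_trans (fg x))// ler_norm.
Qed.

Lemma rintegrable_normr f : rintegrable mu f -> rintegrable mu (fun x => `|f x|).
Proof. by move=> fi; have := integrable_abse fi; exact. Qed.

Lemma rintegrableZl r f : rintegrable mu f -> rintegrable mu (fun x => r * f x).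
Proof. by move=> /(integrableZl measurableT r); exact. Qed.

Lemma rintegrableD f g : rintegrable mu f -> rintegrable mu g ->
  rintegrable mu (fun x => f x + g x).
Proof. by move=> fi gi; have := integrableD measurableT fi gi. Qed.

Lemma rintegrableB f g : rintegrable mu f -> rintegrable mu g ->
  rintegrable mu (fun x => f x - g x).
Proof. by move=> fi gi; have := integrableB measurableT fi gi. Qed.

Lemma rintegrable0 : rintegrable mu (fun=> 0 : R).
Proof. exact: integrable0. Qed.

Lemma rintegrable_sum (I : Type) (r : seq I) (F : I -> T -> R) :
  (forall i, rintegrable mu (F i)) ->
  rintegrable mu (fun x => \sum_(i <- r) F i x).
Proof.
move=> Fi; elim: r => [|i r IH].
  by under eq_fun do rewrite big_nil; exact: rintegrable0.
by under eq_fun do rewrite big_cons; exact: rintegrableD.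
Qed.

Lemma Rintegral_sum (I : Type) (r : seq I) (F : I -> T -> R) :
  (forall i, rintegrable mu (F i)) ->
  \int[mu]_x (\sum_(i <- r) F i x) = \sum_(i <- r) \int[mu]_x F i x.
Proof.
move=> Fi; elim: r => [|i r IH].
  by under eq_Rintegral do rewrite big_nil; rewrite Rintegral_cst// mul0r big_nil.
under eq_Rintegral do rewrite big_cons.
by rewrite RintegralD ?IH ?big_cons//; exact: rintegrable_sum.
Qed.

Lemma EFin_Rintegral f : rintegrable mu f ->
  (\int[mu]_x f x)%:E = (\int[mu]_x (f x)%:E)%E.
Proof. by move=> fi; rewrite /Rintegral fineK//; exact: integrable_fin_num. Qed.

Lemma le_norm_Rintegral f g : measurable_fun setT f -> rintegrable mu g ->
  (forall x, `|f x| <= g x) -> `|\int[mu]_x f x| <= \int[mu]_x g x.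
Proof.
move=> mf gi fg; have fi := le_rintegrable mf gi fg.
apply: (le_trans (le_normr_Rintegral measurableT fi)).
by apply: le_Rintegral => //; exact: rintegrable_normr.
Qed.

Lemma ae_eq_Rintegral f g : measurable_fun setT f -> measurable_fun setT g ->
  {ae mu, forall x, f x = g x} -> \int[mu]_x f x = \int[mu]_x g x.
Proof.
move=> mf mg fg; congr fine; apply: ae_eq_integral => //; try exact/measurable_EFinP.
by apply: filterS fg => x /= -> _.
Qed.

Lemma ge0_rintegrableP f : measurable_fun setT f ->
  (forall x, 0 <= f x) -> (\int[mu]_x (f x)%:E < +oo)%E -> rintegrable mu f.
Proof.
move=> mf f0 fl; apply/integrableP; split; first exact/measurable_EFinP.
under eq_integral => x _ do rewrite /= ger0_norm//.
exact: fl.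
Qed.

End real_integrals.

(** * Fubini's theorem for real integrals *)

Section real_fubini.
Context d1 d2 (T1 : measurableType d1) (T2 : measurableType d2) (R : realType).
Variables (m1 : {sigma_finite_measure set T1 -> \bar R})
  (m2 : {sigma_finite_measure set T2 -> \bar R}).
Implicit Type F : T1 -> T2 -> R.

(** Tonelli: an integrable majorant [h] of the inner integrals of the modulus makes the iterated
    integral of the modulus finite, and one order of integration is enough. *)
Lemma rintegrable_prod F (h : T1 -> R) :
  measurable_fun setT (fun p => F p.1 p.2) ->
  (forall x, rintegrable m2 (F x)) -> rintegrable m1 h ->
  (forall x, \int[m2]_y `|F x y| <= h x) ->
  rintegrable (m1 \x m2)%E (fun p => F p.1 p.2).
Proof.
move=> mF iF ih Fh; have mF' : measurable_fun setT (EFin \o fun p => F p.1 p.2).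
  exact/measurable_EFinP.
apply/(integrable12ltyP m1 m2 mF').
move/integrableP : (ih) => [_]; apply: le_lt_trans.
apply: ge0_le_integral => //=.
- by move=> x _; apply: integral_ge0.
- apply: (@measurable_fun_fubini_tonelli_F _ _ _ _ _ m2 (fun p => `|F p.1 p.2|%:E)).
  + by apply/measurable_EFinP; exact: measurableT_comp.
  + by [].
- by apply/measurable_EFinP; apply: measurableT_comp => //; exact: rintegrable_measurable ih.
- move=> x _; rewrite -EFin_Rintegral; last exact: (rintegrable_normr (iF x)).
  by rewrite lee_fin (le_trans (Fh x))// ler_norm.
Qed.

Lemma RFubini1 F : rintegrable (m1 \x m2)%E (fun p => F p.1 p.2) ->
  \int[m1]_x \int[m2]_y F x y = \int[(m1 \x m2)%E]_p F p.1 p.2.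
Proof.
move=> iF; rewrite [RHS]/Rintegral -(integral12_prod_meas1 iF).
have iG := integrable_fubini_F iF.
congr fine; apply: ae_eq_integral => //.
- apply/measurable_EFinP; apply: measurableT_comp => //; exact: measurable_int iG.
- exact: measurable_int iG.
- apply: filterS (integrable_ae measurableT iG) => x /(_ I) fx _ /=.
  by rewrite /Rintegral fineK.
Qed.

Lemma integrable_fubini_G (f : T1 * T2 -> \bar R) :
  (m1 \x m2)%E.-integrable setT f -> m2.-integrable setT (fubini_G m1 f).
Proof.
move=> iF; have mF := measurable_int _ iF.
apply/integrableP; split; first exact: (measurable_fubini_G iF).
have := (integrable21ltyP m1 m2 mF).1 iF; apply: le_lt_trans.
apply: ge0_le_integral => //=.
- by apply: measurableT_comp => //; exact: (measurable_fubini_G iF).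
- apply: (@measurable_fun_fubini_tonelli_G _ _ _ _ _ m1 (fun p => `|f p|%E)) => //.
  exact: measurableT_comp.
- move=> y _; apply: le_abse_integral => //.
  by apply: (measurableT_comp mF); exact: pair2_measurable.
Qed.

Lemma RFubini2 F : rintegrable (m1 \x m2)%E (fun p => F p.1 p.2) ->
  \int[m2]_y \int[m1]_x F x y = \int[(m1 \x m2)%E]_p F p.1 p.2.
Proof.
move=> iF; rewrite [RHS]/Rintegral -(integral21_prod_meas1 iF).
have iG := integrable_fubini_G iF.
congr fine; apply: ae_eq_integral => //.
- apply/measurable_EFinP; apply: measurableT_comp => //; exact: measurable_int iG.
- exact: measurable_int iG.
- apply: filterS (integrable_ae measurableT iG) => x /(_ I) fx _ /=.
  by rewrite /Rintegral fineK.
Qed.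

Lemma RFubini F : rintegrable (m1 \x m2)%E (fun p => F p.1 p.2) ->
  \int[m1]_x \int[m2]_y F x y = \int[m2]_y \int[m1]_x F x y.
Proof. by move=> iF; rewrite RFubini1// RFubini2. Qed.

Lemma measurable_Rintegral_param F : rintegrable (m1 \x m2)%E (fun p => F p.1 p.2) ->
  measurable_fun setT (fun x => \int[m2]_y F x y).
Proof.
move=> iF; apply: measurableT_comp => //.
exact: measurable_int (integrable_fubini_F iF).
Qed.

End real_fubini.

(** * Affine changes of variable *)

Section affine.
Context (R : realType).
Notation mu := (@lebesgue_measure R).

Let aff (r b : R) (x : measurableTypeR R) : measurableTypeR R := r * x + b.

Let maff r b : measurable_fun setT (aff r b).
Proof. by apply: measurable_funD => //; exact: mulrl_measurable. Qed.

(** The image measure multiplied by [r] agrees with Lebesgue measure on half-open intervals, and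
    these determine the measure. *)
Lemma lebesgue_measure_affine (r : {posnum R}) (b : R) (A : set R) :
  measurable (A : set (measurableTypeR R)) ->
  pushforward mu (aff r%:num b) A = (r%:num^-1%:E * mu A)%E.
Proof.
move=> mA.
pose pf := measure_function_pushforward__canonical__measure_function_Measure
  mu (maff r%:num b).
rewrite (@lebesgue_measure_unique R (mscale r%:num%:nng pf) _ A mA).
  by rewrite /mscale /= muleA -EFinM mulVf ?mul1e.
move=> X /ocitvP[->|[[x y] /= xy ->]]; first by rewrite !measure0.
rewrite /mscale /= lebesgue_measure_itv/= lte_fin xy.
have -> : pushforward mu (aff r%:num b) `]x, y]%classic =
   mu `]((x - b) / r%:num), ((y - b) / r%:num)]%classic.
  congr (mu _); apply/seteqP; split => z /=;
  by rewrite !in_itv/= /aff ltr_pdivrMr// ler_pdivlMr// ltrBlDr lerBrDr [z * _]mulrC.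
rewrite lebesgue_measure_itv/= lte_fin ltr_pM2r ?invr_gt0// ltrD2r xy.
rewrite -!EFinB -EFinM; congr EFin.
by rewrite -mulrBl opprB addrA addrNK mulrC mulfVK.
Qed.

Lemma ge0_integral_affine (r b : R) (f : R -> \bar R) : 0 < r ->
  measurable_fun setT f -> (forall x, 0 <= f x)%E ->
  (\int[mu]_x f (r * x + b)%R = r^-1%:E * \int[mu]_x f x)%E.
Proof.
move=> r0 mf f0.
have r1 : 0 <= r^-1 by rewrite invr_ge0 ltW.
transitivity (\int[mscale (NngNum r1) mu]_x f x)%E; last by rewrite ge0_integral_mscale.
have -> : (\int[mu]_x f (r * x + b)%R = \int[pushforward mu (aff r b)]_x f x)%E.
  by rewrite (ge0_integral_pushforward (maff r b))//.
apply: eq_measure_integral => A mA _.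
exact: (lebesgue_measure_affine (PosNum r0)).
Qed.

Lemma rintegrable_affine (r b : R) (f : R -> R) : 0 < r ->
  rintegrable mu f -> rintegrable mu (fun x => f (r * x + b)).
Proof.
move=> r0 fi; have mf := rintegrable_measurable fi.
apply/integrableP; split.
  by apply/measurable_EFinP; apply: (measurableT_comp mf); exact: (maff r b).
rewrite /= (@ge0_integral_affine r b (fun x => `|f x|%:E))//.
  by apply: lte_mul_pinfty; [rewrite lee_fin invr_ge0 ltW| |case/integrableP : fi].
by apply/measurable_EFinP; exact: measurableT_comp.
Qed.

Lemma Rintegral_affine (r b : R) (f : R -> R) : 0 < r -> rintegrable mu f ->
  \int[mu]_x f (r * x + b) = r^-1 * \int[mu]_x f x.
Proof.
move=> r0 fi; have mf := rintegrable_measurable fi.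
have ai := rintegrable_affine b r0 fi.
have pfi := integrable_funepos measurableT fi.
have nfi := integrable_funeneg measurableT fi.
have mp := measurable_int _ pfi; have mn := measurable_int _ nfi.
transitivity (fine (\int[mu]_x (EFin \o f)^\+ (r * x + b)%R -
                    \int[mu]_x (EFin \o f)^\- (r * x + b)%R)).
  rewrite /Rintegral integralE; congr (fine (_ - _)).
    by apply: eq_integral => x _; rewrite !funeposE.
  by apply: eq_integral => x _; rewrite !funenegE.
rewrite !ge0_integral_affine//.
rewrite -muleBr// ?fineM//.
- by rewrite -integralE.
- by rewrite fin_numB !(integrable_fin_num measurableT).
- by rewrite fin_num_adde_defr// (integrable_fin_num measurableT).
Qed.

End affine.

(** * Derivatives and limits under the integral sign *)

Section derive_under_integral.
Context (R : realType) d (Y : measurableType d) (mu : {measure set Y -> \bar R}).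

Lemma is_derive_Rintegral (f f' : R -> Y -> R) (a e : R) (G : Y -> R) : 0 < e ->
  (forall x y, `|x - a| < e -> is_derive x 1 (f^~ y) (f' x y)) ->
  (forall x, `|x - a| < e -> rintegrable mu (f x)) ->
  rintegrable mu G ->
  (forall x y, `|x - a| < e -> `|f' x y| <= G y) ->
  is_derive a 1 (fun x => \int[mu]_y f x y) (\int[mu]_y f' a y).
Proof.
move=> e0 df fi Gi f'G.
have inI x : `]a - e, a + e[%classic x -> `|x - a| < e.
  by rewrite /= in_itv/= ltr_norml => /andP[? ?]; apply/andP; split; lra.
have Ia : `]a - e, a + e[%classic a by rewrite /= in_itv/=; apply/andP; split; lra.
have d1E x y : `|x - a| < e -> (partial1of2 f) x y = f' x y.
  by move=> /df h; rewrite partial1of2E; apply: derive_val.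
have aa : `|a - a| < e by rewrite subrr normr0.
have h1 : forall x y, `]a - e, a + e[%classic x -> setT y -> derivable (f ^~ y) x 1.
  by move=> x y /inI h _; have [] := df _ y h.
have h2 x : `]a - e, a + e[%classic x -> rintegrable mu (f x) by move/inI; exact: fi.
have h3 : forall x y, `]a - e, a + e[%classic x -> setT y -> `|partial1of2 f x y| <= G y.
  by move=> x y /inI h _; rewrite d1E// f'G.
have h4 y : 0 <= G y by rewrite (le_trans _ (f'G a y aa)).
have := differentiation_under_integral measurableT Ia h2 h1 h4 Gi h3.
have := derivable_under_integral measurableT Ia h2 h1 h4 Gi h3.
move=> h5 h6; apply: DeriveDef => //.
rewrite -derive1E h6; apply: eq_Rintegral => y _.
by rewrite d1E.
Qed.

Lemma cvg_Rintegral (f_ : nat -> Y -> R) (f g : Y -> R) :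
  (forall n, measurable_fun setT (f_ n)) -> measurable_fun setT f ->
  {ae mu, forall y, f_ n y @[n --> \oo] --> f y} ->
  rintegrable mu g -> (forall n y, `|f_ n y| <= g y) ->
  \int[mu]_y f_ n y @[n --> \oo] --> \int[mu]_y f y.
Proof.
move=> mf_ mf cf ig fg.
have [] := @dominated_convergence _ _ _ mu setT measurableT (fun n y => (f_ n y)%:E)
  (EFin \o f) (EFin \o g).
- by move=> n; exact/measurable_EFinP.
- exact/measurable_EFinP.
- by apply: filterS cf => y h _ /=; apply: cvg_EFin => //; exact: nearW.
- exact: ig.
- by apply: aeW => y n _; rewrite lee_fin.
move=> fi _ h; apply: fine_cvg; rewrite -/(\int[mu]_y f y) EFin_Rintegral//.
Qed.

End derive_under_integral.

(** * The heat kernel and its derivatives *)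

Section hermite_gauss.
Context (R : realType).
Notation mu := (@lebesgue_measure R).
Implicit Types (k m : nat) (t x y : R).

(** Hermite polynomials up to sign and scaling: the recursion makes [gauss k] the [k]-th derivative
    of exp(-x^2/4). *)
Fixpoint hermite k : {poly R} :=
  if k is j.+1 then (hermite j)^`() - 2^-1 *: ('X * hermite j) else 1.

Definition gauss k x : R := (hermite k).[x] * expR (- (x ^+ 2 / 4)).

Lemma horner_hermiteS k x :
  (hermite k.+1).[x] = (hermite k)^`().[x] - x / 2 * (hermite k).[x].
Proof. by rewrite /= hornerD hornerN hornerZ hornerM hornerX; ring. Qed.

Lemma derive_hermiteS k : (hermite k.+1)^`() = - ((k.+1)%:R / 2) *: hermite k.
Proof.
elim: k => [|k IH].
  by rewrite /= derivC sub0r mulr1 derivN derivZ derivX mul1r scaleNr.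
rewrite [in LHS]/= -/(hermite k.+1) derivB IH !derivZ derivM derivX mul1r IH.
rewrite [hermite k.+1]/=.
rewrite -!mul_polyC.
have -> : (k.+2%:R : R) = k%:R + 2 by rewrite -addn2 natrD.
have -> : (k.+1%:R : R) = k%:R + 1 by rewrite -addn1 natrD.
rewrite !rmorphN !rmorphM !rmorphD !rmorph1/=.
ring.
Qed.

Lemma is_derive_gauss k x : is_derive x 1 (gauss k) (gauss k.+1 x).
Proof.
apply: is_derive_eq.
rewrite /gauss horner_hermiteS /GRing.scale/=; lra.
Qed.

Lemma is_derive_gauss_comp k (g : R -> R) x dg : is_derive x 1 g dg ->
  is_derive x 1 (fun x => gauss k (g x)) (gauss k.+1 (g x) * dg).
Proof. by move=> gd; exact: (is_derive1_comp (is_derive_gauss k (g x)) gd). Qed.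

(** The heat equation in the self-similar variable x / sqrt t: this recurrence turns the time
    derivative of [heat1 k] into [heat1 k.+2]. *)
Lemma gaussSS k x : gauss k.+2 x = - (x / 2 * gauss k.+1 x) - (k.+1)%:R / 2 * gauss k x.
Proof.
rewrite /gauss [in LHS]horner_hermiteS derive_hermiteS hornerZ.
ring.
Qed.

(** Write exp(x^2/4) as the [m]-th power of exp(x^2/(4m)) and use 1 + y <= exp y: what remains is
    |x| <= m + x^2/4, which follows from (|x|/2 - 1)^2 >= 0 and m >= 1. *)
Lemma exprM_gauss_bounded m : exists C : R, forall x, `|x| ^+ m * expR (- (x ^+ 2 / 4)) <= C.
Proof.
exists (m%:R ^+ m) => x; rewrite expRN ler_pdivrMr ?expR_gt0//.
case: m => [|m]; first by rewrite !expr0 mul1r -expR0 ler_expR divr_ge0// sqr_ge0.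
have : 1 <= m.+1%:R :> R by rewrite ler1n.
set c : R := m.+1%:R => c1; have c0 : c != 0 by rewrite gt_eqF//; lra.
rewrite (_ : x ^+ 2 / 4 = m.+1%:R * (x ^+ 2 / (4 * c))); last by field.
rewrite expRM_natl -exprMn; apply: lerXn2r; rewrite ?nnegrE ?mulr_ge0 ?expR_ge0//.
have c2 : 0 <= c by lra.
apply: le_trans (ler_wpM2l c2 (expR_ge1Dx (x ^+ 2 / (4 * c)))).
rewrite mulrDr mulr1 (_ : _ * (x ^+ 2 / _) = x ^+ 2 / 4); last by field.
rewrite -[x ^+ 2]real_normK ?num_real//.
have : 0 <= (`|x| / 2 - 1) ^+ 2 by rewrite sqr_ge0.
rewrite sqrrB; lra.
Qed.

Lemma poly_gauss_bounded (p : {poly R}) :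
  exists C : R, forall x, `|p.[x]| * expR (- (x ^+ 2 / 4)) <= C.
Proof.
have [c cP] := choice exprM_gauss_bounded.
exists (\sum_(i < size p) `|p`_i| * c i) => x.
rewrite horner_coef.
apply: (@le_trans _ _ ((\sum_(i < size p) `|p`_i| * `|x| ^+ i) * expR (- (x ^+ 2 / 4)))).
  rewrite ler_wpM2r ?expR_ge0// (le_trans (ler_norm_sum _ _ _))//.
  by apply: ler_sum => i _; rewrite normrM normrX.
rewrite mulr_suml; apply: ler_sum => i _; rewrite -mulrA ler_wpM2l//.
Qed.

Lemma gauss_bounded k m : exists C : R, forall x, `|gauss k x| * (1 + `|x|) ^+ m <= C.
Proof.
(* The inequality 1 + |x| <= 2 (1 + x^2) replaces the weight by a polynomial. *)
have [C CP] := poly_gauss_bounded (hermite k * (2 *: (1 + 'X^2)) ^+ m).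
exists C => x; apply: le_trans (CP x).
rewrite /gauss hornerM !normrM [`|expR _|]ger0_norm ?expR_ge0// mulrAC.
rewrite ler_wpM2r ?expR_ge0// ler_wpM2l// horner_exp normrX.
apply: lerXn2r; rewrite ?nnegrE ?addr_ge0//.
rewrite !hornerE ger0_norm; last by nra.
rewrite -[x ^+ 2]real_normK ?num_real//; nra.
Qed.

End hermite_gauss.

(** * The Cauchy kernel as a majorant *)

Section cauchy_kernel.
Context (R : realType).
Notation mu := (@lebesgue_measure R).
Implicit Types s t x y h : R.

(** [pi] times the Poisson kernel of the half-plane at height [s]; its mass is [pi] at every
    scale. *)
Definition cauchy_ker s x : R := s / (s ^+ 2 + x ^+ 2).

Lemma cauchy_ge0 s x : 0 <= s -> 0 <= cauchy_ker s x.
Proof. by move=> s0; rewrite divr_ge0// addr_ge0 ?sqr_ge0. Qed.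

Lemma cauchyN s x : cauchy_ker s (- x) = cauchy_ker s x.
Proof. by rewrite /cauchy_ker sqrrN. Qed.

Lemma sqrD_gt0 s x : 0 < s -> 0 < s ^+ 2 + x ^+ 2.
Proof. by move=> s0; rewrite ltr_wpDr ?sqr_ge0 ?exprn_gt0. Qed.

Lemma cauchy_shift s x h : 0 < s -> `|h| <= s -> cauchy_ker s (x + h) <= 3 * cauchy_ker s x.
Proof.
move=> s0 hs.
have h2 : h ^+ 2 <= s ^+ 2 by rewrite -[h ^+ 2]real_normK ?num_real// lerXn2r// nnegrE ltW.
rewrite /cauchy_ker ler_pdivrMr ?sqrD_gt0//.
rewrite [leRHS](_ : _ = s * (3 * (s ^+ 2 + (x + h) ^+ 2)) / (s ^+ 2 + x ^+ 2)); last by ring.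
rewrite ler_pdivlMr ?sqrD_gt0// ler_pM2l//.
have := sqr_ge0 (x + 2 * h); nra.
Qed.

Lemma cauchy_scale s t x : 0 < s -> s / 2 <= t -> t <= 2 * s ->
  cauchy_ker t x <= 8 * cauchy_ker s x.
Proof.
move=> s0 st ts; have t0 : 0 < t by lra.
have t2 : s ^+ 2 / 4 <= t ^+ 2 by nra.
rewrite /cauchy_ker ler_pdivrMr ?sqrD_gt0//.
rewrite [leRHS](_ : _ = s * (8 * (t ^+ 2 + x ^+ 2)) / (s ^+ 2 + x ^+ 2)); last by ring.
rewrite ler_pdivlMr ?sqrD_gt0//.
apply: (@le_trans _ _ (2 * s * (s ^+ 2 + x ^+ 2))).
  by rewrite ler_wpM2r// ltW// sqrD_gt0.
rewrite [2 * s]mulrC -mulrA ler_pM2l//.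
have := sqr_ge0 x; lra.
Qed.

Lemma continuous_cauchy s : 0 < s -> continuous (cauchy_ker s).
Proof.
move=> s0 x; apply: cvgM; first exact: cvg_cst.
apply: cvgV; first by rewrite gt_eqF// sqrD_gt0.
apply: cvgD; first exact: cvg_cst.
exact: sqr_continuous.
Qed.

Let integral_cauchy1 : (\int[mu]_x (cauchy_ker 1 x)%:E = pi%:E)%E.
Proof.
rewrite ge0_symfun_integralT//; first last.
- by move=> x /=; rewrite cauchyN.
- exact: continuous_cauchy.
- by move=> x; exact: cauchy_ge0.
rewrite -set_itvcy; under eq_integral do rewrite /cauchy_ker expr1n mul1r -/(oneDsqr _).
by rewrite integral0y_oneDsqr -EFinM; congr EFin; field.
Qed.

Let rintegrable_cauchy1 : rintegrable mu (cauchy_ker 1).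
Proof.
apply: ge0_rintegrableP.
- by apply: continuous_measurable_fun; exact: continuous_cauchy.
- by move=> x; exact: cauchy_ge0.
- by rewrite integral_cauchy1 ltry.
Qed.

Let cauchyE s x y : 0 < s -> cauchy_ker s (x - y) = s^-1 * cauchy_ker 1 (s^-1 * y + - (s^-1 * x)).
Proof.
move=> s0; rewrite /cauchy_ker; field; rewrite ?(gt_eqF s0)//.
by rewrite gt_eqF ?sqrD_gt0.
Qed.

Lemma rintegrable_cauchy s x : 0 < s -> rintegrable mu (fun y => cauchy_ker s (x - y)).
Proof.
move=> s0; under eq_fun do rewrite cauchyE//.
by apply: rintegrableZl; apply: rintegrable_affine; rewrite ?invr_gt0.
Qed.

Lemma Rintegral_cauchy s x : 0 < s -> \int[mu]_y cauchy_ker s (x - y) = pi.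
Proof.
move=> s0; under eq_Rintegral do rewrite cauchyE//.
rewrite RintegralZl//; last by apply: rintegrable_affine; rewrite ?invr_gt0.
rewrite Rintegral_affine ?invr_gt0// invrK mulKf ?gt_eqF//.
by rewrite /Rintegral integral_cauchy1.
Qed.

End cauchy_kernel.

(** * The heat kernel on the line *)

Section heat_kernel1.
Context (R : realType).
Notation mu := (@lebesgue_measure R).
Implicit Types (k m : nat) (t x y : R).

(* The [k]-th space derivative of the heat kernel (4 pi t)^(-1/2) exp(-x^2/(4t)). *)
Definition heat1 k t x : R :=
  (Num.sqrt (4 * pi))^-1 * (Num.sqrt t)^-1 ^+ k.+1 * gauss k (x / Num.sqrt t).

Lemma is_derive_heat1 k t x : is_derive x 1 (heat1 k t) (heat1 k.+1 t x).
Proof.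
have cd : is_derive x 1 (fun x => gauss k (x / Num.sqrt t))
    ((Num.sqrt t)^-1 * gauss k.+1 (x / Num.sqrt t)).
  have hd : is_derive x 1 (fun x => x / Num.sqrt t) (Num.sqrt t)^-1.
    by apply: is_derive_eq; rewrite /GRing.scale/=; ring.
  by have := is_derive_gauss_comp k hd; rewrite [X in is_derive _ _ _ X]mulrC.
rewrite /heat1; apply: is_derive_eq.
rewrite /GRing.scale/= [in RHS]exprS; ring.
Qed.

Lemma is_derive_heat1_time k t x : 0 < t ->
  is_derive t 1 (fun t => heat1 k t x) (heat1 k.+2 t x).
Proof.
move=> t0; have s0 : Num.sqrt t != 0 by rewrite gt_eqF// sqrtr_gt0.
have ds : is_derive t 1 Num.sqrt (2 * Num.sqrt t)^-1 by exact: is_derive1_sqrt.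
have di : is_derive t 1 (fun t => (Num.sqrt t)^-1) (- ((Num.sqrt t)^-1 ^+ 3 / 2)).
  have [d1 d2] := ds; apply: DeriveDef; first exact: derivableV.
  by rewrite deriveV// d2 /GRing.scale/=; field.
have cd : is_derive t 1 (fun t => gauss k (x / Num.sqrt t))
    (x * (- ((Num.sqrt t)^-1 ^+ 3 / 2)) * gauss k.+1 (x / Num.sqrt t)).
  have hd : is_derive t 1 (fun t => x / Num.sqrt t) (x * (- ((Num.sqrt t)^-1 ^+ 3 / 2))).
    by apply: is_derive_eq; rewrite /GRing.scale/=; ring.
  by have := is_derive_gauss_comp k hd; rewrite [X in is_derive _ _ _ X]mulrC.
have hr : is_derive t 1 (fun t => (Num.sqrt t)^-1 ^+ k.+1)
    (- (k.+1%:R / 2 * (Num.sqrt t)^-1 ^+ k.+3)).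
  have -> : (fun t : R => (Num.sqrt t)^-1 ^+ k.+1) = (fun t => (Num.sqrt t)^-1) ^+ k.+1.
    by apply/funext => z; rewrite fctE.
  by apply: is_derive_eq; rewrite /GRing.scale/= !exprS; ring.
rewrite /heat1; apply: is_derive_eq; rewrite gaussSS /GRing.scale/=.
move: (Num.sqrt t)^-1 => r; move: (gauss k.+1 _) (gauss k _) (Num.sqrt _)^-1 => a b c.
rewrite !exprS; ring.
Qed.

(** With z = x / sqrt t, three powers of 1 + |z| are available: two produce the Cauchy kernel at
    scale sqrt t, and the third is kept to absorb a weight |x|^alpha with alpha <= 1. *)
Lemma heat1_bounded k : exists2 C : R, 0 <= C & forall t x, 0 < t ->
  `|heat1 k t x| * (1 + `|x| / Num.sqrt t) <=
  C * (Num.sqrt t)^-1 ^+ k * cauchy_ker (Num.sqrt t) x.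
Proof.
have [C CP] := @gauss_bounded R k 3.
have C0 : 0 <= C by apply: le_trans (CP 0); rewrite mulr_ge0 ?exprn_ge0 ?addr_ge0.
exists ((Num.sqrt (4 * pi))^-1 * C) => [|t x t0].
  by rewrite mulr_ge0// invr_ge0 sqrtr_ge0.
have s0 : 0 < Num.sqrt t by rewrite sqrtr_gt0.
set s := Num.sqrt t in s0 *; pose z := x / s.
have zE : `|x| / s = `|z| by rewrite /z normrM normfV (gtr0_norm s0).
rewrite /heat1 -/s -/z zE.
move: (gauss k z) (CP z) => g gC.
have c0 : 0 <= (Num.sqrt (4 * pi))^-1 * s^-1 ^+ k.+1.
  by rewrite mulr_ge0 ?exprn_ge0 ?invr_ge0 ?sqrtr_ge0// ltW.
rewrite normrM (ger0_norm c0).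
have -> : cauchy_ker s x = s^-1 / (1 + z ^+ 2).
  rewrite /cauchy_ker /z; field.
  by rewrite !gt_eqF ?sqrD_gt0.
rewrite [leLHS](_ : _ = ((Num.sqrt (4 * pi))^-1 * s^-1 ^+ k.+1) * (`|g| * (1 + `|z|))); last by ring.
rewrite [leRHS](_ : _ = ((Num.sqrt (4 * pi))^-1 * s^-1 ^+ k.+1) * (C / (1 + z ^+ 2))); last first.
  by rewrite (exprSr _ k); ring.
rewrite ler_wpM2l// ler_pdivlMr; last by rewrite ltr_pwDl// sqr_ge0.
apply: le_trans gC; rewrite -mulrA ler_wpM2l//.
rewrite -[z ^+ 2]real_normK ?num_real//; have := normr_ge0 z; nra.
Qed.

Lemma integrable_heat1_0 t x : 0 < t -> rintegrable mu (fun y => heat1 0 t (x - y)) /\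
  \int[mu]_y heat1 0 t (x - y) = 1.
Proof.
move=> t0; have s0 : Num.sqrt (2 * t) != 0 by rewrite gt_eqF// sqrtr_gt0; lra.
(* The heat kernel at time t is the normal density of variance 2t. *)
have E y : heat1 0 t (x - y) = normal_pdf x (Num.sqrt (2 * t)) y.
  rewrite normal_pdfE// /heat1 /gauss /normal_peak /normal_fun hornerC mul1r expr1.
  rewrite -invfM -sqrtrM; last by rewrite mulr_ge0// pi_ge0.
  rewrite sqr_sqrtr; last by lra.
  congr ((Num.sqrt _)^-1 * expR _); first by rewrite -mulr_natr; ring.
  rewrite expr_div_n sqr_sqrtr ?(ltW t0)// -mulr_natr; field.
  by rewrite gt_eqF.
under eq_fun do rewrite E.
split; first exact: integrable_normal_pdf.
by rewrite /Rintegral integral_normal_pdf.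
Qed.

Let measurable_rsqrt : measurable_fun setT (fun t : R => (Num.sqrt t)^-1).
Proof.
have -> : (fun t : R => (Num.sqrt t)^-1) = (fun x => x `^ (-1)) \o Num.sqrt.
  by apply/funext => t /=; rewrite powR_inv1// sqrtr_ge0.
apply: measurableT_comp; first exact: measurable_powR.
by apply: continuous_measurable_fun; exact: sqrt_continuous.
Qed.

Lemma continuous_gauss k : continuous (@gauss R k).
Proof.
by move=> x; apply: differentiable_continuous; apply/derivable1_diffP;
  have [] := is_derive_gauss k x.
Qed.

Lemma measurable_heat1 k d (T : measurableType d) (t x : T -> R) :
  measurable_fun setT t -> measurable_fun setT x ->
  measurable_fun setT (fun w => heat1 k (t w) (x w)).
Proof.
move=> mt mx; have mr := measurableT_comp measurable_rsqrt mt.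
apply: measurable_funM.
  by apply: measurable_funM => //; apply: measurable_funX.
apply: (measurableT_comp (continuous_measurable_fun (@continuous_gauss k))).
exact: measurable_funM.
Qed.

Lemma heat1N0 t x : heat1 0 t (- x) = heat1 0 t x.
Proof. by rewrite /heat1 /gauss !hornerC mulNr sqrrN. Qed.

End heat_kernel1.

(** * Integrals of products, over product spaces and row vectors *)

Section product_integral.
Context (R : realType) d1 d2 (T1 : measurableType d1) (T2 : measurableType d2).
Variables (m1 : {sigma_finite_measure set T1 -> \bar R})
  (m2 : {sigma_finite_measure set T2 -> \bar R}).

Lemma rintegrable_prodM (a : T1 -> R) (b : T2 -> R) :
  rintegrable m1 a -> rintegrable m2 b ->
  rintegrable (m1 \x m2)%E (fun p => a p.1 * b p.2).
Proof.
move=> ia ib; have ma := rintegrable_measurable ia; have mb := rintegrable_measurable ib.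
apply: (@rintegrable_prod _ _ _ _ _ _ _ (fun x y => a x * b y)
  (fun x => (\int[m2]_y `|b y|) * `|a x|)).
- apply: measurable_funM.
    by apply: (measurableT_comp ma); exact: measurable_fst.
  by apply: (measurableT_comp mb); exact: measurable_snd.
- by move=> x; apply: rintegrableZl.
- by apply: rintegrableZl; apply: rintegrable_normr.
- move=> x; under eq_Rintegral do rewrite normrM.
  by rewrite RintegralZl// 1?mulrC//; exact: rintegrable_normr.
Qed.

Lemma Rintegral_prodM (a : T1 -> R) (b : T2 -> R) :
  rintegrable m1 a -> rintegrable m2 b ->
  \int[(m1 \x m2)%E]_p (a p.1 * b p.2) = (\int[m1]_x a x) * (\int[m2]_y b y).
Proof.
move=> ia ib; have := RFubini1 (F := fun x y => a x * b y) (rintegrable_prodM ia ib).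
move=> /= <-; by under eq_Rintegral do rewrite RintegralZl//; rewrite RintegralZr.
Qed.

End product_integral.

Section cons_integral.
Context (R : realType) (n : nat).
Notation mu := (@lebesgue_measure R).
Notation lam := (@lebesgue_rV R).
Implicit Type f : 'rV[R]_n.+1 -> R.

Lemma rintegrable_rV_cons f : measurable_fun setT f ->
  rintegrable (mu \x lam n)%E (f \o rV_cons) -> rintegrable (lam n.+1) f.
Proof.
move=> mf fi; apply: (integrable_pushforward measurable_rV_cons) => //.
exact/measurable_EFinP.
Qed.

Lemma Rintegral_rV_cons f : measurable_fun setT f ->
  rintegrable (mu \x lam n)%E (f \o rV_cons) ->
  \int[lam n.+1]_x f x = \int[(mu \x lam n)%E]_p f (rV_cons p).
Proof.
move=> mf fi; rewrite /Rintegral (integral_pushforward measurable_rV_cons) //.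
exact/measurable_EFinP.
Qed.

End cons_integral.

Section complex_integral.
Local Open Scope complex_scope.
Context (R : realType).

Section defs.
Context d (T : measurableType d) (mu : {measure set T -> \bar R}).

Definition Cint (phi : T -> R[i]) : R[i] :=
  (\int[mu]_x complex.Re (phi x)) +i* (\int[mu]_x complex.Im (phi x)).

Definition Cintegrable (phi : T -> R[i]) :=
  rintegrable mu (fun x => complex.Re (phi x)) /\
  rintegrable mu (fun x => complex.Im (phi x)).

End defs.

Lemma complex_ReM (x y : R[i]) : complex.Re (x * y) =
  complex.Re x * complex.Re y - complex.Im x * complex.Im y.
Proof. by case: x; case: y. Qed.

Lemma complex_ImM (x y : R[i]) : complex.Im (x * y) =
  complex.Re x * complex.Im y + complex.Im x * complex.Re y.
Proof. by case: x => a b; case: y => c e /=. Qed.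

Section prod.
Context d1 d2 (T1 : measurableType d1) (T2 : measurableType d2).
Variables (m1 : {sigma_finite_measure set T1 -> \bar R})
  (m2 : {sigma_finite_measure set T2 -> \bar R}).

Lemma Cintegrable_prodM (a : T1 -> R[i]) (b : T2 -> R[i]) :
  Cintegrable m1 a -> Cintegrable m2 b ->
  Cintegrable (m1 \x m2)%E (fun p => a p.1 * b p.2).
Proof.
move=> [ra ia] [rb ib]; split.
  by under eq_fun do rewrite complex_ReM; apply: rintegrableB;
    apply: (rintegrable_prodM (a := fun x => _ (a x)) (b := fun y => _ (b y))).
by under eq_fun do rewrite complex_ImM; apply: rintegrableD;
  apply: (rintegrable_prodM (a := fun x => _ (a x)) (b := fun y => _ (b y))).
Qed.

Lemma Cint_prodM (a : T1 -> R[i]) (b : T2 -> R[i]) :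
  Cintegrable m1 a -> Cintegrable m2 b ->
  Cint (m1 \x m2)%E (fun p => a p.1 * b p.2) = Cint m1 a * Cint m2 b.
Proof.
move=> [ra ia] [rb ib]; rewrite /Cint.
under eq_Rintegral do rewrite complex_ReM.
under [X in _ +i* X]eq_Rintegral do rewrite complex_ImM.
have rr := rintegrable_prodM ra rb; have ii := rintegrable_prodM ia ib.
have ri := rintegrable_prodM ra ib; have ir := rintegrable_prodM ia rb.
rewrite RintegralB// RintegralD//.
by rewrite (Rintegral_prodM ra rb) (Rintegral_prodM ia ib) (Rintegral_prodM ra ib)
  (Rintegral_prodM ia rb).
Qed.

End prod.

Lemma Cintegrable_measurable d (T : measurableType d) (mu : {measure set T -> \bar R}) phi :
  Cintegrable mu phi -> measurable_fun setT (fun x => complex.Re (phi x)) /\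
    measurable_fun setT (fun x => complex.Im (phi x)).
Proof. by move=> [/rintegrable_measurable ? /rintegrable_measurable ?]. Qed.

Lemma Cint_rV0 (c : R[i]) : Cintegrable (lebesgue_rV 0) (fun=> c) /\
  Cint (lebesgue_rV 0) (fun=> c) = c.
Proof.
have h (r : R) : rintegrable (@lebesgue_rV R 0) (fun=> r).
  apply/integrableP; split; first exact/measurable_EFinP.
  by rewrite /= integral_cst//= diracE mem_set// mule1 ltry.
split; first by split; exact: h.
have e' (r : R) : \int[lebesgue_rV 0]_x r = r.
  by rewrite /Rintegral integral_dirac// diracE mem_set// mul1e.
by case: c => a b; rewrite /Cint /= !e'.
Qed.

Let prod_rV_cons n (k : 'I_n.+1 -> R -> R[i]) p :
  \prod_i k i (rV_cons p ord0 i) =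
  k ord0 p.1 * \prod_i k (lift ord0 i) (p.2 ord0 i).
Proof.
rewrite big_ord_recl rV_cons0; congr (_ * _).
by apply: eq_bigr => i _; rewrite rV_consS.
Qed.

(** Fubini, by induction on the dimension along [rV_cons]. Complex factors are allowed because the
    integrand of the Fourier transform of the heat kernel is such a product. *)
Lemma Cint_rV_prod n (k : 'I_n -> R -> R[i]) :
  (forall i, Cintegrable (@lebesgue_measure R) (k i)) ->
  Cintegrable (lebesgue_rV n) (fun x => \prod_i k i (x ord0 i)) /\
  Cint (lebesgue_rV n) (fun x => \prod_i k i (x ord0 i)) =
    \prod_i Cint (@lebesgue_measure R) (k i).
Proof.
elim: n k => [|n IH] k ki.
  have -> : (fun x : 'rV[R]_0 => \prod_i k i (x ord0 i)) = fun=> 1.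
    by apply/funext => x; rewrite big_ord0.
  by rewrite big_ord0; exact: Cint_rV0.
have [IH1 IH2] := IH _ (fun i => ki (lift ord0 i)).
pose K (p : R * 'rV[R]_n) := k ord0 p.1 * \prod_i k (lift ord0 i) (p.2 ord0 i).
have KI : Cintegrable (@lebesgue_measure R \x lebesgue_rV n)%E K.
  exact: (Cintegrable_prodM (ki ord0) IH1).
have [mR mI] := Cintegrable_measurable KI.
have uK (x : 'rV[R]_n.+1) : \prod_i k i (x ord0 i) = K (rV_uncons x).
  transitivity (\prod_i k i (rV_cons (rV_uncons x) ord0 i)); last exact: prod_rV_cons.
  apply: eq_bigr => i _; congr (k _ _).
  by case: (unliftP ord0 i) => [j ->|->]; rewrite ?rV_consS ?rV_cons0//= mxE.
have mR' : measurable_fun setT (fun x : 'rV[R]_n.+1 => complex.Re (\prod_i k i (x ord0 i))).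
  by under eq_fun do rewrite uK; apply: (measurableT_comp mR); exact: measurable_rV_uncons.
have mI' : measurable_fun setT (fun x : 'rV[R]_n.+1 => complex.Im (\prod_i k i (x ord0 i))).
  by under eq_fun do rewrite uK; apply: (measurableT_comp mI); exact: measurable_rV_uncons.
have ER p : complex.Re (\prod_i k i (rV_cons p ord0 i)) = complex.Re (K p).
  by rewrite prod_rV_cons.
have EI p : complex.Im (\prod_i k i (rV_cons p ord0 i)) = complex.Im (K p).
  by rewrite prod_rV_cons.
have iR : rintegrable (@lebesgue_measure R \x lebesgue_rV n)%E
    ((fun x : 'rV[R]_n.+1 => complex.Re (\prod_i k i (x ord0 i))) \o rV_cons).
  by rewrite (_ : _ \o rV_cons = fun p => complex.Re (K p)); [case: KI|apply/funext].
have iI : rintegrable (@lebesgue_measure R \x lebesgue_rV n)%E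
    ((fun x : 'rV[R]_n.+1 => complex.Im (\prod_i k i (x ord0 i))) \o rV_cons).
  by rewrite (_ : _ \o rV_cons = fun p => complex.Im (K p)); [case: KI|apply/funext].
split; first by split; apply: rintegrable_rV_cons.
rewrite /Cint (Rintegral_rV_cons mR' iR) (Rintegral_rV_cons mI' iI).
transitivity (Cint (@lebesgue_measure R \x lebesgue_rV n)%E K).
  by congr (_ +i* _); apply: eq_Rintegral => p _; [exact: ER|exact: EI].
by rewrite (Cint_prodM (ki ord0) IH1) IH2 big_ord_recl.
Qed.

Lemma Rintegral_rV_prod n (k : 'I_n -> R -> R) :
  (forall i, rintegrable (@lebesgue_measure R) (k i)) ->
  rintegrable (lebesgue_rV n) (fun x => \prod_i k i (x ord0 i)) /\
  \int[lebesgue_rV n]_x \prod_i k i (x ord0 i) =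
    \prod_i \int[@lebesgue_measure R]_y k i y.
Proof.
move=> ki; have ki' i : Cintegrable (@lebesgue_measure R) (fun y => (k i y)%:C).
  by split; [exact: ki|exact: rintegrable0].
have [[h1 _] h2] := Cint_rV_prod ki'.
have E (x : 'rV[R]_n) : complex.Re (\prod_i (k i (x ord0 i))%:C) = \prod_i k i (x ord0 i).
  by rewrite -rmorph_prod.
split; first by move: h1; under eq_fun do rewrite E.
move/(congr1 (@complex.Re R)) : h2; rewrite /Cint /=.
under eq_Rintegral do rewrite E.
move=> ->.
rewrite (eq_bigr (fun i => (\int[@lebesgue_measure R]_y k i y)%:C)) => [|i _].
  by rewrite -rmorph_prod.
by congr (_ +i* _); rewrite Rintegral_cst// mul0r.
Qed.

End complex_integral.

Lemma is_derive_line (R : realType) (V W : normedModType R) (f : V -> W) x v d :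
  is_derive (0 : R) 1 (fun h : R => f (x + h *: v)) d -> is_derive x v f d.
Proof.
move=> [h1 h2].
have E : (fun h : R => h^-1 *: ((f \o shift x) (h *: v) - f x)) =
  (fun h : R => h^-1 *: (((fun h : R => f (x + h *: v)) \o shift 0) (h *: 1) - f (x + 0 *: v))).
  apply/funext => h /=; rewrite scale0r !addr0 [x + _]addrC.
  by rewrite /GRing.scale/= mulr1.
by apply: DeriveDef; rewrite /derivable /derive E.
Qed.

Lemma is_derive_mulr (R : realType) (f : R -> R) (x d c : R) :
  is_derive x 1 f d -> is_derive x 1 (fun x => f x * c) (d * c).
Proof. by move=> fd; apply: is_derive_eq; rewrite /GRing.scale/=; ring. Qed.

(** The product rule; [uniq r] ensures that the condition [j != i] removes exactly one factor. *)
Lemma is_derive_prod (R : realType) (I : eqType) (r : seq I) (f f' : I -> R -> R) (t : R) :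
  uniq r -> (forall i, is_derive t 1 (f i) (f' i t)) ->
  is_derive t 1 (fun t => \prod_(i <- r) f i t)
    (\sum_(i <- r) f' i t * \prod_(j <- r | j != i) f j t).
Proof.
move=> + fd; elim: r => [_|i r IH /= /andP[ir ur]].
  under eq_fun do rewrite big_nil.
  by rewrite big_nil; exact: is_derive_cst.
under eq_fun do rewrite big_cons.
have := IH ur => {}IH.
apply: is_derive_eq.
rewrite /GRing.scale/= !big_cons eqxx/= addrC; congr (_ + _).
  rewrite mulrC; congr (_ * _); rewrite [RHS]big_seq_cond [LHS]big_seq.
  apply: eq_bigl => j; case: (boolP (j \in r)) => //= jr.
  by apply/esym; apply: contra ir => /eqP <-.
rewrite mulr_sumr [LHS]big_seq [RHS]big_seq; apply: eq_bigr => j jr.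
rewrite big_cons ifT; first by ring.
by apply: contra ir => /eqP ->.
Qed.

(** * The heat kernel in several variables and convolution with it *)

Section heat_kernel.
Context (R : realType) (n : nat).
Notation lam := (@lebesgue_rV R n).
Notation Rn := 'rV[R]_n.
Implicit Types (g : seq 'I_n) (s t : R) (x y z : Rn) (u f : Rn -> R) (i j : 'I_n).

(* The heat kernel is a product, so its derivative along the word [g] only
   depends on the number of occurrences of each coordinate. *)
Definition heat g t z : R := \prod_i heat1 (count_mem i g) t (z ord0 i).

Definition cauchyn s z : R := \prod_i cauchy_ker s (z ord0 i).

Lemma sum_count_mem g : (\sum_i count_mem i g)%N = size g.
Proof.
elim: g => [|i g IH] /=; first by rewrite big1.
by rewrite big_split/= IH (bigD1 i)//= eqxx big1 => [|j /negPf]; rewrite 1?eq_sym// => ->.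
Qed.

Lemma cauchyn_ge0 s z : 0 <= s -> 0 <= cauchyn s z.
Proof. by move=> s0; apply: prodr_ge0 => i _; exact: cauchy_ge0. Qed.

Lemma cauchyn_shift s z h i : 0 < s -> `|h| <= s ->
  cauchyn s (z + h *: delta_mx ord0 i) <= 3 ^+ n * cauchyn s z.
Proof.
move=> s0 hs; rewrite -[X in 3 ^+ X]card_ord -prodr_const -big_split/=.
apply: ler_prod => j _; rewrite cauchy_ge0 ?(ltW s0)//= !mxE eqxx /=.
apply: cauchy_shift => //; case: (j == i); rewrite ?mulr1// mulr0 normr0 ltW//.
Qed.

Lemma cauchyn_scale s t z : 0 < s -> s / 2 <= t -> t <= 2 * s ->
  cauchyn t z <= 8 ^+ n * cauchyn s z.
Proof.
move=> s0 st ts; rewrite -[X in 8 ^+ X]card_ord -prodr_const -big_split/=.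
apply: ler_prod => j _; rewrite cauchy_ge0 ?cauchy_scale//; lra.
Qed.

Lemma Rintegral_cauchyn s x : 0 < s -> rintegrable lam (fun y => cauchyn s (x - y)) /\
  \int[lam]_y cauchyn s (x - y) = pi ^+ n.
Proof.
move=> s0; have E y : cauchyn s (x - y) = \prod_i cauchy_ker s (x ord0 i - y ord0 i).
  by apply: eq_bigr => i _; rewrite !mxE.
under eq_fun do rewrite E.
have [h1 h2] := @Rintegral_rV_prod R n (fun i yi => cauchy_ker s (x ord0 i - yi))
  (fun i => rintegrable_cauchy _ s0).
split => //; rewrite h2 (eq_bigr (fun=> pi)) ?prodr_const ?card_ord//.
by move=> i _; exact: Rintegral_cauchy.
Qed.

Lemma heat_bounded g : exists2 C : R, 0 <= C & forall t z, 0 < t ->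
  `|heat g t z| * \prod_i (1 + `|z ord0 i| / Num.sqrt t) <=
  C * (Num.sqrt t)^-1 ^+ size g * cauchyn (Num.sqrt t) z.
Proof.
have [C C0 CP] : exists2 C : nat -> R, (forall k, 0 <= C k) &
  forall k (t x : R), 0 < t -> `|heat1 k t x| * (1 + `|x| / Num.sqrt t) <=
  C k * (Num.sqrt t)^-1 ^+ k * cauchy_ker (Num.sqrt t) x.
  have /choice[C CP] : forall k, exists C : R, 0 <= C /\ forall t x : R, 0 < t ->
    `|heat1 k t x| * (1 + `|x| / Num.sqrt t) <=
    C * (Num.sqrt t)^-1 ^+ k * cauchy_ker (Num.sqrt t) x.
    by move=> k; have [C C0 CP] := heat1_bounded R k; exists C.
  by exists C => k; have [] := CP k.
exists (\prod_i C (count_mem i g)) => [|t z t0]; first exact: prodr_ge0.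
(* The powers of 1 / sqrt t of the factors add up to [size g]. *)
rewrite -sum_count_mem -prodrXr normr_prod -!big_split/=.
apply: ler_prod => i _; by rewrite mulr_ge0 ?CP// addr_ge0// divr_ge0 ?sqrtr_ge0.
Qed.

Lemma heat_le g : exists2 C : R, 0 <= C & forall t z, 0 < t ->
  `|heat g t z| <= C * (Num.sqrt t)^-1 ^+ size g * cauchyn (Num.sqrt t) z.
Proof.
have [C C0 CP] := heat_bounded g; exists C => // t z t0; apply: le_trans (CP t z t0).
rewrite ler_peMr// -[leLHS](@big1 _ 1 *%R 'I_n (index_enum _) predT (fun=> 1))//.
by apply: ler_prod => i _; rewrite ler01 lerDl divr_ge0 ?sqrtr_ge0.
Qed.

Lemma measurable_heat g d (T : measurableType d) (t : T -> R) (z : T -> Rn) :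
  measurable_fun setT t -> (forall i, measurable_fun setT (fun w => z w ord0 i)) ->
  measurable_fun setT (fun w => heat g (t w) (z w)).
Proof.
move=> mt mz; apply: measurable_prod => i _; exact: measurable_heat1.
Qed.

Lemma measurable_coordB x i : measurable_fun setT (fun y : Rn => (x - y) ord0 i : R).
Proof.
under eq_fun do rewrite !mxE.
by apply: measurable_funB => //; exact: measurable_rV_coord.
Qed.

Lemma is_derive_heat g t z i (h : R) :
  is_derive h 1 (fun h => heat g t (z + h *: delta_mx ord0 i))
    (heat (i :: g) t (z + h *: delta_mx ord0 i)).
Proof.
have E g' h' : heat g' t (z + h' *: delta_mx ord0 i) =
    heat1 (count_mem i g') t (z ord0 i + h') *
    \prod_(j | j != i) heat1 (count_mem j g') t (z ord0 j).
  rewrite /heat (bigD1 i)//= !mxE !eqxx mulr1; congr (_ * _).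
  by apply: eq_bigr => j ji; rewrite !mxE (negPf ji) andbF mulr0 addr0.
under eq_fun do rewrite E.
rewrite E /= eqxx add1n.
have -> : \prod_(j < n | j != i) heat1 ((i == j) + count_mem j g) t (z ord0 j) =
    \prod_(j < n | j != i) heat1 (count_mem j g) t (z ord0 j).
  by apply: eq_bigr => j ji; rewrite eq_sym (negPf ji).
have hd : is_derive h 1 (fun h => z ord0 i + h) 1.
  by have := is_deriveD (is_derive_cst (z ord0 i) h 1) (is_derive_id h 1); rewrite add0r.
have := is_derive1_comp (is_derive_heat1 (count_mem i g) t (z ord0 i + h)) hd.
rewrite mulr1 => gd; apply: is_derive_eq; rewrite /GRing.scale/=; ring.
Qed.

Lemma is_derive_heat_time g t z : 0 < t ->
  is_derive t 1 (fun t => heat g t z) (\sum_i heat (i :: i :: g) t z).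
Proof.
move=> t0; apply: is_derive_eq.
  by apply: (is_derive_prod (f' := fun i t => heat1 (count_mem i g).+2 t (z ord0 i)));
    [exact: index_enum_uniq|move=> i; exact: is_derive_heat1_time].
apply: eq_bigr => i _; rewrite /heat [RHS](bigD1 i)//= eqxx !add1n; congr (_ * _).
by apply: eq_bigr => j ji; rewrite eq_sym (negPf ji) !add0n.
Qed.

(** The derivative D^g u_t, with all derivatives placed on the kernel; [is_derive_heatconv]
    justifies this reading. *)
Definition heatconv g u t x : R := \int[lam]_y (heat g t (x - y) * u y).

Section bounded.
Variables (u : Rn -> R) (M : R).
Hypotheses (mu : measurable_fun setT u) (uM : forall x, `|u x| <= M).

Let M0 : 0 <= M. Proof. by apply: le_trans (uM 0). Qed.

Let mhu g t x : measurable_fun setT (fun y => heat g t (x - y) * u y).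
Proof.
by apply: measurable_funM => //; apply: measurable_heat => //; exact: measurable_coordB.
Qed.

Lemma rintegrable_heat g t x : 0 < t -> rintegrable lam (fun y => heat g t (x - y) * u y).
Proof.
move=> t0; have [C C0 CP] := heat_le g; have s0 : 0 < Num.sqrt t by rewrite sqrtr_gt0.
have [ci _] := Rintegral_cauchyn x s0.
apply: (le_rintegrable (mhu _ _ _)
  (rintegrableZl (C * (Num.sqrt t)^-1 ^+ size g * M) ci)) => y.
by rewrite normrM mulrAC; apply: ler_pM => //; exact: CP.
Qed.

(** Increments below sqrt t do not exceed the scale of the kernel, so [cauchyn_shift] gives a
    majorant independent of the increment. *)
Lemma is_derive_heatconv g t x i : 0 < t ->
  is_derive x (delta_mx ord0 i) (heatconv g u t) (heatconv (i :: g) u t x).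
Proof.
move=> t0; apply: is_derive_line.
have s0 : 0 < Num.sqrt t by rewrite sqrtr_gt0.
have [C C0 CP] := heat_le (i :: g).
have [ci _] := Rintegral_cauchyn x s0.
pose e : Rn := delta_mx ord0 i.
have := @is_derive_Rintegral R _ _ lam (fun h y => heat g t (x + h *: e - y) * u y)
  (fun h y => heat (i :: g) t (x + h *: e - y) * u y) 0 (Num.sqrt t)
  (fun y => C * (Num.sqrt t)^-1 ^+ size (i :: g) * (3 ^+ n) * M * cauchyn (Num.sqrt t) (x - y)) s0.
rewrite scale0r addr0; apply.
- move=> h y _; have E h' : x + h' *: e - y = (x - y) + h' *: e by rewrite addrAC.
  under eq_fun do rewrite E; rewrite E.
  have hd := is_derive_heat g t (x - y) i h.
  exact: is_derive_mulr.
- by move=> h _; exact: rintegrable_heat.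
- exact: rintegrableZl.
- move=> h y; rewrite subr0 => hs; rewrite addrAC normrM.
  rewrite [leRHS](_ : _ = (C * (Num.sqrt t)^-1 ^+ size (i :: g)
    * (3 ^+ n * cauchyn (Num.sqrt t) (x - y))) * M); last by ring.
  apply: ler_pM => //; apply: le_trans (CP _ _ t0) _.
  rewrite ler_wpM2l//; last by apply: cauchyn_shift => //; exact: ltW.
  by rewrite mulr_ge0// exprn_ge0// invr_ge0 ltW.
Qed.

Lemma is_derive_heatconv_time g t x : 0 < t ->
  is_derive t 1 (fun t => heatconv g u t x) (\sum_i heatconv (i :: i :: g) u t x).
Proof.
move=> t0; have s0 : 0 < Num.sqrt t by rewrite sqrtr_gt0.
have /choice[C CP] : forall i, exists C : R, 0 <= C /\ forall t z, 0 < t ->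
  `|heat (i :: i :: g) t z| <= C * (Num.sqrt t)^-1 ^+ (size g).+2 * cauchyn (Num.sqrt t) z.
  by move=> i; have [C ? ?] := heat_le (i :: i :: g); exists C.
have [ci _] := Rintegral_cauchyn x s0.
have t20 : 0 < t / 2 by lra.
(* For |t' - t| < t/2 the scale sqrt t' stays within a factor 2 of sqrt t, the range covered by
   [cauchyn_scale]. *)
have nr t' : `|t' - t| < t / 2 -> [/\ 0 < t', Num.sqrt t / 2 <= Num.sqrt t' &
    Num.sqrt t' <= 2 * Num.sqrt t].
  rewrite ltr_norml => /andP[h1 h2]; have t'0 : 0 < t' by lra.
  have e1 : Num.sqrt t / 2 = Num.sqrt (t / 4).
    rewrite sqrtrM ?(ltW t0)// (_ : 4^-1 = 2^-1 ^+ 2); last by field.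
    by rewrite sqrtr_sqr ger0_norm// invr_ge0.
  have e2 : 2 * Num.sqrt t = Num.sqrt (4 * t).
    rewrite sqrtrM// (_ : 4 = 2 ^+ 2 :> R); last by ring.
    by rewrite sqrtr_sqr ger0_norm.
  split => //; [rewrite e1|rewrite e2]; rewrite ler_sqrt; lra.
have := @is_derive_Rintegral R _ _ lam (fun t y => heat g t (x - y) * u y)
  (fun t y => (\sum_i heat (i :: i :: g) t (x - y)) * u y) t (t / 2)
  (fun y => (\sum_i C i) * (2 * (Num.sqrt t)^-1) ^+ (size g).+2 * 8 ^+ n * M *
     cauchyn (Num.sqrt t) (x - y)) t20.
have -> : \sum_i heatconv (i :: i :: g) u t x =
    \int[lam]_y ((\sum_i heat (i :: i :: g) t (x - y)) * u y).
  rewrite -Rintegral_sum; last by move=> i; exact: rintegrable_heat.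
  by apply: eq_Rintegral => y _; rewrite mulr_suml.
apply.
- move=> t' y /nr[t'0 _ _]; have hd := is_derive_heat_time g (x - y) t'0.
  exact: is_derive_mulr.
- by move=> t' /nr[t'0 _ _]; exact: rintegrable_heat.
- exact: rintegrableZl.
- move=> t' y /nr[t'0 st ts]; rewrite normrM.
  rewrite [leRHS](_ : _ = (\sum_i C i * (2 * (Num.sqrt t)^-1) ^+ (size g).+2 *
     (8 ^+ n * cauchyn (Num.sqrt t) (x - y))) * M); last by rewrite -!mulr_suml; ring.
  apply: ler_pM => //; apply: le_trans (ler_norm_sum _ _ _) _.
  apply: ler_sum => i _; apply: le_trans ((CP i).2 _ _ t'0) _.
  have s'0 : 0 < Num.sqrt t' by rewrite sqrtr_gt0.
  apply: ler_pM; last exact: cauchyn_scale.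
  + by rewrite mulr_ge0 ?(CP i).1// exprn_ge0// invr_ge0 ltW.
  + by apply: cauchyn_ge0; exact: ltW.
  + rewrite ler_wpM2l ?(CP i).1//; apply: lerXn2r; rewrite ?nnegrE ?mulr_ge0 ?invr_ge0 ?(ltW s0) ?(ltW s'0)//.
    by rewrite ler_pdivlMr// mulrC ler_pdivrMr//; lra.
Qed.

End bounded.

End heat_kernel.

Section enorm.
Context (R : realType) (n : nat).
Implicit Types x y z : 'rV[R]_n.

Lemma dot_ge0 x : 0 <= dot x x.
Proof. by apply: sumr_ge0 => i _; rewrite -expr2 sqr_ge0. Qed.

Lemma enorm_ge0 x : 0 <= enorm x.
Proof. exact: sqrtr_ge0. Qed.

Lemma normr_coord_le x i : `|x ord0 i| <= enorm x.
Proof.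
rewrite -sqrtr_sqr /enorm ler_sqrt ?dot_ge0// /dot (bigD1 i)//= -expr2 lerDl.
by apply: sumr_ge0 => j _; rewrite -expr2 sqr_ge0.
Qed.

Lemma enorm_le_sum x : enorm x <= \sum_i `|x ord0 i|.
Proof.
have s0 : 0 <= \sum_i `|x ord0 i| by exact: sumr_ge0.
rewrite -[leRHS]ger0_norm// -sqrtr_sqr ler_sqrt ?sqr_ge0// expr2 mulr_suml.
apply: ler_sum => i _; apply: le_trans (ler_norm _) _; rewrite normrM ler_wpM2l//.
by rewrite (bigD1 i)//= lerDl sumr_ge0.
Qed.

Lemma sum_coord_le x : \sum_i `|x ord0 i| <= n%:R * enorm x.
Proof.
apply: (@le_trans _ _ (\sum_(i < n) enorm x)); last by rewrite sumr_const card_ord mulr_natl.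
by apply: ler_sum => i _; exact: normr_coord_le.
Qed.

Lemma enorm_gt0 x : x != 0 -> 0 < enorm x.
Proof.
move=> x0; rewrite lt_neqAle enorm_ge0 andbT eq_sym.
apply: contra x0 => /eqP e0; apply/eqP/rowP => i; rewrite mxE.
by apply/normr0_eq0/eqP; rewrite eq_le normr_ge0 andbT -e0 normr_coord_le.
Qed.

End enorm.

Lemma sum_le_prod1D (R : realType) (I : Type) (r : seq I) (a : I -> R) :
  (forall i, 0 <= a i) -> 1 + \sum_(i <- r) a i <= \prod_(i <- r) (1 + a i).
Proof.
move=> a0; elim: r => [|i r IH]; first by rewrite !big_nil addr0.
rewrite !big_cons; have := a0 i.
have s0 : 0 <= \sum_(j <- r) a j by exact: sumr_ge0.
move=> ai; apply: (@le_trans _ _ ((1 + a i) * (1 + \sum_(j <- r) a j))); first by nra.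
by rewrite ler_wpM2l// addr_ge0.
Qed.

(** * Decay in time of the derivatives of u_t and f_t *)

Section heatconv_bounds.
Context (R : realType) (n : nat).
Notation lam := (@lebesgue_rV R n).
Notation Rn := 'rV[R]_n.
Implicit Types (g : seq 'I_n) (s t M N : R) (x y z : Rn) (u f : Rn -> R) (i j : 'I_n).

Lemma sqrtV_exprE t k : 0 < t -> (Num.sqrt t)^-1 ^+ k = t `^ (- (k%:R / 2)).
Proof.
move=> t0; rewrite -powR12_sqrt ?ltW// -powRN -powR_mulrn ?powR_ge0// -powRrM.
by congr (_ `^ _); ring.
Qed.

(** The kernel has mass 1. Its derivatives have mass 0, because they give the derivatives of the
    convolution with the constant 1, which is constant. *)
Lemma heatconv1 g t x : 0 < t -> heatconv g (fun=> 1) t x = (g == [::])%:R.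
Proof.
move=> t0; elim: g x => [|i g IH] x.
  rewrite eqxx /heatconv.
  have E y : heat [::] t (x - y) * 1 = \prod_i heat1 0 t (x ord0 i - y ord0 i).
    by rewrite mulr1; apply: eq_bigr => i _; rewrite !mxE.
  under eq_Rintegral do rewrite E.
  have [_ ->] := @Rintegral_rV_prod R n (fun i yi => heat1 0 t (x ord0 i - yi))
    (fun i => (integrable_heat1_0 _ t0).1).
  by rewrite big1// => i _; exact: (integrable_heat1_0 _ t0).2.
have m1 : measurable_fun setT (fun _ : Rn => 1 : R) by exact: measurable_cst.
have b1 (y : Rn) : `|1 : R| <= 1 by rewrite normr1.
have [_ <-] := is_derive_heatconv m1 b1 g x i t0.
by rewrite (_ : heatconv g _ t = cst (g == [::])%:R) ?derive_cst//; exact/funext.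
Qed.

Lemma heatconv_le g : exists2 C : R, 0 <= C & forall u M t x,
  measurable_fun setT u -> (forall y, `|u y| <= M) -> 0 < t ->
  `|heatconv g u t x| <= C * M * t `^ (- ((size g)%:R / 2)).
Proof.
have [C C0 CP] := @heat_le R n g; exists (C * pi ^+ n) => [|u M t x mu uM t0].
  by rewrite mulr_ge0// exprn_ge0// pi_ge0.
have s0 : 0 < Num.sqrt t by rewrite sqrtr_gt0.
have [ci ciE] := Rintegral_cauchyn x s0.
rewrite -sqrtV_exprE// [leRHS](_ : _ = C * (Num.sqrt t)^-1 ^+ size g * M * pi ^+ n); last by ring.
rewrite -ciE -RintegralZl//; apply: le_norm_Rintegral.
- apply: measurable_funM => //; apply: measurable_heat => //; exact: measurable_coordB.
- exact: rintegrableZl.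
- by move=> y; rewrite normrM mulrAC; apply: ler_pM => //; exact: CP.
Qed.

(** The norm of z is at most sqrt t times the product P of the factors 1 + |z_i| / sqrt t. Since P
    >= 1 and [al <= 1], the power [al] costs at most one factor P, and [heat_bounded] holds exactly
    that factor in reserve. *)
Lemma powR_enorm_le (al : R) t z : 0 <= al <= 1 -> 0 < t ->
  enorm z `^ al <= t `^ (al / 2) * \prod_i (1 + `|z ord0 i| / Num.sqrt t).
Proof.
move=> /andP[al0 al1] t0; have s0 : 0 < Num.sqrt t by rewrite sqrtr_gt0.
set P := \prod_i _.
have a0 i : 0 <= `|z ord0 i| / Num.sqrt t by rewrite divr_ge0// ltW.
have P1 := sum_le_prod1D (index_enum 'I_n) a0; rewrite -/P in P1.
have S0 : 0 <= \sum_i (`|z ord0 i| / Num.sqrt t) by exact: sumr_ge0.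
have zP : enorm z <= Num.sqrt t * P.
  apply: le_trans (enorm_le_sum z) _.
  apply: (@le_trans _ _ (Num.sqrt t * (\sum_i (`|z ord0 i| / Num.sqrt t)))).
    by rewrite -mulr_suml mulrCA divff ?mulr1// gt_eqF.
  by rewrite ler_wpM2l// ?(ltW s0)//; lra.
have P0 : 0 <= P by lra.
apply: le_trans (ge0_ler_powR al0 _ _ zP) _; rewrite ?nnegrE ?enorm_ge0 ?mulr_ge0 ?(ltW s0)//.
rewrite powRM ?(ltW s0)//; apply: ler_pM; rewrite ?powR_ge0//.
  by rewrite -powR12_sqrt ?(ltW t0)// -powRrM mulrC.
by apply: ler1_powR => //; lra.
Qed.

(** A derivative of the kernel has mass 0, so f(y) may be replaced by f(y) - f(x). Its size |x -
    y|^alpha is then converted into t^(alpha/2) by [powR_enorm_le]. *)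
Lemma heatconv_holder_le i g (al : R) : 0 <= al <= 1 ->
  exists2 C : R, 0 <= C & forall f M N t x,
  measurable_fun setT f -> (forall y, `|f y| <= M) ->
  (forall x y, `|f x - f y| <= N * enorm (x - y) `^ al) -> 0 < t ->
  `|heatconv (i :: g) f t x| <= C * N * t `^ ((al - (size (i :: g))%:R) / 2).
Proof.
move=> al01; have [C C0 CP] := @heat_bounded R n (i :: g).
exists (C * pi ^+ n) => [|f M N t x mf fM fN t0].
  by rewrite mulr_ge0// exprn_ge0// pi_ge0.
have s0 : 0 < Num.sqrt t by rewrite sqrtr_gt0.
(* The letter [i] shows that the dimension is positive, so there are two distinct points, and the
   Hoelder bound between them forces N >= 0. *)
have N0 : 0 <= N.
  pose e : Rn := const_mx 1.
  have e0 : 0 < enorm (e - 0).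
    rewrite subr0; apply: enorm_gt0; apply/eqP => /matrixP /(_ ord0 i).
    by rewrite !mxE => /eqP; rewrite oner_eq0.
  have := le_trans (normr_ge0 _) (fN e 0).
  by rewrite pmulr_lge0// powR_gt0.
have [ci ciE] := Rintegral_cauchyn x s0.
have m1 : measurable_fun setT (fun _ : Rn => 1 : R) by exact: measurable_cst.
have b1 (y : Rn) : `|1 : R| <= 1 by rewrite normr1.
have -> : heatconv (i :: g) f t x = \int[lam]_y (heat (i :: g) t (x - y) * (f y - f x)).
  transitivity (heatconv (i :: g) f t x - heatconv (i :: g) (fun=> 1) t x * f x).
    by rewrite heatconv1//= mul0r subr0.
  rewrite /heatconv -RintegralZr//; last exact: (rintegrable_heat m1 b1).
  rewrite -RintegralB//; first by apply: eq_Rintegral => y _; ring.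
    exact: (rintegrable_heat mf fM).
  under eq_fun do rewrite mulrC; apply: rintegrableZl; exact: (rintegrable_heat m1 b1).
rewrite mulrDl powRD; last by rewrite (gt_eqF t0) implybT.
rewrite mulNr -sqrtV_exprE//.
rewrite [leRHS](_ : _ = (t `^ (al / 2) * C * (Num.sqrt t)^-1 ^+ size (i :: g) * N) * pi ^+ n); last by ring.
rewrite -ciE -RintegralZl//; apply: le_norm_Rintegral.
- apply: measurable_funM; last by apply: measurable_funB.
  by apply: measurable_heat => //; exact: measurable_coordB.
- exact: rintegrableZl.
move=> y; rewrite normrM distrC.
have := fN x y => /(ler_wpM2l (normr_ge0 (heat (i :: g) t (x - y)))) /le_trans; apply.
have := powR_enorm_le (x - y) al01 t0.
move/(ler_wpM2l (mulr_ge0 (normr_ge0 (heat (i :: g) t (x - y))) N0)).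
rewrite -mulrA => /le_trans; apply.
have := CP t (x - y) t0; set P := \prod_(_ < _) _; set c := cauchyn _ _ => h.
rewrite [leLHS](_ : _ = (t `^ (al / 2) * N) * (`|heat (i :: g) t (x - y)| * P)); last by ring.
rewrite [leRHS](_ : _ = (t `^ (al / 2) * N) * (C * (Num.sqrt t)^-1 ^+ size (i :: g) * c)); last by ring.
by rewrite ler_wpM2l// mulr_ge0 ?powR_ge0.
Qed.

End heatconv_bounds.

(** * Abel's integral equation *)

Section time_integrals.
Context (R : realType).
Notation mu := (@lebesgue_measure R).
Implicit Types (p q r s t v : R).

Lemma is_derive_powR (a x : R) : 0 < x ->
  is_derive x 1 (fun x => x `^ a) (a * x `^ (a - 1)).
Proof.
move=> x0; have xi : x \in `]0, +oo[ by rewrite in_itv/= x0.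
apply: DeriveDef; first exact: derivable_powR.
by rewrite -derive1E powR_derive1.
Qed.

Lemma continuous_powR (a x : R) : 0 < x -> {for x, continuous (fun x => x `^ a)}.
Proof.
move=> x0; apply: differentiable_continuous; apply/derivable1_diffP.
by have [] := is_derive_powR a x0.
Qed.

Lemma cvgy_powRN (d : R) : 0 < d -> (fun x : R => x `^ (- d)) @ +oo --> 0.
Proof.
move=> d0; apply/cvgr0Pnorm_lt => e e0; near=> x.
have x0 : e `^ (- d^-1) < x by near: x; exact: nbhs_pinfty_gt.
have e1 : 0 < e `^ (- d^-1) by exact: powR_gt0.
rewrite ger0_norm ?powR_ge0// powRN -[e in ltRHS]invrK ltf_pV2 ?posrE ?invr_gt0 ?powR_gt0// ?(lt_trans e1)//.
have -> : e^-1 = (e `^ (- d^-1)) `^ d.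
  by rewrite -powRrM mulNr mulVf ?gt_eqF// powR_inv1// ltW.
by apply: gt0_ltr_powR => //; rewrite nnegrE ltW// (lt_trans e1).
Unshelve. all: by end_near. Qed.

(** The indicator of v > t as a real factor: integrals stay over the whole line, where Fubini and
    affine substitution apply directly. *)
Definition ray t v : R := (t < v)%R%:R.

Lemma ray_ge0 t v : 0 <= ray t v. Proof. by rewrite /ray ler0n. Qed.

Lemma measurable_ray t d (T : measurableType d) (f : T -> R) :
  measurable_fun setT f -> measurable_fun setT (fun w => ray t (f w)).
Proof.
move=> mf; have -> : (fun w => ray t (f w)) = \1_`]t, +oo[%classic \o f.
  by apply/funext => w; rewrite /ray/= indicE mem_setE in_itv/= andbT.
exact: measurableT_comp.
Qed.

Lemma measurable_rayM t (f : R -> R) : (forall v, t < v -> {for v, continuous f}) ->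
  measurable_fun setT (fun v => ray t v * f v).
Proof.
move=> cf; have -> : (fun v => ray t v * f v) = f \_ `]t, +oo[.
  apply/funext => v; rewrite /ray patchE mem_setE in_itv/= andbT.
  by case: ifP; rewrite ?mul1r ?mul0r.
apply/(measurable_restrictT f); first exact: measurable_itv.
apply: open_continuous_measurable_fun; first exact: interval_open.
by move=> v; rewrite inE/= in_itv/= andbT; exact: cf.
Qed.

Lemma is_derive_continuous (f : R -> R) (x d : R) : is_derive x 1 f d -> {for x, continuous f}.
Proof. by move=> [h _]; exact/differentiable_continuous/derivable1_diffP. Qed.

Lemma ge0_ftc_tail (F F' : R -> R) t : 0 < t ->
  (forall v, 0 < v -> is_derive v 1 F (F' v)) ->
  (forall v, 0 < v -> {for v, continuous F'}) ->
  (forall v, 0 < v -> 0 <= F' v) -> F @ +oo --> 0 ->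
  rintegrable mu (fun v => ray t v * F' v) /\ \int[mu]_v (ray t v * F' v) = - F t.
Proof.
move=> t0 dF cF' F'0 F0.
have mF : measurable_fun setT (fun v => ray t v * F' v).
  by apply: measurable_rayM => v tv; apply: cF'; exact: lt_trans tv.
have pos v : 0 <= ray t v * F' v.
  rewrite /ray; case: ltP => tv; rewrite ?mul0r// mul1r F'0//; exact: lt_trans tv.
have E : (\int[mu]_v (ray t v * F' v)%:E = (- F t)%:E)%E.
  transitivity (\int[mu]_(v in `]t, +oo[) (F' v)%:E)%E.
    rewrite [RHS]integral_mkcond; apply: eq_integral => v _.
    by rewrite /ray patchE mem_setE in_itv/= andbT; case: ifP; rewrite ?mul1r ?mul0r.
  rewrite integral_itv_obnd_cbnd; last first.
    apply/measurable_EFinP; apply: open_continuous_measurable_fun; first exact: interval_open.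
    by move=> v; rewrite inE/= in_itv/= andbT => tv; apply: cF'; exact: lt_trans tv.
  rewrite (ge0_continuous_FTC2y _ _ F0).
  - by rewrite -EFinB sub0r.
  - by move=> v tv; apply: F'0; exact: lt_le_trans tv.
  - apply/continuous_within_itvcyP; split.
      by move=> v; rewrite in_itv/= andbT => tv; apply: cF'; exact: lt_trans tv.
    by apply: cvg_at_right_filter; exact: cF'.
  - by move=> v tv; have [] := dF v (lt_trans t0 tv).
  - by apply: cvg_at_right_filter; apply: is_derive_continuous; exact: dF.
  - move=> v; rewrite in_itv/= andbT => tv; rewrite derive1E.
    by apply: derive_val; apply: dF; exact: lt_trans tv.
split; last by rewrite /Rintegral E.
by apply: ge0_rintegrableP => //; rewrite E ltry.
Qed.

Lemma powR_tail t d : 0 < t -> 0 < d ->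
  rintegrable mu (fun v => ray t v * v `^ (- 1 - d)) /\
  \int[mu]_v (ray t v * v `^ (- 1 - d)) = d^-1 * t `^ (- d).
Proof.
move=> t0 d0.
have := @ge0_ftc_tail (fun v => - (d^-1) * v `^ (- d)) (fun v => v `^ (- 1 - d)) t t0.
rewrite mulNr opprK; apply.
- move=> v v0; have h := is_derive_powR (- d) v0.
  apply: is_derive_eq; rewrite /GRing.scale/= (_ : - d - 1 = - 1 - d); last by ring.
  by field; rewrite gt_eqF.
- by move=> v v0; exact: continuous_powR.
- by move=> v v0; rewrite powR_ge0.
- rewrite -[X in _ --> X](mulr0 (- d^-1)); apply: cvgMl_tmp.
  exact: cvgy_powRN.
Qed.

(** Adding [M * v^(-1-d)] makes the integrand nonnegative. The nonnegative case then applies to the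
    sum and to the power separately. *)
Lemma ftc_tail (F F' : R -> R) t d M : 0 < t -> 0 < d ->
  (forall v, 0 < v -> is_derive v 1 F (F' v)) ->
  (forall v, 0 < v -> {for v, continuous F'}) ->
  (forall v, 0 < v -> `|F' v| <= M * v `^ (- 1 - d)) -> F @ +oo --> 0 ->
  rintegrable mu (fun v => ray t v * F' v) /\ \int[mu]_v (ray t v * F' v) = - F t.
Proof.
move=> t0 d0 dF cF' F'M F0.
pose P v := - (d^-1) * v `^ (- d); pose P' v := v `^ (- 1 - d).
have [ip ipE] := powR_tail t0 d0.
have [||||iG iGE] := @ge0_ftc_tail (fun v => F v + M * P v) (fun v => F' v + M * P' v) t t0.
- move=> v v0; have h1 := dF v v0; have h2 := is_derive_powR (- d) v0.
  rewrite /P /P'; apply: is_derive_eq; rewrite /GRing.scale/=.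
  rewrite (_ : - d - 1 = - 1 - d); last by ring.
  by field; rewrite gt_eqF.
- by move=> v v0; apply: cvgD; [exact: cF'|apply: cvgMl_tmp; exact: continuous_powR].
- by move=> v v0; have := F'M v v0; rewrite ler_norml => /andP[+ _]; rewrite /P'; lra.
- rewrite -[X in _ --> X](addr0 0); apply: cvgD => //.
  rewrite -[X in _ --> X](mulr0 M); apply: cvgMl_tmp.
  by rewrite -[X in _ --> X](mulr0 (- d^-1)); apply: cvgMl_tmp; exact: cvgy_powRN.
have E v : ray t v * F' v = ray t v * (F' v + M * P' v) - M * (ray t v * v `^ (- 1 - d)).
  by rewrite /P'; ring.
under eq_fun do rewrite E.
split; first by apply: rintegrableB => //; exact: rintegrableZl.
rewrite RintegralB//; last exact: rintegrableZl.
rewrite iGE RintegralZl// ipE /P; ring.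
Qed.

(** The Abel weight v^(-p) on v > 0; the factor [ray 0] discards the default values of the power
    elsewhere. *)
Definition wgt p v : R := ray 0 v * v `^ (- p).

Lemma wgt_ge0 p v : 0 <= wgt p v.
Proof. by rewrite mulr_ge0 ?ray_ge0 ?powR_ge0. Qed.

Lemma wgt_scale p r v : 0 < r -> wgt p (r * v) = r `^ (- p) * wgt p v.
Proof.
move=> r0; rewrite /wgt /ray pmulr_rgt0//; case: ltP => v0; last by rewrite !mul0r mulr0.
by rewrite !mul1r powRM// ltW.
Qed.

Lemma measurable_wgt p : measurable_fun setT (wgt p).
Proof. by apply: measurable_rayM => v v0; exact: continuous_powR. Qed.

Lemma measurable_wgtM p (f : R -> R) : (forall v, 0 < v -> {for v, continuous f}) ->
  measurable_fun setT (fun v => wgt p v * f v).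
Proof.
move=> cf; under eq_fun do rewrite -mulrA.
apply: (@measurable_rayM 0 (fun v => v `^ (- p) * f v)) => v v0.
by apply: cvgM; [exact: continuous_powR|exact: cf].
Qed.

(** For the exponent p - 2 there is an explicit primitive, (v/(1+v))^(1-p) / (1-p), here written
    with 1 - 1/(1+v) and normalised to vanish at infinity. The singularity at 0 is reached by
    monotone convergence along the lower limits 1/(n+1). *)
Let wgt_beta p : p < 1 -> rintegrable mu (fun v => wgt p v * (1 + v) `^ (p - 2)).
Proof.
move=> p1; pose F v := (1 - p)^-1 * ((1 - (1 + v)^-1) `^ (1 - p) - 1).
pose F' v := v `^ (- p) * (1 + v) `^ (p - 2).
have q0 : 0 < 1 - p by lra.
have in01 v : 0 < v -> 0 < 1 - (1 + v)^-1 <= 1.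
  by move=> v0; rewrite subr_gt0 invf_lt1 ?lerBlDr ?lerDl ?invr_ge0//; lra.
have dF v : 0 < v -> is_derive v 1 F (F' v).
  move=> v0; have v1 : 1 + v != 0 by rewrite gt_eqF//; lra.
  have /andP[w0 _] := in01 v v0.
  have d1 : is_derive v 1 (fun v : R => 1 + v) 1.
    by have := is_deriveD (is_derive_cst (1 : R) v 1) (is_derive_id v 1); rewrite add0r.
  have di : is_derive v 1 (fun v : R => (1 + v)^-1) (- (1 + v) ^- 2).
    have [e1 e2] := d1; apply: DeriveDef; first exact: derivableV.
    by rewrite deriveV// e2 /GRing.scale/= mulr1.
  have dw : is_derive v 1 (fun v : R => 1 - (1 + v)^-1) ((1 + v) ^- 2).
    by have := is_deriveB (is_derive_cst (1 : R) v 1) di; rewrite sub0r opprK.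
  have dp := @is_derive1_comp R (fun w => w `^ (1 - p)) (fun v => 1 - (1 + v)^-1) v _ _
    (is_derive_powR (1 - p) w0) dw.
  have -> : F' v = (1 - p)^-1 * ((1 - p) * (1 - (1 + v)^-1) `^ (1 - p - 1) * (1 + v) ^- 2 - 0).
    rewrite subr0 -!mulrA mulKf ?gt_eqF// /F'.
    have -> : 1 - (1 + v)^-1 = v * (1 + v)^-1 by field.
    have v10 : 0 < 1 + v by lra.
    rewrite powRM ?invr_ge0 ?(ltW v0) ?(ltW v10)// -mulrA.
    rewrite (_ : 1 - p - 1 = - p); last by ring.
    congr (_ * _); rewrite -powR_inv1 ?(ltW v10)// -powRrM -powR_invn ?(ltW v10)//.
    by rewrite -powRD ?(gt_eqF v10) ?implybT//; congr (_ `^ _); ring.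
  have dF1 := is_deriveB dp (is_derive_cst (1 : R) v 1).
  by have := is_deriveZ (1 - p)^-1 dF1.
have cF' v : 0 < v -> {for v, continuous F'}.
  move=> v0; apply: cvgM; first exact: continuous_powR.
  apply: (@continuous_comp _ _ _ (fun v : R => 1 + v) (fun w => w `^ (p - 2))).
    by apply: cvgD; [exact: cvg_cst|exact: cvg_id].
  by apply: continuous_powR; lra.
have F'0 v : 0 < v -> 0 <= F' v by move=> _; rewrite mulr_ge0 ?powR_ge0.
have Foo : F @ +oo --> 0.
  have h0 : (fun v : R => (1 + v)^-1) @ +oo --> 0.
    apply/cvgr0Pnorm_lt => e e0; near=> v.
    have v0 : e^-1 < v by near: v; apply: nbhs_pinfty_gt; exact: num_real.
    have e1 : 0 < e^-1 by rewrite invr_gt0.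
    rewrite ger0_norm ?invr_ge0; last by lra.
    by rewrite invf_plt ?posrE//; lra.
  rewrite -[X in _ --> X](mulr0 (1 - p)^-1); apply: cvgMl_tmp.
  rewrite -[X in _ --> X](subrr 1); apply: cvgB; last exact: cvg_cst.
  have c1 : (fun v : R => 1 - (1 + v)^-1) @ +oo --> (1 : R).
    by rewrite -[X in _ --> X]subr0; apply: cvgB => //; exact: cvg_cst.
  have : (fun x : R => x `^ (1 - p)) x @[x --> (1 : R)] --> (1 : R) `^ (1 - p).
    exact: continuous_powR.
  by rewrite powR1 => /(cvg_comp _ _ c1).
have mf n : measurable_fun setT (fun v => (ray n.+1%:R^-1 v * F' v)%:E).
  apply/measurable_EFinP; apply: measurable_rayM => v vn; apply: cF'.
  by apply: lt_trans vn; rewrite invr_gt0.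
have f0 n v : (0 <= (ray n.+1%:R^-1 v * F' v)%:E)%E.
  by rewrite lee_fin mulr_ge0 ?ray_ge0// mulr_ge0 ?powR_ge0.
have nd v : {homo (fun n => (ray n.+1%:R^-1 v * F' v)%:E) : m n / (m <= n)%N >-> (m <= n)%E}.
  move=> m n mn; rewrite lee_fin ler_wpM2r ?mulr_ge0 ?powR_ge0// /ray ler_nat.
  case: ltP => // h1; rewrite (le_lt_trans _ h1)// lef_pV2 ?posrE// ler_nat ltnS//.
have E : (\int[mu]_v (wgt p v * (1 + v) `^ (p - 2))%:E =
    limn (fun n => \int[mu]_v (ray n.+1%:R^-1 v * F' v)%:E))%E.
  rewrite -monotone_convergence//.
  apply: eq_integral => v _; apply/esym/cvg_lim => //.
  rewrite /wgt -mulrA -/(F' v).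
  have [v0|v0] := ltP 0 v; last first.
    rewrite {2}/ray ltNge v0 mul0r; under eq_fun => n.
      rewrite {1}/ray ltNge (le_trans v0)//= ?mul0r//; over.
    exact: cvg_cst.
  apply: cvg_near_cst; near=> n; rewrite /ray v0 (_ : (_ < v)%R)//.
  rewrite invf_plt ?posrE//; apply: lt_trans (_ : n%:R < _) => //; last by rewrite ltr_nat.
  by near: n; exact: nbhs_infty_gtr.
apply: ge0_rintegrableP.
- apply: measurable_wgtM => v v0.
  apply: (@continuous_comp _ _ _ (fun v : R => 1 + v) (fun w => w `^ (p - 2))).
    by apply: cvgD; [exact: cvg_cst|exact: cvg_id].
  by apply: continuous_powR; lra.
- by move=> v; rewrite mulr_ge0 ?wgt_ge0 ?powR_ge0.
rewrite E; apply: (@le_lt_trans _ _ (1 - p)^-1%:E); last exact: ltry.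
apply: lime_le.
  apply: ereal_nondecreasing_is_cvgn => m n mn.
  by apply: ge0_le_integral => //; [exact: mf..|move=> v _; exact: nd].
apply: nearW => n; have tn : 0 < n.+1%:R^-1 :> R by rewrite invr_gt0.
have [i1 i2] := ge0_ftc_tail tn dF cF' F'0 Foo.
rewrite -EFin_Rintegral// i2 lee_fin /F -mulrN opprB.
rewrite ler_piMr ?invr_ge0 ?(ltW q0)// lerBlDr lerDl powR_ge0//.
Unshelve. all: by end_near. Qed.

Lemma rintegrable_wgt p q : p < 1 -> 1 < p + q -> 0 <= q ->
  rintegrable mu (fun v => wgt p v * (1 + v) `^ (- q)).
Proof.
move=> p1 pq q0; pose d := p + q - 1; have d0 : 0 < d by rewrite /d; lra.
have [i1 _] := powR_tail ltr01 d0.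
(* For v <= 1 one has (1+v)^(-q) <= 1 <= 2^(2-p) (1+v)^(p-2); for v > 1 one has (1+v)^(-q) <=
   v^(-q), and [d] is chosen so that v^(-p-q) is v^(-1-d). *)
have i2 := rintegrableZl (2 `^ (2 - p)) (wgt_beta p1).
apply: (le_rintegrable _ (rintegrableD i2 i1)) => [|v].
  apply: measurable_wgtM => v v0.
  apply: (@continuous_comp _ _ _ (fun v : R => 1 + v) (fun w => w `^ (- q))).
    by apply: cvgD; [exact: cvg_cst|exact: cvg_id].
  by apply: continuous_powR; lra.
rewrite ger0_norm; last by rewrite mulr_ge0 ?wgt_ge0 ?powR_ge0.
rewrite /wgt /ray; case: (ltP 0 v) => v0; last first.
  by rewrite !mul0r mulr0 add0r mulr_ge0 ?ler0n ?powR_ge0.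
rewrite mul1r; case: (ltP 1 v) => v1.
  rewrite mul1r (_ : - 1 - d = - p + - q); last by rewrite /d; ring.
  rewrite (@powRD _ v (- p)); last by rewrite (gt_eqF v0) implybT.
  apply: ler_wpDl; first by rewrite !mulr_ge0 ?powR_ge0.
  rewrite ler_wpM2l ?powR_ge0// !powRN lef_pV2 ?posrE ?powR_gt0//; last by lra.
  by apply: ge0_ler_powR => //; rewrite ?nnegrE; lra.
rewrite mul0r addr0 mulrCA ler_wpM2l ?powR_ge0//.
apply: (@le_trans _ _ 1).
  rewrite powRN invf_le1; last by apply: powR_gt0; lra.
  by rewrite -[leLHS](powRr0 (1 + v)); apply: ler_powR => //; lra.
rewrite -[p - 2]opprB powRN ler_pdivlMr; last by apply: powR_gt0; lra.
by rewrite mul1r; apply: ge0_ler_powR; rewrite ?nnegrE; lra.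
Qed.

(** Euler's Beta function B(1 - p, p + q - 1) in its half-line form. *)
Definition betaint p q : R := \int[mu]_v (wgt p v * (1 + v) `^ (- q)).

Lemma Rintegral_wgt p q t : p < 1 -> 1 < p + q -> 0 <= q -> 0 < t ->
  rintegrable mu (fun v => wgt p v * (t + v) `^ (- q)) /\
  \int[mu]_v (wgt p v * (t + v) `^ (- q)) = t `^ (1 - p - q) * betaint p q.
Proof.
move=> p1 pq q0 t0; have i1 := rintegrable_wgt p1 pq q0.
have ti : 0 < t^-1 by rewrite invr_gt0.
have E v : wgt p v * (t + v) `^ (- q) =
    t `^ (- p - q) * (fun v => wgt p v * (1 + v) `^ (- q)) (t^-1 * v + 0).
  rewrite addr0 /= wgt_scale//; have [v0|v0] := ltP 0 v; last first.
    by rewrite /wgt /ray ltNge v0 !mul0r mulr0 mul0r mulr0.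
  have -> : 1 + t^-1 * v = t^-1 * (t + v) by field; rewrite gt_eqF.
  rewrite powRM ?(ltW ti)//; last by lra.
  have tt a : (t^-1) `^ (- a) = t `^ a.
    by rewrite -powR_inv1 ?(ltW t0)// -powRrM; congr (_ `^ _); ring.
  rewrite !tt powRD ?(gt_eqF t0) ?implybT// !powRN; field.
  by rewrite !gt_eqF ?powR_gt0//; lra.
under eq_fun do rewrite E.
have ia := rintegrable_affine 0 ti i1.
split; first exact: rintegrableZl.
rewrite (RintegralZl _ measurableT ia) (Rintegral_affine 0 ti i1) invrK mulrA; congr (_ * _).
by rewrite -[X in _ * X = _](powRr1 (ltW t0)) -powRD ?(gt_eqF t0) ?implybT//; congr (_ `^ _); ring.
Qed.

Lemma Rintegral_gt0 (h : R -> R) c : rintegrable mu h -> (forall v, 0 <= h v) ->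
  0 < c -> (forall v, 1 <= v <= 2 -> c <= h v) -> 0 < \int[mu]_v h v.
Proof.
move=> ih h0 c0 hc; apply: (lt_le_trans c0).
have mI : measurable (`[1, 2]%classic : set (measurableTypeR R)) by exact: measurable_itv.
have muI : mu `[1, 2]%classic = 1%E.
  by rewrite lebesgue_measure_itv/= lte_fin ltr1n -EFinD; congr EFin; ring.
have ii : rintegrable mu (\1_`[1, 2]%classic : R -> R).
  exact: integrable_indic_itv.
have <- : \int[mu]_v (c * \1_`[1, 2]%classic v) = c.
  by rewrite RintegralZl// /Rintegral integral_indic// setIT [X in fine X]muI mulr1.
apply: le_Rintegral => //; first exact: rintegrableZl.
move=> v _; rewrite indicE mem_setE in_itv/=; case: (boolP (1 <= v <= 2)) => v12; rewrite ?mulr1 ?mulr0//.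
exact: hc.
Qed.

Lemma betaint_gt0 p q : p < 1 -> 1 < p + q -> 0 <= q -> 0 < betaint p q.
Proof.
move=> p1 pq q0.
apply: (@Rintegral_gt0 _ (Num.min 1 (2 `^ (- p)) * 3 `^ (- q))).
- exact: rintegrable_wgt.
- by move=> v; rewrite mulr_ge0 ?wgt_ge0 ?powR_ge0.
- by rewrite mulr_gt0 ?lt_min ?ltr01 ?powR_gt0.
move=> v /andP[v1 v2]; have v0 : 0 < v by lra.
apply: ler_pM; rewrite ?powR_ge0 ?le_min ?ler01 ?powR_ge0//.
  rewrite /wgt /ray v0 mul1r ge_min.
  have [pp|pp] := leP 0 p.
    apply/orP; right; rewrite !powRN lef_pV2 ?posrE ?powR_gt0//.
    by apply: ge0_ler_powR => //; rewrite nnegrE; lra.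
  by apply/orP; left; rewrite -[leLHS](powRr0 v); apply: ler_powR => //; lra.
rewrite !powRN lef_pV2 ?posrE ?powR_gt0//; last by lra.
by apply: ge0_ler_powR => //; rewrite ?nnegrE; lra.
Qed.

Lemma rintegrable_gamma s : 0 < s < 1 -> rintegrable mu (fun v => wgt s v * expR (- v)).
Proof.
move=> /andP[s0 s1].
(* The majorant comes from exp(-v) <= 1/(1+v). *)
apply: (@le_rintegrable _ _ _ mu _ _ _ (@rintegrable_wgt s 1 _ _ _)); try lra.
- apply: measurable_wgtM => v v0.
  by apply: (@continuous_comp _ _ _ -%R expR); [exact: opp_continuous|exact: continuous_expR].
- move=> v; rewrite normrM ger0_norm ?wgt_ge0// ger0_norm ?expR_ge0//.
  have [v0|v0] := ltP 0 v; last by rewrite /wgt /ray ltNge v0 !mul0r.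
  rewrite ler_wpM2l ?wgt_ge0// expRN powR_inv1; last by lra.
  by rewrite lef_pV2 ?posrE ?expR_gt0 ?expR_ge1Dx//; lra.
Qed.

(** Euler's Gamma(1 - s). *)
Definition gammaint s : R := \int[mu]_v (wgt s v * expR (- v)).

Lemma gammaint_gt0 s : 0 < s < 1 -> 0 < gammaint s.
Proof.
move=> s01; have /andP[s0 s1] := s01.
apply: (@Rintegral_gt0 _ (2 `^ (- s) * expR (- 2))).
- exact: rintegrable_gamma.
- by move=> v; rewrite mulr_ge0 ?wgt_ge0 ?expR_ge0.
- by rewrite mulr_gt0 ?expR_gt0 ?powR_gt0.
move=> v /andP[v1 v2]; have v0 : 0 < v by lra.
apply: ler_pM; rewrite ?powR_ge0 ?expR_ge0 ?ler_expR ?lerN2//.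
rewrite /wgt /ray v0 mul1r !powRN lef_pV2 ?posrE ?powR_gt0//.
by apply: ge0_ler_powR => //; rewrite ?nnegrE; lra.
Qed.

Lemma Rintegral_gamma s l : 0 < s < 1 -> 0 < l ->
  rintegrable mu (fun v => wgt s v * (l * expR (- (l * v)))) /\
  \int[mu]_v (wgt s v * (l * expR (- (l * v)))) = l `^ s * gammaint s.
Proof.
move=> s01 l0; have i1 := rintegrable_gamma s01.
have ia := rintegrable_affine 0 l0 i1.
have E v : wgt s v * (l * expR (- (l * v))) =
    (l `^ s * l) * (fun v => wgt s v * expR (- v)) (l * v + 0).
  rewrite addr0 /= wgt_scale// powRN; field.
  by rewrite gt_eqF ?powR_gt0.
under eq_fun do rewrite E.
split; first exact: rintegrableZl.
by rewrite (RintegralZl _ measurableT ia) (Rintegral_affine 0 l0 i1) mulrA mulfK ?gt_eqF.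
Qed.

Lemma ray_affine (h : R -> R) t c : 0 < c -> rintegrable mu (fun v => ray t v * h v) ->
  rintegrable mu (fun r => ray 0 r * h (t + r * c)) /\
  \int[mu]_r (ray 0 r * h (t + r * c)) = c^-1 * \int[mu]_v (ray t v * h v).
Proof.
move=> c0 ih; have E r : ray 0 r * h (t + r * c) = (fun v => ray t v * h v) (c * r + t).
  rewrite /= mulrC [c * r]mulrC [r * c + t]addrC [in RHS]mulrC; congr (_ * _).
  by rewrite /ray ltrDl pmulr_lgt0.
under eq_fun do rewrite E.
by split; [exact: (rintegrable_affine t c0 ih)|exact: (Rintegral_affine t c0 ih)].
Qed.

(** What the inversion asks of A = D^g u_t(x) as a function of t: A is recovered from A' by
    integrating from infinity, with absolute convergence guaranteed by the exponent -1 - d. *)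
Record tail_primitive (A A' : R -> R) (d M : R) : Prop := {
  tail_gt0 : 0 < d;
  tail_derive : forall v, 0 < v -> is_derive v 1 A (A' v);
  tail_continuous : forall v, 0 < v -> {for v, continuous A'};
  tail_le : forall v, 0 < v -> `|A' v| <= M * v `^ (- 1 - d);
  tail_cvg : A @ +oo --> 0 }.

Let cshift A A' d M v t : tail_primitive A A' d M ->
  0 < t -> 0 < v -> {for v, continuous (fun v => A' (t + v))}.
Proof.
move=> [_ _ cA' _ _] t0 v0; apply: (@continuous_comp _ _ _ (fun v : R => t + v) A').
  by apply: cvgD; [exact: cvg_cst|exact: cvg_id].
by apply: cA'; lra.
Qed.

Lemma rintegrable_tail A A' s d M t : tail_primitive A A' d M -> 0 < s < 1 -> 0 < t ->
  rintegrable mu (fun v => wgt s v * A' (t + v)).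
Proof.
move=> TP /andP[s0 s1] t0; have [d0 dA cA' A'M A0] := TP.
have i1 : rintegrable mu (fun v => wgt s v * (t + v) `^ (- (1 + d))).
  have h1 : 1 < s + (1 + d) by lra.
  have h2 : 0 <= 1 + d by lra.
  exact: (Rintegral_wgt s1 h1 h2 t0).1.
apply: (le_rintegrable _ (rintegrableZl M i1)) => [|v].
  by apply: measurable_wgtM => v v0; exact: cshift TP _ _.
rewrite normrM (ger0_norm (wgt_ge0 _ _)).
have [v0|v0] := ltP 0 v; last by rewrite /wgt /ray ltNge v0 !mul0r mulr0.
rewrite mulrCA ler_wpM2l ?wgt_ge0//; have := A'M _ (addr_gt0 t0 v0).
by rewrite (_ : - 1 - d = - (1 + d)); last by ring.
Qed.

(** Substitute v = r p. The outer weight r^(s-1), the factor r^(-s) from the inner weight and the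
    Jacobian r cancel, which is why the inverting weight has exponent 1 - s. *)
Let inner A A' s d M r t : tail_primitive A A' d M -> 0 < s < 1 -> 0 < t -> 0 < r ->
  wgt (1 - s) r * \int[mu]_v (wgt s v * A' (t + r + v)) =
  \int[mu]_p (wgt s p * A' (t + r * (1 + p))).
Proof.
move=> TP s01 t0 r0; have tr : 0 < t + r by lra.
have ik := rintegrable_tail TP s01 tr.
have ri : 0 < r^-1 by rewrite invr_gt0.
have E p : wgt s p * A' (t + r * (1 + p)) =
    r `^ s * (fun v => wgt s v * A' (t + r + v)) (r * p + 0).
  rewrite addr0 wgt_scale// mulrA mulrA powRN divff ?gt_eqF ?powR_gt0// mul1r.
  by congr (_ * A' _); ring.
under [RHS]eq_Rintegral do rewrite E.
rewrite (RintegralZl _ measurableT (rintegrable_affine 0 r0 ik)) (Rintegral_affine 0 r0 ik).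
rewrite mulrA; congr (_ * _); rewrite /wgt /ray r0 mul1r.
rewrite -powR_inv1 ?(ltW r0)// -powRD ?(gt_eqF r0) ?implybT//.
by congr (_ `^ _); ring.
Qed.

(* Substituting v = r p in the inner integral and exchanging the order reduces
   the double integral to [betaint s 1] times the integral of [A'] over v > t. *)
Lemma abel_inversion A A' s d M t : tail_primitive A A' d M -> 0 < s < 1 -> 0 < t ->
  \int[mu]_r (wgt (1 - s) r * \int[mu]_v (wgt s v * A' (t + r + v))) = - betaint s 1 * A t.
Proof.
move=> TP s01 t0; have /andP[s0 s1] := s01; have [d0 dA cA' A'M A0] := TP.
(* [A'] is cut off for v <= 0, where nothing is assumed about it, so that [F] is measurable on the
   whole plane. For p, r > 0 the cut-off changes nothing. *)
pose A0' v := ray 0 v * A' v.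
pose F p r := wgt s p * (ray 0 r * A0' (t + r * (1 + p))).
have FE p r : F p r = wgt s p * (ray 0 r * A' (t + r * (1 + p))).
  rewrite /F /A0'; have [p0|p0] := ltP 0 p; last first.
    by rewrite /wgt /ray !ltNge p0 !mul0r.
  have [r0|r0] := ltP 0 r; last by rewrite /ray !ltNge r0 !mul0r.
  by congr (_ * (_ * _)); rewrite {1}/ray (_ : (0 < _)%R) ?mul1r//; nra.
have F0 p : p <= 0 -> F p = (fun=> 0).
  by move=> p0; apply/funext => r; rewrite /F /wgt /ray ltNge p0 !mul0r.
have [it itE] := ftc_tail t0 d0 dA cA' A'M A0.
have [ip ipE] := powR_tail t0 d0.
have ia := rintegrable_normr it.
have nE v : `|ray t v * A' v| = ray t v * `|A' v| by rewrite normrM (ger0_norm (ray_ge0 _ _)).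
move: ia; under eq_fun do rewrite nE; move=> ia.
transitivity (\int[mu]_r \int[mu]_p F p r).
  apply: eq_Rintegral => r _.
  have [r0|r0] := ltP 0 r.
    rewrite (inner TP)//; apply: eq_Rintegral => p _; rewrite FE; congr (_ * _).
    by rewrite /ray r0 mul1r.
  rewrite /wgt {1}/ray ltNge r0 !mul0r; apply/esym.
  under eq_Rintegral do rewrite FE /ray ltNge r0 !mul0r mulr0.
  by rewrite Rintegral_cst// mul0r.
have iF : rintegrable (mu \x mu)%E (fun z => F z.1 z.2).
  (* Integration in r of the substituted [A'] leaves a factor 1/(1+p), and [wgt s p] / (1+p) is
     integrable with integral [betaint s 1]. *)
  apply: (@rintegrable_prod _ _ _ _ _ mu mu F
    (fun p => (M * (d^-1 * t `^ (- d))) * (wgt s p * (1 + p) `^ (- 1)))).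
  - apply: measurable_funM.
      by apply: measurableT_comp; [exact: measurable_wgt|exact: measurable_fst].
    apply: measurable_funM; first by apply: measurable_ray; exact: measurable_snd.
    apply: (@measurableT_comp _ _ _ _ _ _ A0'); first by apply: measurable_rayM; exact: cA'.
    apply: measurable_funD => //; apply: measurable_funM => //.
    by apply: measurable_funD.
  - move=> p; have [p0|p0] := ltP 0 p; last first.
      by rewrite F0//; exact: rintegrable0.
    rewrite (_ : F p = fun r => wgt s p * (ray 0 r * A' (t + r * (1 + p)))); last exact/funext.
    have p1 : 0 < 1 + p by lra.
    by apply: rintegrableZl; apply: (ray_affine p1 it).1.
  - by apply: rintegrableZl; apply: rintegrable_wgt => //; lra.
  - move=> p; have [p0|p0] := ltP 0 p; last first.
      rewrite F0//; under eq_Rintegral do rewrite normr0.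
      by rewrite Rintegral_cst// mul0r /wgt {1}/ray ltNge p0 !mul0r mulr0.
    have p1 : 0 < 1 + p by lra.
    have nF r : `|F p r| = wgt s p * (ray 0 r * (fun v => `|A' v|) (t + r * (1 + p))).
      by rewrite FE normrM (ger0_norm (wgt_ge0 _ _)) normrM (ger0_norm (ray_ge0 _ _)).
    under eq_Rintegral do rewrite nF.
    have [ja jE] := ray_affine p1 ia.
    rewrite (RintegralZl _ measurableT ja) jE [leRHS]mulrCA ler_wpM2l ?wgt_ge0//.
    rewrite powR_inv1 ?(ltW p1)// mulrC ler_wpM2r ?invr_ge0 ?(ltW p1)//.
    rewrite -ipE -(RintegralZl _ measurableT ip).
    apply: le_Rintegral => //; first exact: rintegrableZl.
    move=> v _; rewrite mulrCA /ray; case: ltP => tv; last by rewrite !mul0r.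
    by rewrite !mul1r A'M//; lra.
rewrite -(RFubini iF).
transitivity (\int[mu]_p (- A t * (wgt s p * (1 + p) `^ (- 1)))).
  apply: eq_Rintegral => p _; have [p0|p0] := ltP 0 p; last first.
    by rewrite F0// Rintegral_cst// mul0r /wgt /ray ltNge p0 !mul0r mulr0.
  have p1 : 0 < 1 + p by lra.
  under eq_Rintegral do rewrite FE.
  have [ja jE] := ray_affine p1 it.
  by rewrite (RintegralZl _ measurableT ja) jE itE powR_inv1 ?(ltW p1)//; ring.
by rewrite RintegralZl//; [rewrite /betaint; ring|apply: rintegrable_wgt => //; lra].
Qed.

(** Integrating [Phi] against r^(s-1) returns c * [betaint s 1] times A. The bound on [Phi]
    integrates to [betaint (1 - s) k] * t^(s-k), and s < k is convergence at infinity. The constant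
    [M] of the tail does not enter the result. *)
Lemma abel_inversion_le A A' s d M (Phi : R -> R) (c K k t : R) :
  tail_primitive A A' d M -> 0 < s < 1 -> 0 < t -> 0 < c -> s < k ->
  (forall v, 0 < v -> {for v, continuous Phi}) ->
  (forall v, 0 < v -> Phi v = - c * \int[mu]_w (wgt s w * A' (v + w))) ->
  (forall v, 0 < v -> `|Phi v| <= K * v `^ (- k)) ->
  `|A t| <= (c * betaint s 1)^-1 * betaint (1 - s) k * K * t `^ (s - k).
Proof.
move=> TP s01 t0 c0 sk cP PE PK; have /andP[s0 s1] := s01.
have b0 : 0 < betaint s 1 by apply: betaint_gt0 => //; lra.
have [ik ikE] : rintegrable mu (fun v => wgt (1 - s) v * (t + v) `^ (- k)) /\
   \int[mu]_v (wgt (1 - s) v * (t + v) `^ (- k)) = t `^ (s - k) * betaint (1 - s) k.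
  have := @Rintegral_wgt (1 - s) k t; rewrite (_ : 1 - (1 - s) - k = s - k); last by ring.
  by apply => //; lra.
have mP : measurable_fun [set: measurableTypeR R] (fun r => wgt (1 - s) r * Phi (t + r)).
  apply: measurable_wgtM => v v0.
  apply: (@continuous_comp _ _ _ (fun v : R => t + v) Phi).
    by apply: cvgD; [exact: cvg_cst|exact: cvg_id].
  by apply: cP; lra.
have PK' r : `|wgt (1 - s) r * Phi (t + r)| <= K * (wgt (1 - s) r * (t + r) `^ (- k)).
  rewrite normrM (ger0_norm (wgt_ge0 _ _)).
  have [r0|r0] := ltP 0 r; last by rewrite /wgt /ray ltNge r0 !mul0r mulr0.
  by rewrite mulrCA ler_wpM2l ?wgt_ge0// PK//; lra.
have iP := le_rintegrable mP (rintegrableZl K ik) PK'.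
have E : \int[mu]_r (wgt (1 - s) r * Phi (t + r)) = c * betaint s 1 * A t.
  rewrite -mulrA -[betaint s 1 * A t]opprK -mulNr -(abel_inversion TP)// mulrN -mulNr.
  rewrite [X in _ = _ * X](_ : _ = \int[mu]_r (- c^-1 * (wgt (1 - s) r * Phi (t + r)))).
    by rewrite (RintegralZl _ measurableT iP); field; rewrite gt_eqF.
  apply: eq_Rintegral => r _; have [r0|r0] := ltP 0 r; last first.
    by rewrite /wgt {1 3}/ray ltNge r0 !mul0r mulr0.
  by rewrite PE; [field; rewrite gt_eqF|lra].
have cb0 : 0 < c * betaint s 1 by rewrite mulr_gt0.
rewrite -!mulrA ler_pdivlMl// -[c * _ in leLHS](gtr0_norm cb0) -normrM -E.
rewrite [leRHS](_ : _ = K * (t `^ (s - k) * betaint (1 - s) k)); last by ring.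
rewrite -ikE -(RintegralZl _ measurableT ik).
by apply: le_norm_Rintegral => //; exact: rintegrableZl.
Qed.

End time_integrals.

(** * The fractional Laplacian of the heat kernel *)

Section gauss_fourier.
Context (R : realType).
Notation mu := (@lebesgue_measure R).
Implicit Types (t x y z th : R) (m : nat).

Lemma expR_sqr_le t m : 0 < t -> exists2 C : R, 0 <= C &
  forall x, `|x| ^+ m * expR (- (t * x ^+ 2)) <= C * cauchy_ker 1 x.
Proof.
move=> t0; have [C CP] := @gauss_bounded R 0 m.+2.
have C0 : 0 <= C by apply: le_trans (CP 0); rewrite mulr_ge0 ?exprn_ge0 ?addr_ge0.
have s0 : 0 < 2 * Num.sqrt t by rewrite mulr_gt0 ?sqrtr_gt0.
(* In the variable w = 2 sqrt t x the Gaussian is [gauss 0], and k (1 + |x|) <= 1 + |w|. *)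
pose k := Num.min 1 (2 * Num.sqrt t).
have k0 : 0 < k by rewrite lt_min ltr01.
have kn : 0 < k ^+ m.+2 by exact: exprn_gt0.
exists (C / k ^+ m.+2) => [|x]; first by rewrite divr_ge0// ltW.
pose w := 2 * Num.sqrt t * x.
have E : gauss 0 w = expR (- (t * x ^+ 2)).
  rewrite /gauss hornerC mul1r /w !exprMn sqr_sqrtr ?(ltW t0)//.
  by congr (expR (- _)); field.
have := CP w; rewrite E ger0_norm ?expR_ge0// => Cw.
have kw : k * (1 + `|x|) <= 1 + `|w|.
  rewrite /w normrM (gtr0_norm s0) mulrDr mulr1; apply: lerD; first by rewrite /k ge_min lexx.
  by rewrite ler_wpM2r// /k ge_min lexx orbT.
have kw' : k ^+ m.+2 * (1 + `|x|) ^+ m.+2 <= (1 + `|w|) ^+ m.+2.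
  by rewrite -exprMn; apply: lerXn2r; rewrite ?nnegrE ?mulr_ge0 ?addr_ge0 ?(ltW k0).
have xm : `|x| ^+ m * (1 + x ^+ 2) <= (1 + `|x|) ^+ m.+2.
  rewrite [leRHS](_ : _ = (1 + `|x|) ^+ m * (1 + `|x|) ^+ 2); last by rewrite -exprD addn2.
  apply: ler_pM; rewrite ?exprn_ge0 ?addr_ge0 ?sqr_ge0//.
    by apply: lerXn2r; rewrite ?nnegrE ?addr_ge0// lerDr.
  rewrite -[x ^+ 2]real_normK ?num_real//; have := normr_ge0 x; nra.
rewrite /cauchy_ker expr1n mul1r ler_pdivlMr; last by rewrite ltr_pwDl// sqr_ge0.
rewrite ler_pdivlMr// mulrAC.
apply: le_trans Cw.
rewrite [leLHS](_ : _ = expR (- (t * x ^+ 2)) * (k ^+ m.+2 * (`|x| ^+ m * (1 + x ^+ 2)))); last by ring.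
rewrite ler_wpM2l ?expR_ge0//.
by apply: le_trans kw'; rewrite ler_wpM2l// ltW.
Qed.

Lemma rintegrable_cauchy1 : rintegrable mu (cauchy_ker (1 : R)).
Proof.
have := @rintegrable_cauchy R 1 0 ltr01.
by under eq_fun do rewrite sub0r cauchyN.
Qed.

Let is_derive_affine (a b x : R) : is_derive x 1 (fun x => a * x + b) a.
Proof.
by apply: is_derive_eq; rewrite /GRing.scale/= ?mulr1 ?addr0.
Qed.

Lemma is_derive_expR_sqr t x :
  is_derive x 1 (fun x => expR (- (t * x ^+ 2))) (- (2 * t * x) * expR (- (t * x ^+ 2))).
Proof.
have h : is_derive x 1 (fun x => - (t * x ^+ 2)) (- (2 * t * x)).
  by apply: is_derive_eq; rewrite /GRing.scale/=; ring.
have := @is_derive1_comp R expR (fun x => - (t * x ^+ 2)) x _ _ (is_derive_expR _) h.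
by rewrite mulrC.
Qed.

(** By translation invariance the integral of F(x + h) in x does not depend on h; its derivative at
    h = 0 is the integral of F'. *)
Lemma Rintegral_derive0 (F F' : R -> R) (C : R) :
  rintegrable mu F -> (forall x, is_derive x 1 F (F' x)) ->
  (forall x, `|F' x| <= C * cauchy_ker 1 x) -> \int[mu]_x F' x = 0.
Proof.
move=> iF dF F'C.
have C0 : 0 <= C.
  have := le_trans (normr_ge0 _) (F'C 0); rewrite pmulr_lge0//.
  by rewrite /cauchy_ker divr_gt0// sqrD_gt0.
have := @is_derive_Rintegral R _ _ mu (fun h x => F (1 * x + h)) (fun h x => F' (1 * x + h))
  0 1 (fun x => C * (3 * cauchy_ker 1 x)) ltr01.
under [X in is_derive _ _ _ X]eq_Rintegral do rewrite mul1r addr0.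
have E : (fun h : R => \int[mu]_x F (1 * x + h)) = cst (\int[mu]_x F x).
  by apply/funext => h; rewrite (Rintegral_affine h ltr01 iF) invr1 mul1r.
rewrite E => H.
have [|||x h|_ <-] := H; last by rewrite derive_cst.
- move=> h x _; have dh : is_derive h 1 (fun h => 1 * x + h) 1.
    by have := is_deriveD (is_derive_cst (1 * x) h 1) (is_derive_id h 1); rewrite add0r.
  have := @is_derive1_comp R F (fun h => 1 * x + h) h _ _ (dF _) dh.
  by rewrite mulr1.
- by move=> h _; exact: rintegrable_affine.
- by apply: rintegrableZl; apply: rintegrableZl; exact: rintegrable_cauchy1.
- rewrite subr0 => x1; apply: le_trans (F'C _) _; rewrite ler_wpM2l// mul1r.
  by apply: cauchy_shift => //; exact: ltW.
Qed.

Let bounded_trig (f : R -> R) (t : R) m : 0 < t -> continuous f -> (forall x, `|f x| <= 1) ->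
  rintegrable mu (fun x => x ^+ m * expR (- (t * x ^+ 2)) * f x).
Proof.
move=> t0 cf f1; have [C C0 CP] := expR_sqr_le m t0.
apply: (le_rintegrable _ (rintegrableZl C rintegrable_cauchy1)) => [|x].
  apply: measurable_funM; last exact: continuous_measurable_fun.
  apply: measurable_funM; first by apply: measurable_funX.
  apply: continuous_measurable_fun => x.
  by apply: is_derive_continuous; exact: is_derive_expR_sqr.
rewrite !normrM normrX [`|expR _|]ger0_norm ?expR_ge0//.
by apply: le_trans (CP x); rewrite ler_piMr// mulr_ge0 ?exprn_ge0 ?expR_ge0.
Qed.

(** A phase shift by pi/2 turns cos into -sin. The parameter [th] thus covers real and imaginary
    parts of Gaussian Fourier integrals together, and each derivative in z only raises [m] and
    shifts [th]. *)
Definition cosint m t z th : R := \int[mu]_x (x ^+ m * expR (- (t * x ^+ 2)) * cos (z * x + th)).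

Let ccos a b : continuous (fun x : R => cos (a * x + b)).
Proof.
by move=> x; apply: (@continuous_comp _ _ _ (fun x => a * x + b) cos);
  [exact: is_derive_continuous (is_derive_affine a b x)|exact: continuous_cos].
Qed.

Lemma rintegrable_cosint m t z th : 0 < t ->
  rintegrable mu (fun x => x ^+ m * expR (- (t * x ^+ 2)) * cos (z * x + th)).
Proof.
move=> t0; apply: (bounded_trig (f := fun x => cos (z * x + th))) => // x.
by rewrite ler_norml cos_geN1 cos_le1.
Qed.

Lemma sin_cos_shift x : sin x = - cos (x + pi / 2).
Proof. by rewrite cosDpihalf opprK. Qed.

Lemma is_derive_cosint m t z th : 0 < t ->
  is_derive z 1 (fun z => cosint m t z th) (cosint m.+1 t z (th + pi / 2)).
Proof.
move=> t0; have [C C0 CP] := expR_sqr_le m.+1 t0.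
apply: (@is_derive_Rintegral R _ _ mu (fun z x => x ^+ m * expR (- (t * x ^+ 2)) * cos (z * x + th))
  (fun z x => x ^+ m.+1 * expR (- (t * x ^+ 2)) * cos (z * x + (th + pi / 2))) z 1
  (fun x => C * cauchy_ker 1 x) ltr01).
- move=> w x _.
  have h : is_derive w 1 (fun w => w * x + th) x.
    by under eq_fun do rewrite mulrC; exact: is_derive_affine.
  have := @is_derive1_comp R cos (fun w => w * x + th) w _ _ (is_derive_cos _) h.
  move=> /(is_derive_mulr (x ^+ m * expR (- (t * x ^+ 2)))).
  under eq_fun do rewrite mulrC.
  rewrite sin_cos_shift opprK addrA (_ : _ * _ * _ = x ^+ m.+1 * expR (- (t * x ^+ 2)) * cos (w *
      x + th + pi / 2))//.
  by move: (cos _) (expR _) => a b; rewrite (exprSr _ m); ring.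
- by move=> w _; exact: rintegrable_cosint.
- by apply: rintegrableZl; exact: rintegrable_cauchy1.
- move=> w x _; rewrite !normrM normrX [`|expR _|]ger0_norm ?expR_ge0//.
  apply: le_trans (CP x); rewrite ler_piMr// ?mulr_ge0 ?exprn_ge0 ?expR_ge0//.
  by rewrite ler_norml cos_geN1 cos_le1.
Qed.

(** Integration by parts: the derivative of exp(-t x^2) cos(z x + th + pi/2) has integral zero. *)
Lemma cosint_by_parts t z th : 0 < t ->
  cosint 1 t z (th + pi / 2) = - (z / (2 * t)) * cosint 0 t z th.
Proof.
move=> t0.
have [C C0 CP] := expR_sqr_le 1 t0; have [D D0 DP] := expR_sqr_le 0 t0.
pose F x := x ^+ 0 * expR (- (t * x ^+ 2)) * cos (z * x + (th + pi / 2)).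
pose F' x := - (2 * t) * (x ^+ 1 * expR (- (t * x ^+ 2)) * cos (z * x + (th + pi / 2)))
   - z * (x ^+ 0 * expR (- (t * x ^+ 2)) * cos (z * x + th)).
have dF x : is_derive x 1 F (F' x).
  have de := is_derive_expR_sqr t x.
  have dc := @is_derive1_comp R cos (fun x => z * x + (th + pi / 2)) x _ _ (is_derive_cos _)
    (is_derive_affine z (th + pi / 2) x).
  rewrite /F; under eq_fun do rewrite expr0 mul1r.
  have -> : F' x = expR (- (t * x ^+ 2)) * (- sin (z * x + (th + pi / 2)) * z) +
      cos (z * x + (th + pi / 2)) * (- (2 * t * x) * expR (- (t * x ^+ 2))).
    by rewrite /F' addrA sinDpihalf expr0 expr1; ring.
  exact: (is_deriveM de dc).
have iF : rintegrable mu F by exact: rintegrable_cosint.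
have F'C x : `|F' x| <= (2 * t * C + `|z| * D) * cauchy_ker 1 x.
  rewrite /F'; apply: le_trans (ler_normB _ _) _; rewrite [leRHS]mulrDl; apply: lerD.
    rewrite normrM normrN [`|2 * t|]ger0_norm ?mulr_ge0 ?(ltW t0)// -[leRHS]mulrA.
    rewrite ler_wpM2l ?mulr_ge0 ?(ltW t0)//; apply: le_trans (CP x).
    rewrite !normrM normrX [`|expR _|]ger0_norm ?expR_ge0//.
    by rewrite ler_piMr ?mulr_ge0 ?expR_ge0// ler_norml cos_geN1 cos_le1.
  rewrite normrM -[leRHS]mulrA ler_wpM2l//; apply: le_trans (DP x).
  rewrite !normrM normrX [`|expR _|]ger0_norm ?expR_ge0//.
  by rewrite ler_piMr ?mulr_ge0 ?expR_ge0// ler_norml cos_geN1 cos_le1.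
have := Rintegral_derive0 iF dF F'C.
have i1 := rintegrable_cosint 1 z (th + pi / 2) t0.
have i0 := rintegrable_cosint 0 z th t0.
rewrite /F' RintegralB//; [|exact: rintegrableZl..].
rewrite !RintegralZl// -/(cosint _ _ _ _) -/(cosint _ _ _ _) => /eqP.
rewrite subr_eq0 => /eqP E.
by rewrite mulNr mulrAC -E; field; rewrite gt_eqF.
Qed.

(** By [cosint_by_parts] the integral I solves I' = -(z/(2t)) I, so I(z) exp(z^2/(4t)) is constant.
    Its value at z = 0 comes from the mass of the heat kernel at time 1/(4t). *)
Lemma cosint0 t z th : 0 < t -> cosint 0 t z th = cos th * (2 * pi * heat1 0 t z).
Proof.
move=> t0; have s0 : 0 < Num.sqrt t by rewrite sqrtr_gt0.
have dI z' : is_derive z' 1 (fun z => cosint 0 t z th) (- (z' / (2 * t)) * cosint 0 t z' th).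
  by rewrite -cosint_by_parts//; exact: is_derive_cosint.
pose c := (4 * t)^-1.
have cst0 z' : is_derive z' 1 (fun z => cosint 0 t z th * expR (- (- c * z ^+ 2))) 0.
  have := is_deriveM (dI z') (is_derive_expR_sqr (- c) z').
  rewrite (_ : _ + _ = 0)// /GRing.scale/= /c; field.
  by rewrite gt_eqF.
have := is_derive_0_is_cst z 0 cst0.
rewrite expr0n/= mulr0 oppr0 expR0 mulr1 mulNr opprK => E.
have -> : cosint 0 t z th = cosint 0 t 0 th * expR (- (c * z ^+ 2)).
  by rewrite -E expRN mulfK// gt_eqF// expR_gt0.
have c0 : 0 < c by rewrite invr_gt0; lra.
have [i1 i1E] := integrable_heat1_0 0 c0.
have pi40 : 0 < Num.sqrt (4 * pi : R) by rewrite sqrtr_gt0 mulr_gt0// pi_gt0.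
have sc : Num.sqrt c = (2 * Num.sqrt t)^-1.
  apply/eqP; rewrite -(@eqrXn2 _ 2)// ?sqrtr_ge0 ?invr_ge0 ?mulr_ge0// sqr_sqrtr ?(ltW c0)//.
  by rewrite exprVn exprMn [Num.sqrt t ^+ 2]sqr_sqrtr ?(ltW t0)// /c; apply/eqP; field; rewrite gt_eqF.
have -> : cosint 0 t 0 th = cos th * (2 * pi * (Num.sqrt (4 * pi))^-1 * (Num.sqrt t)^-1).
  have h y : y ^+ 0 * expR (- (t * y ^+ 2)) * cos (0 * y + th) =
      cos th * (Num.sqrt (4 * pi) * Num.sqrt c) * heat1 0 c (0 - y).
    rewrite /heat1 /gauss hornerC mul1r expr0 mul1r mul0r add0r sub0r expr1.
    have -> : (- y / Num.sqrt c) ^+ 2 / 4 = t * y ^+ 2.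
      rewrite exprMn sqrrN exprVn sqr_sqrtr ?(ltW c0)// /c; field; by rewrite gt_eqF.
    by field; rewrite !gt_eqF// sqrtr_gt0.
  rewrite /cosint; under eq_Rintegral do rewrite h.
  rewrite RintegralZl// i1E mulr1; congr (_ * _); rewrite sc.
  have -> : 2 * pi = Num.sqrt (4 * pi) ^+ 2 / 2 :> R.
    by rewrite sqr_sqrtr ?mulr_ge0 ?pi_ge0//; field.
  by field; rewrite !gt_eqF.
have -> : c * z ^+ 2 = (z / Num.sqrt t) ^+ 2 / 4.
  by rewrite exprMn exprVn sqr_sqrtr ?(ltW t0)// /c; field; rewrite gt_eqF.
by rewrite /heat1 /gauss hornerC mul1r expr1; ring.
Qed.

(** Two derivatives of [cosint0] in z add pi to the phase, whence the sign. *)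
Lemma cosint2 t z th : 0 < t -> cosint 2 t z th = - (cos th * (2 * pi * heat1 2 t z)).
Proof.
move=> t0.
have d2 := is_derive_cosint 1 z (th + pi / 2) t0.
have e1 z' : cosint 1 t z' (th + pi / 2) = cos th * (2 * pi * heat1 1 t z').
  have [_ <-] := is_derive_cosint 0 z' th t0.
  rewrite (_ : (fun z => cosint 0 t z th) = fun z => heat1 0 t z * (cos th * (2 * pi))).
    have [_ ->] := is_derive_mulr (cos th * (2 * pi)) (is_derive_heat1 0 t z').
    by ring.
  by apply/funext => w; rewrite cosint0//; ring.
have d1 := is_derive_mulr (cos th * (2 * pi)) (is_derive_heat1 1 t z).
have : cosint 2 t z (th + pi / 2 + pi / 2) = cos th * (2 * pi * heat1 2 t z).
  have [_ <-] := d2; rewrite (_ : (fun z => _) = fun z => heat1 1 t z * (cos th * (2 * pi))).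
    by have [_ ->] := d1; ring.
  by apply/funext => w; rewrite e1; ring.
move=> <-; rewrite /cosint -mulN1r -RintegralZl//; last exact: rintegrable_cosint.
apply: eq_Rintegral => x _; rewrite -addrA -splitr addrA cosDpi; ring.
Qed.

End gauss_fourier.

(** * Fourier transforms of heat kernels and Gaussians *)

Section heat_fourier.
Local Open Scope complex_scope.
Context (R : realType).
Notation mu := (@lebesgue_measure R).
Implicit Types (t : R) (m : nat).

Lemma cisD (a b : R) : cis (a + b) = cis a * cis b.
Proof.
rewrite /cis cosD sinD; apply/eqP; rewrite eq_complex/= eqxx/=.
by apply/eqP; ring.
Qed.

Lemma cis0 : cis (0 : R) = 1.
Proof. by rewrite /cis cos0 sin0. Qed.

Lemma cis_sum (I : Type) (r : seq I) (f : I -> R) :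
  cis (\sum_(i <- r) f i) = \prod_(i <- r) cis (f i).
Proof.
elim: r => [|i r IH]; first by rewrite !big_nil cis0.
by rewrite !big_cons cisD IH.
Qed.

Lemma Re_realM (a : R) (z : R[i]) : complex.Re (a%:C * z) = a * complex.Re z.
Proof. by rewrite complex_ReM/= mul0r subr0. Qed.

Lemma Im_realM (a : R) (z : R[i]) : complex.Im (a%:C * z) = a * complex.Im z.
Proof. by rewrite complex_ImM/= mul0r addr0. Qed.

Lemma Cint_gauss m t (z : R) : 0 < t ->
  Cintegrable mu (fun y => (y ^+ m * expR (- (t * y ^+ 2)))%:C * cis (z * y)) /\
  Cint mu (fun y => (y ^+ m * expR (- (t * y ^+ 2)))%:C * cis (z * y)) =
    cosint m t z 0 +i* - cosint m t z (pi / 2).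
Proof.
move=> t0.
have rE y : complex.Re ((y ^+ m * expR (- (t * y ^+ 2)))%:C * cis (z * y)) =
    y ^+ m * expR (- (t * y ^+ 2)) * cos (z * y + 0).
  by rewrite Re_realM addr0.
have iE y : complex.Im ((y ^+ m * expR (- (t * y ^+ 2)))%:C * cis (z * y)) =
    -1 * (y ^+ m * expR (- (t * y ^+ 2)) * cos (z * y + pi / 2)).
  by rewrite Im_realM /= sin_cos_shift; ring.
have i1 := rintegrable_cosint m z 0 t0; have i2 := rintegrable_cosint m z (pi / 2) t0.
split.
  split; [under eq_fun do rewrite rE|under eq_fun do rewrite iE] => //.
  exact: rintegrableZl.
rewrite /Cint; under eq_Rintegral do rewrite rE.
under [X in _ +i* X]eq_Rintegral do rewrite iE.
by rewrite (RintegralZl _ measurableT i2) mulN1r.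
Qed.

Lemma Cint_heat1 t (x w : R) : 0 < t ->
  Cintegrable mu (fun y => (heat1 0 t (y - x))%:C * cis (- (y * w))) /\
  Cint mu (fun y => (heat1 0 t (y - x))%:C * cis (- (y * w))) =
    (expR (- (t * w ^+ 2)))%:C * cis (- (x * w)).
Proof.
move=> t0; have s0 : 0 < Num.sqrt t by rewrite sqrtr_gt0.
(* As a function of space the heat kernel at time t is a multiple of exp(-c y^2) with c = 1/(4t), so
   [cosint0] applies with c in place of t. *)
pose c := (4 * t)^-1; have c0 : 0 < c by rewrite invr_gt0; lra.
have pi40 : 0 < Num.sqrt (4 * pi : R) by rewrite sqrtr_gt0 mulr_gt0// pi_gt0.
have sc : Num.sqrt c = (2 * Num.sqrt t)^-1.
  apply/eqP; rewrite -(@eqrXn2 _ 2)// ?sqrtr_ge0 ?invr_ge0 ?mulr_ge0// sqr_sqrtr ?(ltW c0)//.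
  by rewrite exprVn exprMn [Num.sqrt t ^+ 2]sqr_sqrtr ?(ltW t0)// /c; apply/eqP; field; rewrite gt_eqF.
pose K := (Num.sqrt (4 * pi))^-1 * (Num.sqrt t)^-1.
have hE th y : heat1 0 t (y - x) * cos (y * w + th) =
    K * (fun y => y ^+ 0 * expR (- (c * y ^+ 2)) * cos (w * y + (x * w + th))) (1 * y + - x).
  have e1 : c * (y - x) ^+ 2 = ((y - x) / Num.sqrt t) ^+ 2 / 4.
    rewrite exprMn exprVn sqr_sqrtr ?(ltW t0)// /c; field; by rewrite gt_eqF.
  have e2 : w * (y - x) + (x * w + th) = y * w + th by ring.
  by rewrite /= mul1r expr0 mul1r e1 e2 /heat1 /gauss hornerC mul1r expr1 /K; ring.
have ia th := rintegrable_affine (- x) ltr01 (rintegrable_cosint 0 w (x * w + th) c0).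
have IE th : \int[mu]_y (heat1 0 t (y - x) * cos (y * w + th)) =
    expR (- (t * w ^+ 2)) * cos (x * w + th).
  under eq_Rintegral do rewrite hE.
  rewrite (RintegralZl _ measurableT (ia th)).
  rewrite (Rintegral_affine (- x) ltr01 (rintegrable_cosint 0 w (x * w + th) c0)).
  rewrite -/(cosint _ _ _ _) cosint0// invr1 mul1r /heat1 /gauss hornerC mul1r expr1 /K.
  have -> : (w / Num.sqrt c) ^+ 2 / 4 = t * w ^+ 2.
    rewrite exprMn exprVn sqr_sqrtr ?(ltW c0)// /c; field; by rewrite gt_eqF.
  rewrite sc; have -> : 2 * pi = Num.sqrt (4 * pi) ^+ 2 / 2 :> R.
    by rewrite sqr_sqrtr ?mulr_ge0 ?pi_ge0//; field.
  by field; rewrite !gt_eqF.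
have rE y : complex.Re ((heat1 0 t (y - x))%:C * cis (- (y * w))) =
    heat1 0 t (y - x) * cos (y * w + 0).
  by rewrite Re_realM /= addr0 cosN.
have iE y : complex.Im ((heat1 0 t (y - x))%:C * cis (- (y * w))) =
    heat1 0 t (y - x) * cos (y * w + pi / 2).
  by rewrite Im_realM /= sinN sin_cos_shift opprK.
split.
  by split; [under eq_fun do rewrite rE|under eq_fun do rewrite iE];
    under eq_fun do rewrite hE; exact: rintegrableZl.
rewrite /Cint; under eq_Rintegral do rewrite rE.
under [X in _ +i* X]eq_Rintegral do rewrite iE.
rewrite !IE; apply/eqP; rewrite eq_complex Re_realM Im_realM /= addr0 cosN eqxx/=.
by rewrite cosDpihalf sinN.
Qed.

Section rV.
Context (n : nat).
Notation lam := (@lebesgue_rV R n).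
Notation Rn := 'rV[R]_n.
Implicit Types (x y z xi : Rn) (i j : 'I_n).

Definition gaussn t xi : R := expR (- (t * dot xi xi)).

Lemma gaussnE t xi : gaussn t xi = \prod_i expR (- (t * xi ord0 i ^+ 2)).
Proof.
by rewrite /gaussn /dot mulr_sumr -sumrN expR_sum; apply: eq_bigr => i _; rewrite expr2.
Qed.

Lemma gaussnD t v xi : gaussn (t + v) xi = gaussn t xi * gaussn v xi.
Proof. by rewrite /gaussn mulrDl opprD expRD. Qed.

Lemma gaussn_ge0 t xi : 0 <= gaussn t xi. Proof. exact: expR_ge0. Qed.

Lemma dotNl x y : dot (- x) y = - dot x y.
Proof. by rewrite /dot -sumrN; apply: eq_bigr => i _; rewrite mxE mulNr. Qed.

Lemma dotDl x y z : dot (x + y) z = dot x z + dot y z.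
Proof. by rewrite /dot -big_split; apply: eq_bigr => i _; rewrite mxE mulrDl. Qed.

Lemma rintegrable_gaussn t : 0 < t -> rintegrable lam (gaussn t) /\
  forall i, rintegrable lam (fun xi => xi ord0 i ^+ 2 * gaussn t xi).
Proof.
move=> t0; have h m : rintegrable mu (fun y : R => y ^+ m * expR (- (t * y ^+ 2))).
  have := rintegrable_cosint m 0 0 t0.
  by under eq_fun do rewrite mul0r add0r cos0 mulr1.
split=> [|i].
  rewrite (_ : gaussn t = fun xi => \prod_i expR (- (t * xi ord0 i ^+ 2))); last first.
    by apply/funext => xi; exact: gaussnE.
  apply: (@Rintegral_rV_prod R n (fun _ (y : R) => expR (- (t * y ^+ 2))) _).1 => _.
  by have := h 0; under eq_fun do rewrite expr0 mul1r.
have E xi : xi ord0 i ^+ 2 * gaussn t xi = \prod_j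
    (xi ord0 j ^+ (if j == i then 2 else 0)%N * expR (- (t * xi ord0 j ^+ 2))).
  rewrite big_split/= -gaussnE (bigD1 i)//= eqxx big1 ?mulr1//.
  by move=> j /negPf ->; rewrite expr0.
under eq_fun do rewrite E.
exact: (@Rintegral_rV_prod R n (fun j (y : R) =>
  y ^+ (if j == i then 2 else 0)%N * expR (- (t * y ^+ 2))) (fun j => h _)).1.
Qed.

(** The integral factors: coordinate i carries the exponent 2 and gives [- heat1 2], the others
    carry 0 and give [heat1 0]. The phases vanish, so every factor is real. *)
Lemma Rintegral_gaussn_cos t z i : 0 < t ->
  \int[lam]_xi (xi ord0 i ^+ 2 * gaussn t xi * cos (dot z xi)) =
  - (2 * pi) ^+ n * heat [:: i; i] t z.
Proof.
move=> t0; pose m j : nat := if j == i then 2 else 0.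
have cg j := Cint_gauss (m j) (z ord0 j) t0.
have [_] := Cint_rV_prod (fun j => (cg j).1).
rewrite (eq_bigr (fun j => (2 * pi * ((-1) ^+ (j == i) * heat1 (m j) t (z ord0 j)))%:C)); last first.
  move=> j _; rewrite (cg j).2 /m; case: eqP => [_|_].
    by rewrite !cosint2// cos0 cos_pihalf mul1r mul0r !oppr0 expr1 mulN1r mulrN.
  by rewrite !cosint0// cos0 cos_pihalf mul1r mul0r oppr0 expr0 mul1r.
rewrite -rmorph_prod => /(congr1 (@complex.Re R)) /=.
rewrite big_split/= prodr_const card_ord big_split/= [X in _ = _ * (X * _)](bigD1 i)//= eqxx expr1.
rewrite [X in _ = _ * (_ * X * _)]big1 ?mulr1; last by move=> j /negPf ->; rewrite expr0.
have -> : \prod_j heat1 (m j) t (z ord0 j) = heat [:: i; i] t z.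
  by apply: eq_bigr => j _; rewrite /m /= addn0 eq_sym; case: (i == j).
rewrite mulN1r mulrN -mulNr => <-.
rewrite /Cint /=; apply: eq_Rintegral => xi _.
rewrite big_split/= -rmorph_prod -cis_sum -/(dot z xi) Re_realM /=; congr (_ * _).
rewrite big_split/= -gaussnE; congr (_ * _).
by rewrite (bigD1 i)//= /m eqxx big1 ?mulr1// => j /negPf ->; rewrite expr0.
Qed.

Lemma fourier_heat t x xi : 0 < t ->
  fourier (fun y => (heat [::] t (y - x))%:C) xi = (gaussn t xi)%:C * cis (- dot x xi).
Proof.
move=> t0.
have ch i := Cint_heat1 (x ord0 i) (xi ord0 i) t0.
have [_ E] := Cint_rV_prod (fun i => (ch i).1).
transitivity (Cint lam (fun y => \prod_i ((heat1 0 t (y ord0 i - x ord0 i))%:C * cis (- (y ord0 i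
    * xi ord0 i))))).
  congr (Cint lam _); apply/funext => y; rewrite big_split/= -rmorph_prod -cis_sum sumrN -/(dot y xi).
  by congr (_%:C * _); apply: eq_bigr => i _; rewrite !mxE.
rewrite E (eq_bigr _ (fun i _ => (ch i).2)) big_split/= -rmorph_prod -cis_sum sumrN -/(dot x xi).
by rewrite gaussnE.
Qed.

End rV.
End heat_fourier.

Section frac_laplacian_heat.
Local Open Scope complex_scope.
Context (R : realType) (n : nat).
Notation mu := (@lebesgue_measure R).
Notation lam := (@lebesgue_rV R n).
Notation Rn := 'rV[R]_n.
Implicit Types (x y z xi : Rn) (i j : 'I_n) (s t : R).

Lemma Rintegral_gamma_ge0 s l : 0 < s < 1 -> 0 <= l ->
  rintegrable mu (fun v : R => wgt s v * (l * expR (- (l * v)))) /\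
  \int[mu]_v (wgt s v * (l * expR (- (l * v)))) = l `^ s * gammaint s.
Proof.
move=> /[dup] s01 /andP[s0 _]; rewrite le_eqVlt => /predU1P[<-|]; last exact: Rintegral_gamma.
under eq_fun do rewrite mul0r mulr0.
split; first exact: rintegrable0.
by rewrite Rintegral_cst// mul0r powR0 ?mul0r// gt_eqF.
Qed.

Lemma powR_dot_le s xi : 0 < s < 1 -> dot xi xi `^ s <= 1 + dot xi xi.
Proof.
move=> /andP[s0 s1]; have [d1|/ltW d1] := leP (dot xi xi) 1.
  apply: (@le_trans _ _ 1); last by rewrite lerDl dot_ge0.
  have := @ge0_ler_powR R s (ltW s0) _ _ (dot_ge0 xi) ler01 d1.
  by rewrite powR1.
apply: (@le_trans _ _ (dot xi xi)); last by rewrite lerDr.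
by rewrite -[leRHS]powRr1 ?dot_ge0// ler_powR// (ltW s1).
Qed.

Lemma measurable_dotl d (T : measurableType d) (f g : T -> Rn) :
  (forall i, measurable_fun setT (fun w => f w ord0 i)) ->
  (forall i, measurable_fun setT (fun w => g w ord0 i)) ->
  measurable_fun setT (fun w => dot (f w) (g w)).
Proof.
by move=> mf mg; apply: measurable_sum => i; exact: measurable_funM.
Qed.

Lemma Re_frac_laplacian_heat s t x y : 0 < t ->
  complex.Re (frac_laplacian s (fun y => (heat [::] t (y - x))%:C) y) =
  (2 * pi) ^- n * \int[lam]_xi (enorm xi `^ (2 * s) * gaussn t xi * cos (dot (x - y) xi)).
Proof.
move=> t0; rewrite /frac_laplacian /inverse_fourier Re_realM; congr (_ * _).
apply: eq_Rintegral => xi _; rewrite fourier_heat// -!mulrA -cisD !Re_realM /=.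
by rewrite -dotNl -dotDl -cosN -dotNl opprD opprK.
Qed.

Lemma Rintegral_gaussn_dot t z : 0 < t ->
  rintegrable lam (fun xi => dot xi xi * gaussn t xi * cos (dot z xi)) /\
  \int[lam]_xi (dot xi xi * gaussn t xi * cos (dot z xi)) =
  - (2 * pi) ^+ n * \sum_i heat [:: i; i] t z.
Proof.
move=> t0.
have E xi : dot xi xi * gaussn t xi * cos (dot z xi) =
    \sum_i (xi ord0 i ^+ 2 * gaussn t xi * cos (dot z xi)).
  by rewrite /dot !mulr_suml; apply: eq_bigr => i _; rewrite expr2.
have ii i : rintegrable lam (fun xi => xi ord0 i ^+ 2 * gaussn t xi * cos (dot z xi)).
  have ig := (rintegrable_gaussn n t0).2 i.
  apply: (le_rintegrable _ ig) => [|xi].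
    apply: measurable_funM; first exact: rintegrable_measurable ig.
    apply: (measurableT_comp (continuous_measurable_fun (@continuous_cos R))).
    by apply: measurable_dotl => // j; exact: measurable_rV_coord.
  have p0 : 0 <= xi ord0 i ^+ 2 * gaussn t xi by rewrite mulr_ge0 ?sqr_ge0 ?gaussn_ge0.
  by rewrite normrM (ger0_norm p0) ler_piMr// ler_norml cos_geN1 cos_le1.
under eq_fun do rewrite E; split; first exact: rintegrable_sum.
rewrite Rintegral_sum// mulr_sumr; apply: eq_bigr => i _.
exact: Rintegral_gaussn_cos.
Qed.

(** After inserting the Gamma integral for |xi|^(2s), the modulus integrated in v is at most
    Gamma(1-s) (1 + |xi|^2) exp(-t |xi|^2), so t > 0 permits exchanging the integrals. For fixed v
    the two Gaussians merge into the one at time t + v, whose inverse transform with factor |xi|^2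
    is minus the Laplacian of the heat kernel. *)
Lemma frac_laplacian_heat s t x y : 0 < s < 1 -> 0 < t ->
  rintegrable mu (fun v => wgt s v * \sum_i heat [:: i; i] (t + v) (x - y)) /\
  complex.Re (frac_laplacian s (fun y => (heat [::] t (y - x))%:C) y) =
  - (gammaint s)^-1 * \int[mu]_v (wgt s v * \sum_i heat [:: i; i] (t + v) (x - y)).
Proof.
move=> s01 t0; rewrite Re_frac_laplacian_heat//; set z := x - y.
have G0 := gammaint_gt0 s01.
pose F xi (v : R) := wgt s v * (dot xi xi * expR (- (dot xi xi * v))) * (gaussn t xi * cos (dot z xi)).
have Fi xi := Rintegral_gamma_ge0 s01 (dot_ge0 xi).
have iF xi : rintegrable mu (F xi).
  rewrite /F; under eq_fun do rewrite mulrC.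
  exact: rintegrableZl (Fi xi).1.
have cos1 xi : `|cos (dot z xi)| <= 1 by rewrite ler_norml cos_geN1 cos_le1.
have [ig ig2] := rintegrable_gaussn n t0.
pose h xi := gammaint s * (gaussn t xi + \sum_i xi ord0 i ^+ 2 * gaussn t xi).
have ih : rintegrable lam h.
  by apply: rintegrableZl; apply: rintegrableD => //; exact: rintegrable_sum.
have mc d (T : measurableType d) (f : T -> Rn) : measurable_fun setT f ->
    forall i, measurable_fun setT (fun w => f w ord0 i).
  by move=> mf i; exact: (measurableT_comp (measurable_rV_coord i) mf).
have mg : measurable_fun setT (gaussn t : Rn -> R) := rintegrable_measurable ig.
have mF : measurable_fun setT (fun p : Rn * measurableTypeR R => F p.1 p.2).
  have md : measurable_fun setT (fun p : Rn * measurableTypeR R => dot p.1 p.1).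
    by apply: measurable_dotl; apply: mc; exact: measurable_fst.
  apply: measurable_funM; last first.
    apply: measurable_funM; first exact: (measurableT_comp mg measurable_fst).
    apply: (measurableT_comp (continuous_measurable_fun (@continuous_cos R))); apply: measurable_dotl => //.
    by apply: mc; exact: measurable_fst.
  apply: measurable_funM; first exact: (measurableT_comp (measurable_wgt s) measurable_snd).
  apply: measurable_funM => //; apply: (measurableT_comp (@measurable_expR R)).
  by apply: measurable_funN; apply: measurable_funM => //; exact: measurable_snd.
have IF xi : \int[mu]_v F xi v = gammaint s * (dot xi xi `^ s * gaussn t xi * cos (dot z xi)).
  rewrite /F; under eq_Rintegral do rewrite mulrC.
  by rewrite (RintegralZl _ measurableT (Fi xi).1) (Fi xi).2; ring.
have hE xi : gaussn t xi * (dot xi xi `^ s * `|cos (dot z xi)|) <=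
    gaussn t xi + \sum_i xi ord0 i ^+ 2 * gaussn t xi.
  rewrite -mulr_suml (_ : \sum_i _ = dot xi xi); last by apply: eq_bigr => i _; rewrite expr2.
  rewrite -[X in _ <= X + _]mulr1 [X in _ <= _ + X]mulrC -mulrDr ler_wpM2l ?gaussn_ge0//.
  by apply: le_trans (powR_dot_le xi s01); rewrite ler_piMr ?powR_ge0.
have iFF : rintegrable (lam \x mu)%E (fun p => F p.1 p.2).
  apply: (rintegrable_prod mF iF ih) => xi.
  have nF v : `|F xi v| = `|gaussn t xi * cos (dot z xi)| * (wgt s v * (dot xi xi * expR (- (dot
      xi xi * v)))).
    have p0 : 0 <= wgt s v * (dot xi xi * expR (- (dot xi xi * v))).
      by rewrite mulr_ge0 ?wgt_ge0// mulr_ge0 ?dot_ge0 ?expR_ge0.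
    by rewrite /F normrM mulrC (ger0_norm p0).
  under eq_Rintegral do rewrite nF.
  rewrite (RintegralZl _ measurableT (Fi xi).1) (Fi xi).2.
  rewrite normrM (ger0_norm (gaussn_ge0 _ _)) (_ : _ * _ = gammaint s * (gaussn t xi * (dot xi xi
      `^ s * `|cos (dot z xi)|))); last by ring.
  by rewrite /h ler_wpM2l ?(ltW G0)// hE.
have ipsi : rintegrable lam (fun xi => dot xi xi `^ s * gaussn t xi * cos (dot z xi)).
  have ih' := rintegrableZl (gammaint s)^-1 ih.
  apply: (le_rintegrable _ ih') => [|xi].
    apply: measurable_funM; last first.
      apply: (measurableT_comp (continuous_measurable_fun (@continuous_cos R))).
      by apply: measurable_dotl => //; exact: mc.
    apply: measurable_funM => //; apply: (measurableT_comp (measurable_powR s)).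
    by apply: measurable_dotl; exact: mc.
  rewrite /h mulKf ?gt_eqF// !normrM (ger0_norm (gaussn_ge0 _ _)) ger0_norm ?powR_ge0//.
  by rewrite mulrAC mulrC hE.
have := RFubini iFF; under eq_Rintegral do rewrite IF.
rewrite (RintegralZl _ measurableT ipsi) => E.
have Fv v : rintegrable lam (F^~ v) /\
    \int[lam]_xi F xi v = - (2 * pi) ^+ n * (wgt s v * \sum_i heat [:: i; i] (t + v) z).
  have [v0|v0] := leP v 0.
    have F0 : F^~ v = fun=> 0 by apply/funext => xi; rewrite /F /wgt /ray ltNge v0 !mul0r.
    rewrite F0 Rintegral_cst// mul0r /wgt /ray ltNge v0 !mul0r mulr0; split => //.
    exact: rintegrable0.
  have [id dE] := Rintegral_gaussn_dot z (addr_gt0 t0 v0).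
  have FE : F^~ v = fun xi => wgt s v * (dot xi xi * gaussn (t + v) xi * cos (dot z xi)).
    by apply/funext => xi; rewrite /F gaussnD /gaussn [v * _]mulrC; ring.
  rewrite FE (RintegralZl _ measurableT id) mulrCA dE; split => //.
  exact: rintegrableZl.
have ic : (2 * pi) ^+ n != 0 :> R by rewrite expf_neq0// mulf_neq0 ?pnatr_eq0// gt_eqF ?pi_gt0.
have iW : rintegrable mu (fun v => wgt s v * \sum_i heat [:: i; i] (t + v) z).
  have iG : rintegrable mu (fun v => \int[lam]_xi F xi v).
    have := integrable_fubini_G iFF; congr (mu.-integrable _ _).
    by apply/funext => v; rewrite /= EFin_Rintegral//; exact: (Fv v).1.
  have WE : (fun v => wgt s v * \sum_i heat [:: i; i] (t + v) z) =
      fun v => - ((2 * pi) ^+ n)^-1 * \int[lam]_xi F xi v.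
    by apply/funext => v; rewrite (Fv v).2 !mulNr mulrN opprK mulKf.
  by rewrite WE; exact: rintegrableZl.
split => //.
transitivity ((2 * pi) ^- n * ((gammaint s)^-1 * (gammaint s * \int[lam]_xi (dot xi xi `^ s *
    gaussn t xi * cos (dot z xi))))).
  rewrite mulKf; last by rewrite gt_eqF.
  apply: (congr1 (fun X => (2 * pi) ^- n * X)).
  apply: eq_Rintegral => xi _.
  by rewrite powRrM powR_mulrn ?enorm_ge0// sqr_sqrtr ?dot_ge0.
rewrite E mulrCA mulNr -mulrN; congr (_ * _).
transitivity ((2 * pi) ^- n * \int[mu]_v (- (2 * pi) ^+ n * (wgt s v * \sum_i heat [:: i; i] (t + v) z))).
  by apply: (congr1 (fun X => (2 * pi) ^- n * X)); apply: eq_Rintegral => v _; rewrite (Fv v).2.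
by rewrite (RintegralZl _ measurableT iW) mulNr mulrN mulKf.
Qed.

End frac_laplacian_heat.

(** * Lipschitz bounds and test functions *)

Section lipschitz.
Context (R : realType).

Lemma is_derive_lipschitz (f f' : R -> R) (L a b : R) : a <= b ->
  (forall x, a <= x <= b -> is_derive x 1 f (f' x)) ->
  (forall x, a <= x <= b -> `|f' x| <= L) -> `|f b - f a| <= L * (b - a).
Proof.
move=> ab fd fL.
have [x||c] := @MVT_segment R f f' a b ab.
- by rewrite in_itv/= => /andP[/ltW ax /ltW xb]; apply: fd; rewrite ax.
- apply: derivable_within_continuous => x; rewrite in_itv/= => xab.
  exact: (@ex_derive _ _ _ _ _ _ _ (fd x xab)).
- rewrite in_itv/= => /fL cL ->; rewrite normrM [`|b - a|]ger0_norm ?subr_ge0//.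
  by rewrite ler_wpM2r ?subr_ge0.
Qed.

Context (n : nat).
Notation Rn := 'rV[R]_n.
Implicit Types (w : Rn -> R) (x y : Rn).

Lemma is_derive_along w x v (d : R) (h : R) :
  is_derive (x + h *: v) v w d -> is_derive h 1 (fun h => w (x + h *: v)) d.
Proof.
move=> [h1 h2].
have E : (fun k : R => k^-1 *: ((w \o shift (x + h *: v)) (k *: v) - w (x + h *: v))) =
  (fun k : R => k^-1 *: (((fun h : R => w (x + h *: v)) \o shift h) (k *: 1) - w (x + h *: v))).
  apply/funext => k /=; rewrite addrCA -scalerDl.
  by rewrite [k *: 1]mulr1.
by apply: DeriveDef; rewrite /derivable /derive -E.
Qed.

(** The coordinates are changed one at a time: [z k] has the first k coordinates of x and the others
    of y. The mean value theorem applies on each of the axis-parallel segments. *)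
Lemma partial_lipschitz w (w' : 'I_n -> Rn -> R) (L : R) :
  (forall i x, is_derive x (delta_mx ord0 i) w (w' i x)) ->
  (forall i x, `|w' i x| <= L) ->
  forall x y, `|w x - w y| <= L * \sum_i `|x ord0 i - y ord0 i|.
Proof.
move=> wd wL x y.
pose z k : Rn := \row_i (if (i < k)%N then x ord0 i else y ord0 i).
have step (i : 'I_n) : `|w (z i.+1) - w (z i)| <= L * `|x ord0 i - y ord0 i|.
  have zE : z i.+1 = z i + (x ord0 i - y ord0 i) *: delta_mx ord0 i.
    apply/rowP => j; rewrite !mxE eqxx/= ltnS leq_eqVlt.
    have [/val_inj ->|ji] := eqVneq (j : nat) i.
      by rewrite ltnn eqxx/= mulr1 addrC subrK.
    by rewrite (_ : (j == i) = false) ?mulr0 ?addr0//; exact/negbTE.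
  have line (h : R) : is_derive h 1 (fun h : R => w (z i + h *: delta_mx ord0 i))
      (w' i (z i + h *: delta_mx ord0 i)) by exact: is_derive_along.
  pose f h := w (z i + h *: delta_mx ord0 i).
  have E0 : w (z i) = f 0 by rewrite /f scale0r addr0.
  rewrite zE -/(f _) E0; have [d0|d0] := leP 0 (x ord0 i - y ord0 i).
    rewrite (ger0_norm d0) -[X in _ <= L * X]subr0.
    by apply: (is_derive_lipschitz d0 (fun h _ => line h)) => h _; exact: wL.
  rewrite distrC (ltr0_norm d0) -[X in _ <= L * X]sub0r.
  by apply: (is_derive_lipschitz (ltW d0) (fun h _ => line h)) => h _; exact: wL.
have -> : w x - w y = \sum_(i < n) (w (z i.+1) - w (z i)).
  rewrite -(big_mkord xpredT (fun i => w (z i.+1) - w (z i))) telescope_sumr//.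
  congr (w _ - w _); apply/rowP => i; rewrite mxE ?ltn_ord//.
apply: le_trans (ler_norm_sum _ _ _) _; rewrite mulr_sumr.
exact: ler_sum.
Qed.

Lemma lipschitz_continuous w (L : R) :
  (forall x y, `|w x - w y| <= L * \sum_i `|x ord0 i - y ord0 i|) -> continuous w.
Proof.
move=> wL x; apply: (@cvgrPdist_le _ _ _ (nbhs x) _ w (w x)).2 => e e0.
have c0 : 0 < `|L| * n%:R + 1 by rewrite ltr_wpDl// mulr_ge0.
have d0 : 0 < e / (`|L| * n%:R + 1) by rewrite divr_gt0.
apply: filterS (nbhsx_ballx x _ d0) => y xy.
apply: le_trans (wL x y) _; apply: le_trans (ler_norm _) _.
rewrite normrM (ger0_norm (sumr_ge0 _ _))//.
apply: (@le_trans _ _ (`|L| * \sum_(i < n) e / (`|L| * n%:R + 1))).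
  by rewrite ler_wpM2l//; apply: ler_sum => i _; exact/ltW/(xy.2 ord0 i).
rewrite sumr_const card_ord -(mulr_natl (e / _) n).
rewrite [leLHS](_ : _ = (`|L| * n%:R * e) / (`|L| * n%:R + 1)); last by ring.
by rewrite ler_pdivrMr// mulrDr mulr1 [e * _]mulrC lerDl ltW.
Qed.

End lipschitz.

(** * Translated heat kernels are Schwartz functions *)

Section schwartz_heat.
Local Open Scope complex_scope.
Context (R : realType) (n : nat).
Notation Rn := 'rV[R]_n.
Implicit Types (x y : Rn) (t : R) (g : seq 'I_n).

Lemma is_derive_heat_shift g t x y i :
  is_derive y (delta_mx ord0 i) (fun y => heat g t (y - x)) (heat (i :: g) t (y - x)).
Proof.
apply: is_derive_line.
have := is_derive_heat g t (y - x) i 0; rewrite scale0r addr0.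
by under eq_fun do rewrite addrAC.
Qed.

Lemma partials_heat g t x :
  partials g (fun y => heat [::] t (y - x)) = fun y => heat g t (y - x).
Proof.
elim: g => [//|i g IH]; rewrite /= -/(partials g _) IH /partial; apply/funext => y.
exact: (@derive_val _ _ _ _ _ _ _ (is_derive_heat_shift g t x y i)).
Qed.

Lemma heat_decay g m t : 0 < t -> exists2 M : R, 0 <= M &
  forall z : Rn, (\prod_i (1 + `|z ord0 i|)) ^+ m * `|heat g t z| <= M.
Proof.
move=> t0; have s0 : 0 < Num.sqrt t by rewrite sqrtr_gt0.
have /choice[C CP] := fun k => gauss_bounded R k m.
have C0 k : 0 <= C k by apply: le_trans (CP k 0); rewrite mulr_ge0// exprn_ge0// normr0 addr0.
have pi40 : 0 < Num.sqrt (4 * pi : R) by rewrite sqrtr_gt0 mulr_gt0// pi_gt0.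
have s1 : 0 <= 1 + Num.sqrt t by rewrite addr_ge0// ltW.
pose B k := (Num.sqrt (4 * pi))^-1 * (Num.sqrt t)^-1 ^+ k.+1 * ((1 + Num.sqrt t) ^+ m * C k).
have B0 k : 0 <= B k.
  by rewrite !mulr_ge0 ?exprn_ge0 ?invr_ge0 ?(ltW s0) ?(ltW pi40).
have hB k (z : R) : (1 + `|z|) ^+ m * `|heat1 k t z| <= B k.
  rewrite /heat1 normrM ger0_norm; last first.
    by rewrite mulr_ge0 ?exprn_ge0 ?invr_ge0 ?(ltW s0) ?(ltW pi40).
  rewrite mulrCA ler_wpM2l//.
  apply: le_trans (_ : (1 + Num.sqrt t) ^+ m * (1 + `|z / Num.sqrt t|) ^+ m * `|gauss k (z /
      Num.sqrt t)| <= _); last first.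
    by rewrite -mulrA ler_wpM2l ?exprn_ge0// mulrC CP.
  rewrite ler_wpM2r// -exprMn; apply: lerXn2r; rewrite ?nnegrE ?mulr_ge0 ?addr_ge0 ?(ltW s0)//.
  have a0 : 0 <= `|z / Num.sqrt t| by [].
  have -> : `|z| = `|z / Num.sqrt t| * Num.sqrt t.
    by rewrite normrM normfV (gtr0_norm s0) mulfVK// gt_eqF.
  by nra.
exists (\prod_(i < n) B (count_mem i g)) => [|z]; first by apply: prodr_ge0.
rewrite /heat normr_prod -prodrXl -big_split/=.
by apply: ler_prod => i _; rewrite mulr_ge0 ?exprn_ge0//=.
Qed.

Lemma schwartz_real_heat t x : 0 < t -> schwartz_real (fun y => heat [::] t (y - x)).
Proof.
move=> t0; split=> [k|m g].
  split=> [g _ i y|g _]; rewrite partials_heat.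
    exact: (@ex_derive _ _ _ _ _ _ _ (is_derive_heat_shift g t x y i)).
  have /choice[M MP] : forall i, exists M : R, 0 <= M /\ forall z, `|heat (i :: g) t z| <= M.
    move=> i; have [M M0 MP] := heat_decay (i :: g) 0 t0; exists M; split=> // z.
    by have := MP z; rewrite expr0 mul1r.
  apply: (@lipschitz_continuous _ _ _ (\sum_i M i)).
  apply: (partial_lipschitz (w' := fun i y => heat (i :: g) t (y - x))) => [i y|i y].
    exact: is_derive_heat_shift.
  apply: le_trans ((MP i).2 _) _; rewrite (bigD1 i)//= lerDl sumr_ge0// => j _.
  exact: (MP j).1.
have [M M0 MP] := heat_decay g m t0.
(* The weight is moved from y to y - x by 1 + |y_i| <= (1 + |x_i|) (1 + |y_i - x_i|). *)
exists ((\prod_i (1 + `|x ord0 i|)) ^+ m * M) => y; rewrite partials_heat.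
apply: le_trans (ler_wpM2l _ (MP (y - x))); last by rewrite exprn_ge0// prodr_ge0// => i _; rewrite addr_ge0.
rewrite mulrA -exprMn ler_wpM2r//; apply: lerXn2r; rewrite ?nnegrE ?enorm_ge0//.
  by rewrite mulr_ge0// prodr_ge0// => i _; rewrite addr_ge0.
apply: le_trans (enorm_le_sum y) _; apply: (@le_trans _ _ (1 + \sum_i `|y ord0 i|)); first by rewrite lerDr.
apply: le_trans (sum_le_prod1D _ (fun i => normr_ge0 (y ord0 i))) _.
rewrite -big_split/=; apply: ler_prod => i _; rewrite addr_ge0//= !mxE.
have := ler_normD (x ord0 i) (y ord0 i - x ord0 i); rewrite subrKC.
move: `|x ord0 i| `|y ord0 i - x ord0 i| (normr_ge0 (x ord0 i)) (normr_ge0 (y ord0 i - x ord0 i))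
    => a b a0 b0 h.
by nra.
Qed.

Lemma schwartz_heat t x : 0 < t -> schwartz (fun y => (heat [::] t (y - x))%:C).
Proof.
move=> t0; split; first exact: schwartz_real_heat.
have p0 g : partials g (fun y : Rn => 0 : R) = fun=> 0.
  by elim: g => [//|i g IH]; rewrite /= -/(partials g _) IH; apply/funext => y; exact: derive_cst.
split=> [k|m g] /=.
  split=> [g _ i y|g _]; rewrite p0; first exact: derivable_cst.
  exact: cst_continuous.
by exists 0 => y; rewrite p0 normr0 mulr0.
Qed.

End schwartz_heat.

(** * The fractional heat equation *)

Section heat_laplacian.
Context (R : realType) (n : nat).
Notation mu := (@lebesgue_measure R).
Notation lam := (@lebesgue_rV R n).
Notation Rn := 'rV[R]_n.
Implicit Types (x y z : Rn) (t s : R) (g : seq 'I_n) (u f : Rn -> R).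

Lemma heatN0 t z : heat [::] t (- z) = heat [::] t z.
Proof. by apply: eq_bigr => i _; rewrite mxE /= heat1N0. Qed.

Lemma heatconv_perm g g' u : perm_eq g g' -> heatconv g u = heatconv g' u.
Proof.
move=> /permP p; apply/funext => t; apply/funext => x; apply: eq_Rintegral => y _.
by congr (_ * _); apply: eq_bigr => i _; rewrite p.
Qed.

(** The Laplacian of D^g u_t, which by [is_derive_heatconv_time] is also its time derivative. *)
Definition lapconv g u t x : R := \sum_i heatconv [:: i, i & g] u t x.

Lemma lapconv_le g : exists2 C : R, 0 <= C & forall u M t x,
  measurable_fun setT u -> (forall y, `|u y| <= M) -> 0 < t ->
  `|lapconv g u t x| <= C * M * t `^ (- ((size g).+2%:R / 2)).
Proof.
have /choice[C CP] : forall i, exists C : R, 0 <= C /\ forall u M t x,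
  measurable_fun setT u -> (forall y, `|u y| <= M) -> 0 < t ->
  `|heatconv [:: i, i & g] u t x| <= C * M * t `^ (- ((size g).+2%:R / 2)).
  by move=> i; have [C C0 CP] := @heatconv_le R n [:: i, i & g]; exists C.
exists (\sum_i C i) => [|u M t x mu uM t0]; first by apply: sumr_ge0 => i _; exact: (CP i).1.
apply: le_trans (ler_norm_sum _ _ _) _; rewrite -mulrA mulr_suml; apply: ler_sum => i _.
by rewrite mulrA; exact: (CP i).2.
Qed.

Lemma Rintegral_heat_le g : exists2 C : R, 0 <= C & forall u M t x,
  measurable_fun setT u -> (forall y, `|u y| <= M) -> 0 < t ->
  \int[lam]_y `|(\sum_i heat [:: i, i & g] t (x - y)) * u y| <= C * M * t `^ (- ((size g).+2%:R / 2)).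
Proof.
have /choice[C CP] : forall i, exists C : R, 0 <= C /\ forall t z, 0 < t ->
  `|heat (i :: i :: g) t z| <= C * (Num.sqrt t)^-1 ^+ (size g).+2 * cauchyn (Num.sqrt t) z.
  by move=> i; have [C ? ?] := @heat_le R n (i :: i :: g); exists C.
have C0 : 0 <= \sum_i C i by apply: sumr_ge0 => i _; exact: (CP i).1.
exists ((\sum_i C i) * pi ^+ n) => [|u M t x mu uM t0]; first by rewrite mulr_ge0// exprn_ge0// pi_ge0.
have s0 : 0 < Num.sqrt t by rewrite sqrtr_gt0.
have M0 : 0 <= M by apply: le_trans (uM 0).
have [ci cE] := Rintegral_cauchyn x s0.
pose D := (\sum_i C i) * (Num.sqrt t)^-1 ^+ (size g).+2 * M.
have := le_norm_Rintegral (f := fun y => `|(\sum_i heat [:: i, i & g] t (x - y)) * u y|)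
  _ (rintegrableZl D ci).
rewrite (RintegralZl _ measurableT ci) cE (_ : D * _ = (\sum_i C i) * pi ^+ n * M * t `^ (-
    ((size g).+2%:R / 2))); last first.
  by rewrite /D sqrtV_exprE//; ring.
move=> h; apply: le_trans (ler_norm _) _; apply: h.
  apply: measurableT_comp => //; apply: measurable_funM => //; apply: measurable_sum => i.
  by apply: measurable_heat => //; exact: measurable_coordB.
move=> y; rewrite normr_id normrM /D mulrAC; apply: ler_pM => //.
apply: le_trans (ler_norm_sum _ _ _) _; rewrite -mulrA mulr_suml; apply: ler_sum => i _.
by rewrite mulrA; exact: (CP i).2.
Qed.

Section bounded.
Variables (u : Rn -> R) (M : R).
Hypotheses (mu_ : measurable_fun setT u) (uM : forall x, `|u x| <= M).

Lemma lapconvE g t x : 0 < t ->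
  lapconv g u t x = \int[lam]_y ((\sum_i heat [:: i, i & g] t (x - y)) * u y) /\
  rintegrable lam (fun y => (\sum_i heat [:: i, i & g] t (x - y)) * u y).
Proof.
move=> t0; have ih i := rintegrable_heat mu_ uM [:: i, i & g] x t0.
under [in X in _ /\ X]eq_fun do rewrite mulr_suml.
split; last exact: rintegrable_sum.
rewrite /lapconv /heatconv -Rintegral_sum//.
by apply: eq_Rintegral => y _; rewrite mulr_suml.
Qed.

Lemma continuous_heatconv_time g t x : 0 < t -> {for t, continuous (fun t => heatconv g u t x)}.
Proof.
by move=> t0; exact: is_derive_continuous (is_derive_heatconv_time mu_ uM g x t0).
Qed.

Lemma continuous_lapconv_time g t x : 0 < t -> {for t, continuous (fun t => lapconv g u t x)}.
Proof.
move=> t0; rewrite /lapconv.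
have := @is_derive_sum R R R n (fun i t => heatconv [:: i, i & g] u t x) t 1
  (fun i => lapconv [:: i, i & g] u t x).
move=> h; have {}h : is_derive t 1 (\sum_(i < n) (fun t => heatconv [:: i, i & g] u t x))
    (\sum_(i < n) lapconv [:: i, i & g] u t x).
  by apply: h => i; exact: (is_derive_heatconv_time mu_ uM [:: i, i & g] x t0).
have := is_derive_continuous h.
by congr {for _, continuous _}; apply/funext => t'; rewrite fct_sumE.
Qed.

Lemma is_derive_lapconv g t x i : 0 < t ->
  is_derive x (delta_mx ord0 i) (lapconv g u t) (lapconv (i :: g) u t x).
Proof.
move=> t0; rewrite /lapconv.
have h : is_derive x (delta_mx ord0 i) (\sum_(j < n) heatconv [:: j, j & g] u t)
    (\sum_(j < n) heatconv [:: i, j, j & g] u t x).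
  apply: is_derive_sum => j; exact: (is_derive_heatconv mu_ uM).
rewrite (_ : (fun x => _) = \sum_(j < n) heatconv [:: j, j & g] u t); last first.
  by apply/funext => y; rewrite fct_sumE.
(* Differentiation puts [i] in front of the repeated letter; only the letter counts matter. *)
have -> // : \sum_j heatconv [:: j, j, i & g] u t x = \sum_j heatconv [:: i, j, j & g] u t x.
apply: eq_bigr => j _; rewrite (@heatconv_perm _ [:: i, j, j & g])//.
by apply/permP => p /=; ring.
Qed.

Lemma rintegrable_lapconv s g t x : 0 < s < 1 -> 0 < t ->
  rintegrable mu (fun v => wgt s v * lapconv g u (t + v) x).
Proof.
move=> /andP[s0 s1] t0; have [C C0 CP] := lapconv_le g.
have q1 : 1 <= (size g).+2%:R / 2 :> R by rewrite ler_pdivlMr// mul1r ler_nat.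
have [wi _] := @Rintegral_wgt R s ((size g).+2%:R / 2) t s1 ltac:(lra) ltac:(lra) t0.
apply: (le_rintegrable _ (rintegrableZl (C * M) wi)) => [|v].
  apply: measurable_wgtM => v v0.
  apply: (@continuous_comp _ _ _ (fun v => t + v) (fun t => lapconv g u t x)).
    by apply: cvgD; [exact: cvg_cst|exact: cvg_id].
  by apply: continuous_lapconv_time; rewrite addr_gt0.
rewrite normrM (ger0_norm (wgt_ge0 _ _)) mulrCA.
have [v0|v0] := leP v 0; first by rewrite /wgt /ray ltNge v0 !mul0r.
by rewrite ler_wpM2l ?wgt_ge0// CP// addr_gt0.
Qed.

End bounded.

(** The value of (-Delta)^s applied to the heat kernel at time t, in the form given by
    [frac_laplacian_heat]. *)
Definition frac_heat s t z : R :=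
  - (gammaint s)^-1 * \int[mu]_v (wgt s v * \sum_i heat [:: i; i] (t + v) z).

(* The fractional heat equation satisfied by a bounded distributional solution;
   it depends on [u] and [f] only up to null sets. *)
Definition heat_solution s u f : Prop := forall t x, 0 < t ->
  heatconv [::] f t x = - (gammaint s)^-1 * \int[mu]_v (wgt s v * lapconv [::] u (t + v) x).

(** Fubini in (v, y): the Laplacian of the kernel at time t + v has L^1 norm O(1/(t+v)), and v^(-s)
    / (t+v) is integrable on the half-line. *)
Lemma frac_heat_dual s u M t x : 0 < s < 1 -> measurable_fun setT u ->
  (forall x, `|u x| <= M) -> 0 < t ->
  rintegrable lam (fun y => u y * frac_heat s t (x - y)) /\
  \int[lam]_y (u y * frac_heat s t (x - y)) =
  - (gammaint s)^-1 * \int[mu]_v (wgt s v * lapconv [::] u (t + v) x).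
Proof.
move=> s01 mu_ uM t0; case/andP: (s01) => s0 s1.
pose F (v : R) y := wgt s v * ((\sum_i heat [:: i; i] (t + v) (x - y)) * u y).
have [C C0 CP] := Rintegral_heat_le [::].
have [wi _] := @Rintegral_wgt R s 1 t s1 ltac:(lra) ltac:(lra) t0.
have neg v y : v <= 0 -> F v y = 0 by move=> v0; rewrite /F /wgt /ray ltNge v0 !mul0r.
have iF v : rintegrable lam (F v).
  have [v0|v0] := leP v 0.
    rewrite (_ : F v = fun=> 0); first exact: rintegrable0.
    by apply/funext => y; rewrite neg.
  by apply: rintegrableZl; apply: (lapconvE mu_ uM [::] x _).2; rewrite addr_gt0.
have mF : measurable_fun setT (fun p : measurableTypeR R * Rn => F p.1 p.2).
  apply: measurable_funM; first exact: (measurableT_comp (measurable_wgt s) measurable_fst).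
  apply: measurable_funM; last exact: (measurableT_comp mu_ measurable_snd).
  apply: measurable_sum => i; apply: measurable_heat => [|j].
    by apply: measurable_funD => //; exact: measurable_fst.
  under eq_fun do rewrite !mxE.
  apply: measurable_funB => //.
  exact: (measurableT_comp (measurable_rV_coord j) measurable_snd).
have iFF : rintegrable (mu \x lam)%E (fun p => F p.1 p.2).
  apply: (rintegrable_prod mF iF (rintegrableZl (C * M) wi)) => v.
  have [v0|v0] := leP v 0.
    under eq_Rintegral do rewrite neg// normr0.
    by rewrite Rintegral_cst// mul0r /wgt /ray ltNge v0 !mul0r mulr0.
  have tv : 0 < t + v by rewrite addr_gt0.
  have h := CP u M (t + v) x mu_ uM tv.
  rewrite /F; under eq_Rintegral do rewrite normrM (ger0_norm (wgt_ge0 _ _)).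
  have il := rintegrable_normr (lapconvE mu_ uM [::] x tv).2.
  rewrite (RintegralZl _ measurableT il) mulrCA ler_wpM2l ?wgt_ge0//.
  by rewrite -[X in _ `^ (- X)](@divff R 2).
have iW y : rintegrable mu (fun v => wgt s v * \sum_i heat [:: i; i] (t + v) (x - y)).
  exact: (frac_laplacian_heat x y s01 t0).1.
have GE : (fun y => u y * frac_heat s t (x - y)) = fun y => - (gammaint s)^-1 * \int[mu]_v F v y.
  apply/funext => y; rewrite /frac_heat mulrCA; congr (_ * _); rewrite -(RintegralZl _ measurableT (iW y)).
  by apply: eq_Rintegral => v _; rewrite /F mulrCA [u y * _]mulrC.
have iG := integrable_fubini_G iFF.
have iG' : rintegrable lam (fun y => \int[mu]_v F v y).
  have := iG; congr (lam.-integrable _ _).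
  apply/funext => y; rewrite /= EFin_Rintegral//.
  rewrite (_ : F^~ y = fun v => u y * (wgt s v * \sum_i heat [:: i; i] (t + v) (x - y))); last first.
    by apply/funext => v; rewrite /F; ring.
  exact: rintegrableZl.
rewrite GE; split; first exact: rintegrableZl.
rewrite (RintegralZl _ measurableT iG') -(RFubini iFF); congr (_ * _).
apply: eq_Rintegral => v _; have [v0|v0] := leP v 0.
  rewrite /wgt /ray ltNge v0 !mul0r; under eq_Rintegral do rewrite neg//.
  by rewrite Rintegral_cst// mul0r.
have [lE li] := lapconvE mu_ uM [::] x (addr_gt0 t0 v0).
by rewrite (RintegralZl _ measurableT li) lE.
Qed.

(** The equation for the given pair [u0], [f0] is tested with the heat kernel centred at x and only
    its real part is kept. Representatives [u], [f] bounded everywhere are substituted under the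
    integrals. *)
Lemma frac_laplacian_heat_solution s u0 u f0 f M N : 0 < s < 1 -> frac_laplacian_eq s u0 f0 ->
  measurable_fun setT u0 -> measurable_fun setT f0 ->
  measurable_fun setT u -> measurable_fun setT f ->
  (forall x, `|u x| <= M) -> (forall x, `|f x| <= N) ->
  {ae lam, forall x, u0 x = u x} -> {ae lam, forall x, f0 x = f x} -> heat_solution s u f.
Proof.
move=> s01 equf mu0 mf0 mu_ mf_ uM fN u0u f0f t x t0.
have ReC (phi : Rn -> R[i]) : complex.Re (Cintegral phi) = \int[lam]_y complex.Re (phi y) by [].
have := congr1 (@complex.Re R) (equf _ (schwartz_heat x t0)); rewrite !ReC.
under eq_Rintegral do rewrite Re_realM (frac_laplacian_heat _ _ s01 t0).2 -/(frac_heat s t _).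
under [X in _ = X -> _]eq_Rintegral do rewrite Re_realM/= -opprB heatN0 mulrC.
have mG : measurable_fun setT (fun y => frac_heat s t (x - y)).
  (* Measurability of the kernel is read off from the integrability statement for the constant
     function 1. *)
  have [i1 _] := frac_heat_dual (u := fun=> 1) x s01 (measurable_cst _) (fun=> lexx `|1|) t0.
  by have := rintegrable_measurable i1; under eq_fun do rewrite mul1r.
have mh : measurable_fun setT (fun y => heat [::] t (x - y)).
  by apply: measurable_heat => //; exact: measurable_coordB.
rewrite (ae_eq_Rintegral (g := fun y => u y * frac_heat s t (x - y))).
- rewrite (frac_heat_dual x s01 mu_ uM t0).2 => ->.
  apply: ae_eq_Rintegral; [exact: measurable_funM|exact: measurable_funM|].
  by apply: filterS f0f => y ->.
- exact: measurable_funM.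
- exact: measurable_funM.
- by apply: filterS u0u => y ->.
Qed.

Section equation.
Variables (s : R) (u f : Rn -> R) (M N : R).
Hypotheses (s01 : 0 < s < 1) (equf : heat_solution s u f).
Hypotheses (mu_ : measurable_fun setT u) (uM : forall x, `|u x| <= M).
Hypotheses (mf_ : measurable_fun setT f) (fN : forall x, `|f x| <= N).

(** One letter at a time: the bound of [lapconv_le] is uniform in x, so a single majorant v^(-s)
    (t+v)^(-q) permits differentiating in x under the integral over v. *)
Lemma heatconv_equation g t x : 0 < t ->
  heatconv g f t x = - (gammaint s)^-1 * \int[mu]_v (wgt s v * lapconv g u (t + v) x).
Proof.
move=> t0; case/andP: (s01) => s0 s1; elim: g x => [|i g IH] x; first exact: equf.
pose e : Rn := delta_mx ord0 i.
have [C C0 CP] := lapconv_le (i :: g).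
pose q : R := (size (i :: g)).+2%:R / 2.
have q1 : 1 <= q by rewrite /q ler_pdivlMr// mul1r ler_nat.
have [wi _] := @Rintegral_wgt R s q t s1 ltac:(lra) ltac:(lra) t0.
have := @is_derive_Rintegral R _ _ mu (fun h v => wgt s v * lapconv g u (t + v) (x + h *: e))
  (fun h v => wgt s v * lapconv (i :: g) u (t + v) (x + h *: e)) 0 1
  (fun v => C * M * (wgt s v * (t + v) `^ (- q))) ltr01.
rewrite scale0r addr0.
have wneg v (a : R) : v <= 0 -> wgt s v * a = 0 by move=> v0; rewrite /wgt /ray ltNge v0 !mul0r.
move=> /(_ _ _ (rintegrableZl (C * M) wi) _) dI.
have {}dI : is_derive (0 : R) 1 (fun h : R => \int[mu]_v (wgt s v * lapconv g u (t + v) (x + h *: e)))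
    (\int[mu]_v (wgt s v * lapconv (i :: g) u (t + v) x)).
  apply: dI => [h v _|h _|h v _].
  - have [v0|v0] := leP v 0.
      by under eq_fun do rewrite wneg//; rewrite wneg//; exact: is_derive_cst.
    have tv : 0 < t + v by rewrite addr_gt0.
    under eq_fun do rewrite mulrC; rewrite mulrC; apply: is_derive_mulr.
    by apply: is_derive_along; exact: (is_derive_lapconv mu_ uM).
  - exact: (rintegrable_lapconv mu_ uM).
  - rewrite normrM (ger0_norm (wgt_ge0 _ _)).
    have [v0|v0] := leP v 0; first by rewrite !wneg// mulr0.
    by rewrite mulrCA ler_wpM2l ?wgt_ge0// CP// addr_gt0.
have dh : is_derive x e (heatconv g f t) (heatconv (i :: g) f t x).
  exact: (is_derive_heatconv mf_ fN).
rewrite -(@derive_val _ _ _ _ _ _ _ dh).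
apply: (@derive_val _ _ _ _ _ _ _ _); apply: is_derive_line.
under eq_fun do rewrite IH mulrC.
by rewrite mulrC; exact: is_derive_mulr.
Qed.

End equation.

(** [abel_inversion_le] with A = D^g u_t, Phi = D^g f_t and k = (|g| - al)/2, for which s < k is the
    hypothesis on |g|. The bound M of u only provides the decay at infinity, so it is absent from
    the estimate. *)
Lemma heatconv_decay s al g : 0 < s < 1 -> 0 <= al <= 1 -> al + 2 * s < (size g)%:R ->
  exists2 C : R, 0 <= C & forall u f M K N t x,
  heat_solution s u f -> measurable_fun setT u -> (forall x, `|u x| <= M) ->
  measurable_fun setT f -> (forall x, `|f x| <= K) ->
  (forall x y, `|f x - f y| <= N * enorm (x - y) `^ al) -> 0 < t ->
  `|heatconv g u t x| <= C * N * t `^ ((al + 2 * s - (size g)%:R) / 2).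
Proof.
move=> s01 al01 ag; case/andP: (s01) => s0 s1; case/andP: (al01) => al0 al1.
(* The empty word is excluded, since al + 2s > 0. *)
case: g ag => [|i g] ag; first by rewrite /= in ag; lra.
have [C C0 CP] := heatconv_holder_le i g al01.
have [D D0 DP] := lapconv_le (i :: g).
have [E E0 EP] := @heatconv_le R n (i :: g).
set k : R := ((size (i :: g))%:R - al) / 2.
have sk : s < k by rewrite /k ltr_pdivlMr//; lra.
have G0 := gammaint_gt0 s01.
have B1 : 0 < betaint s 1 by apply: betaint_gt0 => //; lra.
have B2 : 0 < betaint (1 - s) k by apply: betaint_gt0 => //; lra.
exists (((gammaint s)^-1 * betaint s 1)^-1 * betaint (1 - s) k * C) => [|u f M K N t x equf mu_
    uM mf_ fK fN t0].
  by rewrite mulr_ge0// mulr_ge0 ?(ltW B2)// invr_ge0 mulr_ge0 ?(ltW B1)// invr_ge0 ltW.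
have TP : tail_primitive (fun t => heatconv (i :: g) u t x) (fun t => lapconv (i :: g) u t x)
    ((size (i :: g))%:R / 2) (D * M).
  split.
  - by rewrite divr_gt0// ltr0n.
  - by move=> v v0; exact: (is_derive_heatconv_time mu_ uM).
  - by move=> v v0; exact: (continuous_lapconv_time mu_ uM).
  - move=> v v0; apply: le_trans (DP u M v x mu_ uM v0) _.
    by rewrite (_ : - _ = -1 - (size (i :: g))%:R / 2)// -addn2 natrD; field.
  - have d0 : 0 < (size (i :: g))%:R / 2 :> R by rewrite divr_gt0// ltr0n.
    have c0 : (fun v : R => E * M * v `^ (- ((size (i :: g))%:R / 2))) @ +oo --> 0.
      by rewrite -[X in _ --> X](mulr0 (E * M)); apply: cvgMr; exact: cvgy_powRN.
    apply: (squeeze_cvgr _ (cvg_trans (cvgN c0) _) c0); last by rewrite oppr0.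
    near=> v; rewrite -ler_norml; apply: EP => //; near: v; exact: nbhs_pinfty_gt.
have := abel_inversion_le TP s01 t0 (c := (gammaint s)^-1) (K := C * N) (k := k)
  (Phi := fun t => heatconv (i :: g) f t x).
rewrite (_ : (al + 2 * s - (size (i :: g))%:R) / 2 = s - k); last by rewrite /k; field.
rewrite -!mulrA [C * (N * _)]mulrA => h; apply: h => //.
- by rewrite invr_gt0.
- by move=> v v0; exact: (continuous_heatconv_time mf_ fK).
- by move=> v v0; exact: (heatconv_equation s01 equf mu_ uM mf_ fK).
- move=> v v0; apply: le_trans (CP f K N v x mf_ fK fN v0) _.
  by rewrite /k -mulNr opprB.
Unshelve. all: by end_near. Qed.

End heat_laplacian.

(** * Regularity of the limit at time zero *)

Section derivation_from_estimates.
Context (R : realType).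

Lemma le_norm_derive (f f' P P' : R -> R) (a b : R) : a <= b ->
  (forall x, a <= x <= b -> is_derive x 1 f (f' x)) ->
  (forall x, a <= x <= b -> is_derive x 1 P (P' x)) ->
  (forall x, a <= x <= b -> `|f' x| <= P' x) -> `|f b - f a| <= P b - P a.
Proof.
move=> ab fd Pd fP.
have mono (F F' : R -> R) : (forall x, a <= x <= b -> is_derive x 1 F (F' x)) ->
    (forall x, a <= x <= b -> 0 <= F' x) -> F a <= F b.
  move=> Fd F0; have [x||c] := @MVT_segment R F F' a b ab.
  - by rewrite in_itv/= => /andP[/ltW ax /ltW xb]; apply: Fd; rewrite ax.
  - apply: derivable_within_continuous => x; rewrite in_itv/= => xab.
    exact: (@ex_derive _ _ _ _ _ _ _ (Fd x xab)).
  - by rewrite in_itv/= => /F0 c0 E; rewrite -subr_ge0 E mulr_ge0// subr_ge0.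
have h1 : P a - f a <= P b - f b.
  apply: (mono (fun x => P x - f x) (fun x => P' x - f' x)) => x xab.
    by have := Pd x xab; have := fd x xab => ? ?; exact: is_deriveB.
  by rewrite subr_ge0; apply: le_trans (fP x xab); exact: ler_norm.
have h2 : P a + f a <= P b + f b.
  apply: (mono (fun x => P x + f x) (fun x => P' x + f' x)) => x xab.
    by have := Pd x xab; have := fd x xab => ? ?; exact: is_deriveD.
  by have := fP x xab; rewrite ler_norml => /andP[? _]; lra.
by rewrite ler_norml; apply/andP; split; lra.
Qed.

Lemma is_derive_lipschitz0 (f f' : R -> R) (L h : R) :
  (forall x : R, `|x| <= `|h| -> is_derive x 1 f (f' x)) ->
  (forall x : R, `|x| <= `|h| -> `|f' x| <= L) -> `|f h - f 0| <= L * `|h|.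
Proof.
move=> fd fL; have [h0|/ltW h0] := leP 0 h.
  have hE x : 0 <= x <= h -> `|x| <= `|h| by move=> /andP[x0 xh]; rewrite !ger0_norm.
  rewrite [X in _ * X]ger0_norm// -[X in _ * X]subr0.
  by apply: (is_derive_lipschitz h0) => x /hE; [exact: fd|exact: fL].
have hE x : h <= x <= 0 -> `|x| <= `|h| by move=> /andP[xh x0]; rewrite !ler0_norm// lerN2.
rewrite distrC [X in _ * X]ler0_norm// -[X in _ * X]sub0r.
by apply: (is_derive_lipschitz h0) => x /hE; [exact: fd|exact: fL].
Qed.

Lemma is_derive_dist (f : R -> R) (d : R) :
  (forall e, 0 < e -> exists2 r, 0 < r &
     forall h, `|h| <= r -> `|f h - f 0 - h * d| <= e * `|h|) ->
  is_derive (0 : R) 1 f d.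
Proof.
move=> fd.
suff H : h^-1 *: ((f \o shift 0) (h *: 1) - f 0) @[h --> 0^'] --> d.
  by apply: DeriveDef; [apply/cvg_ex; exists d|exact: cvg_lim].
apply/cvgrPdist_le => e e0; have [r r0 fr] := fd e e0.
near=> h.
have h0 : h != 0 by near: h; exact: nbhs_dnbhs_neq.
have hr : `|h| <= r by near: h; exact: dnbhs0_le.
have h1 : 0 < `|h| by rewrite normr_gt0.
rewrite /= [h *: 1]mulr1 addr0 -(ler_pM2r h1).
rewrite distrC -normrM mulrBl [h^-1 *: _]mulrC mulfVK// mulrC.
exact: fr.
Unshelve. all: by end_near. Qed.

(** The hypothesis is the form in which uniform limits of Lipschitz functions present themselves. *)
Lemma eps_lipschitz_continuous n (w : 'rV[R]_n -> R) :
  (forall e, 0 < e -> exists L, forall x y,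
     `|w x - w y| <= e + L * \sum_i `|x ord0 i - y ord0 i|) -> continuous w.
Proof.
move=> wL x; apply: (@cvgrPdist_le _ _ _ (nbhs x) _ w (w x)).2 => e e0.
have e20 : 0 < e / 2 by lra.
have [L wxL] := wL _ e20.
pose v (y : 'rV[R]_n) : R := L * \sum_i `|x ord0 i - y ord0 i|.
have cv : continuous v.
  apply: (@lipschitz_continuous _ _ _ `|L|) => y z.
  rewrite -mulrBr normrM ler_wpM2l// -sumrB; apply: le_trans (ler_norm_sum _ _ _) _.
  apply: ler_sum => i _; apply: le_trans (ler_dist_dist _ _) _.
  by rewrite opprB [x _ _ - _]addrC addrACA subrr addr0 addrC distrC.
have /cvgrPdist_le/(_ _ e20) := cv x.
have v0 : v x = 0 by rewrite /v big1 ?mulr0// => i _; rewrite subrr normr0.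
apply: filterS => y; rewrite v0 sub0r normrN => vy.
apply: le_trans (wxL x y) _; have := ler_norm (v y); rewrite -/(v y) => ?; lra.
Qed.

End derivation_from_estimates.

Lemma is_derive_translate (R : realType) n (w : 'rV[R]_n -> R) x v h (d : R) :
  is_derive (x + h) v w d -> is_derive x v (fun z => w (z + h)) d.
Proof.
move=> wd; apply: is_derive_line; under eq_fun do rewrite addrAC.
by apply: is_derive_along; rewrite scale0r addr0.
Qed.

(** * Differences of functions and of their approximations *)

Section approximation.
Context (R : realType).
Implicit Types a b c d p q : R.

Lemma approx_dist a b c d p q : `|c - d| <= p -> `|d - b| <= q -> `|c - a| <= q ->
  `|a - b| <= 2 * q + p.
Proof.
move=> h1 h2 h3; have -> : a - b = (c - d) + (d - b) - (c - a) by ring.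
have := ler_normB (c - d + (d - b)) (c - a); have := ler_normD (c - d) (d - b); lra.
Qed.

Lemma approx_diff a b a' b' d p q : `|a - d - b| <= p -> `|a - a'| <= q -> `|b - b'| <= q ->
  `|a' - b' - d| <= 2 * q + p.
Proof.
move=> h1 h2 h3; have -> : a' - b' - d = (a - d - b) - (a - a') + (b - b') by ring.
have := ler_normD (a - d - b - (a - a')) (b - b').
have := ler_normB (a - d - b) (a - a'); lra.
Qed.

Lemma approx_diff2 a b c a' b' c' p q : `|a + b - 2 * c| <= p ->
  `|a - a'| <= q -> `|b - b'| <= q -> `|c - c'| <= q -> `|a' + b' - 2 * c'| <= 4 * q + p.
Proof.
move=> h1 h2 h3 h4.
have -> : a' + b' - 2 * c' = ((a + b - 2 * c) - (a - a')) - (b - b') + (c - c') + (c - c') by ring.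
have := ler_normD ((a + b - 2 * c - (a - a')) - (b - b') + (c - c')) (c - c').
have := ler_normD ((a + b - 2 * c - (a - a')) - (b - b')) (c - c').
have := ler_normB (a + b - 2 * c - (a - a')) (b - b').
have := ler_normB (a + b - 2 * c) (a - a'); lra.
Qed.

Lemma diff2_le a b c p : `|a - c - (c - b)| <= p -> `|a + b - 2 * c| <= p.
Proof. by rewrite (_ : a + b - 2 * c = a - c - (c - b)) //; ring. Qed.

Lemma norm_diff2_le a b c q : `|a| <= q -> `|b| <= q -> `|c| <= q -> `|a + b - 2 * c| <= 4 * q.
Proof.
move=> h1 h2 h3; have := @approx_diff2 0 0 0 a b c 0 q.
by rewrite !sub0r !normrN mulr0 !addr0 subr0 normr0 lexx; apply.
Qed.

End approximation.

(** * The limit of u_t at time zero and its modulus of continuity *)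

Section heat_limit.
Context (R : realType) (n : nat).
Notation Rn := 'rV[R]_n.
Implicit Types (x y z : Rn) (t : R) (g : seq 'I_n).
Variables (u : Rn -> R) (M : R).
Hypotheses (mu_ : measurable_fun setT u) (uM : forall x, `|u x| <= M).
Variables (k : nat) (gam K : R).
Hypotheses (gam01 : 0 < gam <= 1) (K0 : 0 <= K).
Hypothesis heatconv1_le : forall g x, (size g <= k)%N -> `|heatconv g u 1 x| <= K.
Hypothesis lapconv_le_powR : forall g t x, (size g <= k)%N -> 0 < t <= 1 ->
  `|lapconv g u t x| <= K * t `^ (gam / 2 - 1).

(* The primitive of [K * t `^ (gam / 2 - 1)]. *)
Let E t : R := 2 / gam * K * t `^ (gam / 2).

Let gam0 : 0 < gam. Proof. by case/andP: gam01. Qed.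

Let E_ge0 t : 0 <= E t.
Proof. by rewrite /E !mulr_ge0 ?powR_ge0// ?invr_ge0 ltW. Qed.

Let E_small e : 0 < e -> exists2 t, 0 < t <= 1 & E t <= e.
Proof.
move=> e0; pose c := 2 / gam * K + 1.
have c1 : 1 <= c by rewrite /c lerDr !mulr_ge0 ?invr_ge0// ltW.
have c0 : 0 < c by lra.
pose r := Num.min 1 (e / c).
have r0 : 0 < r by rewrite lt_min ltr01 divr_gt0.
exists (r `^ (2 / gam)).
  rewrite powR_gt0//= (le_trans (@ge0_ler_powR R (2 / gam) _ r 1 _ _ _)) ?powR1//.
  - by rewrite divr_ge0// ltW.
  - by rewrite nnegrE ltW.
  - by rewrite nnegrE.
  - by rewrite ge_min lexx.
rewrite /E -powRrM (_ : 2 / gam * (gam / 2) = 1); last by field; rewrite gt_eqF.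
rewrite powRr1 ?(ltW r0)//; apply: (@le_trans _ _ (c * (e / c))); last first.
  by rewrite mulrC divfK ?gt_eqF.
apply: ler_pM; rewrite ?(ltW r0)//.
- by rewrite !mulr_ge0 ?invr_ge0// ltW.
- by rewrite /c lerDl.
- by rewrite ge_min lexx orbT.
Qed.

(** [lapconv] is the time derivative, and its bound has exponent gam/2 - 1 > -1, hence the primitive
    [E], which vanishes at 0. *)
Lemma heatconv_time_le g r t x : (size g <= k)%N -> 0 < r -> r <= t -> t <= 1 ->
  `|heatconv g u t x - heatconv g u r x| <= E t - E r.
Proof.
move=> gk r0 rt t1.
apply: (@le_norm_derive _ (fun t => heatconv g u t x) (fun t => lapconv g u t x) E
  (fun t => K * t `^ (gam / 2 - 1)) r t rt) => v /andP[rv vt].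
- by apply: (is_derive_heatconv_time mu_ uM); exact: lt_le_trans rv.
- have v0 : 0 < v by exact: lt_le_trans rv.
  have -> : K * v `^ (gam / 2 - 1) = gam / 2 * v `^ (gam / 2 - 1) * (2 / gam * K).
    by field; rewrite gt_eqF.
  rewrite /E; under eq_fun do rewrite mulrC.
  by apply: is_derive_mulr; exact: is_derive_powR.
- by apply: lapconv_le_powR => //; rewrite (lt_le_trans r0 rv) (le_trans vt t1).
Qed.

(* [heatconv g u t x + E t] is nondecreasing in t on ]0, 1], so that this infimum
   is the limit of [heatconv g u t x] at 0. *)
Definition heatlim g x : R :=
  inf [set heatconv g u t x + E t | t in [set t : R | 0 < t <= 1]].

(** By [heatconv_time_le], adding [E] makes the function of time nondecreasing and subtracting it
    makes it nonincreasing. So every value minus [E] is a lower bound of the set defining the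
    infimum. *)
Lemma heatlim_dist g t x : (size g <= k)%N -> 0 < t <= 1 ->
  `|heatconv g u t x - heatlim g x| <= E t.
Proof.
move=> gk /andP[t0 t1].
have lb r : 0 < r <= 1 -> lbound [set heatconv g u t x + E t | t in [set t : R | 0 < t <= 1]]
    (heatconv g u r x - E r).
  move=> /andP[r0 r1] _ [v /andP[v0 v1] <-].
  have [rv|/ltW vr] := leP r v.
    move: (E_ge0 v) (E_ge0 r) (heatconv_time_le x gk r0 rv v1).
    move: (E v) (E r) (heatconv g u v x) (heatconv g u r x) => a b c d a0 b0.
    by rewrite ler_norml => /andP[? _]; lra.
  move: (E_ge0 v) (E_ge0 r) (heatconv_time_le x gk v0 vr r1).
  move: (E v) (E r) (heatconv g u v x) (heatconv g u r x) => a b c d a0 b0.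
  by rewrite ler_norml => /andP[_ ?]; lra.
have t01 : 0 < t <= 1 by rewrite t0.
rewrite ler_norml; apply/andP; split.
  rewrite lerNl opprB lerBlDl; apply: ge_inf; last by exists t.
  by exists (heatconv g u t x - E t); exact: lb.
rewrite lerBlDr -lerBlDl; apply: lb_le_inf; last exact: lb.
by exists (heatconv g u t x + E t); exists t.
Qed.

Lemma heatlim_cvg g x : (size g <= k)%N ->
  heatconv g u j.+1%:R^-1 x @[j --> \oo] --> heatlim g x.
Proof.
move=> gk; apply/cvgrPdist_le => e e0; have [t /andP[t0 t1] Et] := E_small e0.
near=> j; have jt : j.+1%:R^-1 <= t.
  by near: j; have := near_infty_natSinv_lt (PosNum t0); apply: filterS => j /ltW.
have j0 : 0 < j.+1%:R^-1 :> R by rewrite invr_gt0 ltr0n.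
rewrite distrC; apply: le_trans (heatlim_dist x gk _) (le_trans _ Et).
  by rewrite j0 (le_trans jt t1).
rewrite /E ler_wpM2l ?mulr_ge0 ?invr_ge0 ?(ltW gam0)//.
by rewrite ge0_ler_powR ?nnegrE ?divr_ge0 ?(ltW gam0) ?(ltW j0) ?(ltW t0).
Unshelve. all: by end_near. Qed.

Lemma heatlim_bounded g x : (size g <= k)%N -> `|heatlim g x| <= (1 + 2 / gam) * K.
Proof.
move=> gk; have := heatlim_dist x gk (_ : 0 < 1 <= 1); rewrite /E powR1 mulr1 ltr01 lexx => /(_ isT) h.
have := heatconv1_le x gk; rewrite mulrDl mul1r => h1.
have := ler_normB (heatconv g u 1 x) (heatconv g u 1 x - heatlim g x).
by rewrite opprB addrC subrK => h2; apply: le_trans h2 _; exact: lerD.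
Qed.

Lemma heatconv_lipschitz g t : 0 < t -> exists L, forall x y,
  `|heatconv g u t x - heatconv g u t y| <= L * \sum_i `|x ord0 i - y ord0 i|.
Proof.
move=> t0.
have /choice[C CP] : forall i : 'I_n, exists C : R, 0 <= C /\ forall x, `|heatconv (i :: g) u t x| <= C.
  move=> i; have [C C0 CP] := @heatconv_le R n (i :: g).
  exists (C * M * t `^ (- ((size (i :: g))%:R / 2))); split=> [|x]; last exact: CP.
  by apply: le_trans (CP u M t 0 mu_ uM t0).
exists (\sum_i C i); apply: (partial_lipschitz (w' := fun i => heatconv (i :: g) u t)) => i x.
  exact: (is_derive_heatconv mu_ uM).
by apply: le_trans ((CP i).2 x) _; rewrite (bigD1 i)//= lerDl sumr_ge0// => j _; exact: (CP j).1.
Qed.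

Lemma heatlim_lipschitz g e : (size g <= k)%N -> 0 < e ->
  exists2 L, 0 <= L & forall x y,
  `|heatlim g x - heatlim g y| <= e + L * \sum_i `|x ord0 i - y ord0 i|.
Proof.
move=> gk e0.
have e20 : 0 < e / 2 by rewrite divr_gt0.
have [t /[dup] t01 /andP[t0 _] Et] := E_small e20.
have [L LP] := heatconv_lipschitz g t0; exists `|L| => // x y.
have S0 : 0 <= \sum_i `|x ord0 i - y ord0 i| by exact: sumr_ge0.
apply: le_trans (approx_dist (LP x y) (heatlim_dist y gk t01) (heatlim_dist x gk t01)) _.
apply: lerD; first by rewrite mulrC -ler_pdivlMr.
by rewrite ler_wpM2r// ler_norm.
Qed.

Lemma continuous_heatlim g : (size g <= k)%N -> continuous (heatlim g).
Proof.
move=> gk; apply: eps_lipschitz_continuous => e e0.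
by have [L _ LP] := heatlim_lipschitz gk e0; exists L.
Qed.

(** The approximation minus the linear function v D has derivative at most E(t) + e for |v| <= |h|,
    by closeness to the limit and near-continuity of [heatlim (i :: g)]. The mean value theorem
    bounds its increment, and t tends to 0 at fixed h. *)
Lemma is_derive_heatlim g x i : (size g < k)%N ->
  is_derive x (delta_mx ord0 i) (heatlim g) (heatlim (i :: g) x).
Proof.
move=> gk; apply: is_derive_line; apply: is_derive_dist => e e0; rewrite scale0r addr0.
pose dl : Rn := delta_mx ord0 i; pose D := heatlim (i :: g) x.
have gk' : (size g <= k)%N by exact: ltnW.
have e20 : 0 < e / 2 by rewrite divr_gt0.
have [L L0 LP] := heatlim_lipschitz (g := i :: g) gk e20.
(* This radius makes L |h| at most e/2, the other half being the slack in [heatlim_lipschitz]. *)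
exists (e / (2 * (L + 1))) => [|h hr]; first by rewrite divr_gt0// mulr_gt0// ltr_wpDl.
have near_x v : `|v| <= `|h| -> `|heatlim (i :: g) (x + v *: dl) - D| <= e.
  move=> vh; apply: le_trans (LP _ _) _.
  rewrite (bigD1 i)//= big1 ?addr0; last first.
    by move=> j ji; rewrite !mxE eqxx/= (negPf ji) mulr0 addr0 subrr normr0.
  rewrite !mxE !eqxx mulr1 addrAC subrr add0r.
  have := le_trans vh hr; rewrite ler_pdivlMr ?mulr_gt0 ?ltr_wpDl// => H.
  have := normr_ge0 v; nra.
apply/ler_addgt0Pr => e' e'0.
have h20 : 0 < 2 + `|h| by rewrite ltr_wpDr.
(* The error at time t is E(t) (2 + |h|): twice E(t) from the endpoints and |h| E(t) from the mean
   value bound. *)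
have [t /[dup] t01 /andP[t0 _] Et] := E_small (divr_gt0 e'0 h20).
pose f (v : R) := heatconv g u t (x + v *: dl) - v * D.
have := @is_derive_lipschitz0 R f (fun v => heatconv (i :: g) u t (x + v *: dl) - D) (E t + e) h.
have fd (v : R) : is_derive v 1 f (heatconv (i :: g) u t (x + v *: dl) - D).
  apply: is_deriveB; first by apply: is_derive_along; exact: (is_derive_heatconv mu_ uM).
  by have := is_derive_mulr D (is_derive_id v (1 : R)); rewrite mul1r.
move=> /(_ (fun v _ => fd v)) H; have {}H : `|f h - f 0| <= (E t + e) * `|h|.
  apply: H => v vh.
  have -> : forall b, b - D = (b - heatlim (i :: g) (x + v *: dl)) + (heatlim (i :: g) (x + v *: dl) - D).
    by move=> b; rewrite addrA subrK.
  by apply: le_trans (ler_normD _ _) _; apply: lerD; [exact: heatlim_dist|exact: near_x].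
have f0 : f 0 = heatconv g u t x by rewrite /f scale0r addr0 mul0r subr0.
rewrite f0 /f in H.
have B := approx_diff H (heatlim_dist (x + h *: dl) gk' t01) (heatlim_dist x gk' t01).
apply: le_trans B _.
move: Et; rewrite ler_pdivlMr//.
by move: (E t) `|h| => p q; lra.
Qed.

Lemma partials_heatlim g : (size g <= k)%N -> partials g (heatlim [::]) = heatlim g.
Proof.
elim: g => [//|i g IH] gk; rewrite /= -/(partials g _) IH ?(ltnW gk)// /partial.
by apply/funext => x; exact: (@derive_val _ _ _ _ _ _ _ (is_derive_heatlim x i gk)).
Qed.

Lemma continuously_derivable_heatlim : continuously_derivable k (heatlim [::]).
Proof.
split=> [g gk i x|g gk]; rewrite partials_heatlim ?(ltnW gk)//.
  exact: (@ex_derive _ _ _ _ _ _ _ (is_derive_heatlim x i gk)).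
exact: continuous_heatlim.
Qed.

Let E_sq x : x != 0 -> E (enorm x ^+ 2) = 2 / gam * K * enorm x `^ gam.
Proof.
move=> x0; rewrite /E -powR_mulrn ?enorm_ge0// -powRrM.
by congr (_ * _ `^ _); field.
Qed.

Let enorm_sq x : x != 0 -> enorm x <= 1 -> 0 < enorm x ^+ 2 <= 1.
Proof.
by move=> x0 x1; rewrite exprn_gt0 ?enorm_gt0//= expr_le1// enorm_ge0.
Qed.

Let ge1_powR x : 1 <= enorm x -> 1 <= enorm x `^ gam.
Proof.
move=> x1; have := @ge0_ler_powR R gam (ltW gam0) 1 (enorm x).
by rewrite powR1; apply => //; rewrite nnegrE// enorm_ge0.
Qed.

(** If |x - y| = r >= 1 the sup bound is enough, giving 2 (1 + 2/gam). Otherwise take t = r^2: the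
    two errors E(t) are (2/gam) K r^gam each, and the gradient bound K r^(gam-1) times the l^1
    distance, at most n r, gives the term n. *)
Lemma heatlim_holder g : size g = k ->
  (forall i t x, 0 < t <= 1 -> `|heatconv (i :: g) u t x| <= K * t `^ ((gam - 1) / 2)) ->
  forall x y, x != y ->
  `|heatlim g x - heatlim g y| <= ((2 * (1 + 2 / gam) + n%:R) * K) * enorm (x - y) `^ gam.
Proof.
move=> gk HK x y xy.
have xy0 : x - y != 0 by rewrite subr_eq0.
have gk' : (size g <= k)%N by rewrite gk.
have r0 := enorm_gt0 xy0.
have nK : 0 <= n%:R * K by rewrite mulr_ge0.
have [r1|/ltW r1] := leP (enorm (x - y)) 1; last first.
  apply: le_trans (ler_normB _ _) _.
  apply: le_trans (lerD (heatlim_bounded x gk') (heatlim_bounded y gk')) _.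
  apply: (@le_trans _ _ ((2 * (1 + 2 / gam) + n%:R) * K)).
    by move: (2 / gam) nK => c; lra.
  by rewrite ler_peMr ?ge1_powR// mulr_ge0// addr_ge0// mulr_ge0// addr_ge0// divr_ge0// ltW.
have t01 := enorm_sq xy0 r1; have t0 : 0 < enorm (x - y) ^+ 2 by case/andP: t01.
have lip : `|heatconv g u (enorm (x - y) ^+ 2) x - heatconv g u (enorm (x - y) ^+ 2) y| <=
    n%:R * K * enorm (x - y) `^ gam.
  have := @partial_lipschitz R n (heatconv g u (enorm (x - y) ^+ 2))
    (fun i => heatconv (i :: g) u (enorm (x - y) ^+ 2)) (K * enorm (x - y) `^ (gam - 1))
    (fun i x => is_derive_heatconv mu_ uM g x i t0) _ x y.
  move=> h; apply: le_trans (h _) _.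
    move=> i z; apply: le_trans (HK i _ z t01) _.
    by rewrite -powR_mulrn ?enorm_ge0// -powRrM (_ : 2 * _ = gam - 1)//; field.
  apply: (@le_trans _ _ (K * enorm (x - y) `^ (gam - 1) * (n%:R * enorm (x - y)))).
    rewrite ler_wpM2l ?mulr_ge0 ?powR_ge0//; have := sum_coord_le (x - y).
    by under eq_bigr do rewrite !mxE.
  have -> : enorm (x - y) `^ gam = enorm (x - y) `^ (gam - 1) * enorm (x - y).
    rewrite -[X in _ * X]powRr1 ?(ltW r0)// -powRD ?subrK//.
    by rewrite (gt_eqF r0) implybT.
  by rewrite le_eqVlt; apply/orP; left; apply/eqP; ring.
apply: le_trans (approx_dist lip (heatlim_dist y gk' t01) (heatlim_dist x gk' t01)) _.
rewrite E_sq// -[leRHS]mulrA.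
rewrite [leLHS](_ : _ = (2 * (2 / gam) + n%:R) * (K * enorm (x - y) `^ gam)); last by ring.
rewrite ler_wpM2r ?mulr_ge0 ?powR_ge0//.
by move: (2 / gam) => c; lra.
Qed.

(** For |h| >= 1 the sup bound 3 K is used four times, giving 12. For smaller h take t = |h|^2: the
    errors E(t) = 2 K |h| count four times, and the second difference of the approximation is an
    increment of z -> U(z+h) - U(z), so two uses of [partial_lipschitz] give n^2. *)
Lemma heatlim_zygmund g : gam = 1 -> size g = k ->
  (forall i j t x, 0 < t <= 1 -> `|heatconv [:: i, j & g] u t x| <= K * t `^ (- 2^-1)) ->
  forall x h, h != 0 ->
  `|heatlim g (x + h) + heatlim g (x - h) - 2 * heatlim g x| <= ((12 + n%:R ^+ 2) * K) * enorm h.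
Proof.
move=> gam1 gk HK x h h0.
have gk' : (size g <= k)%N by rewrite gk.
have r0 := enorm_gt0 h0.
have nK : 0 <= n%:R ^+ 2 * K by rewrite mulr_ge0.
have [r1|/ltW r1] := leP (enorm h) 1; last first.
  have b y : `|heatlim g y| <= 3 * K.
    by have := heatlim_bounded y gk'; rewrite gam1 divr1.
  apply: (@le_trans _ _ ((12 + n%:R ^+ 2) * K)).
    apply: le_trans (norm_diff2_le (b (x + h)) (b (x - h)) (b x)) _.
    by move: nK; move: (n%:R ^+ 2) => c nK; lra.
  by rewrite ler_peMr// mulr_ge0.
have t01 := enorm_sq h0 r1; have t0 : 0 < enorm h ^+ 2 by case/andP: t01.
pose U := heatconv g u (enorm h ^+ 2).
have lip i z : `|heatconv (i :: g) u (enorm h ^+ 2) (z + h) - heatconv (i :: g) u (enorm h ^+ 2)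
    z| <= n%:R * K.
  have := @partial_lipschitz R n (heatconv (i :: g) u (enorm h ^+ 2))
    (fun j => heatconv [:: j, i & g] u (enorm h ^+ 2)) (K * (enorm h)^-1)
    (fun j x => is_derive_heatconv mu_ uM (i :: g) x j t0) _ (z + h) z.
  move=> H; apply: le_trans (H _) _.
    move=> j y; apply: le_trans (HK j i _ y t01) _.
    by rewrite powRN -powR_mulrn ?enorm_ge0// -powRrM mulfV ?pnatr_eq0// powRr1 ?enorm_ge0.
  apply: (@le_trans _ _ (K * (enorm h)^-1 * (n%:R * enorm h))).
    rewrite ler_wpM2l ?mulr_ge0 ?invr_ge0 ?(ltW r0)//; have := sum_coord_le h.
    by under [X in _ -> X <= _]eq_bigr do rewrite mxE addrAC subrr add0r.
  by rewrite le_eqVlt; apply/orP; left; apply/eqP; field; rewrite gt_eqF.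
have second : `|U (x + h) + U (x - h) - 2 * U x| <= n%:R ^+ 2 * K * enorm h.
  have dW i z : is_derive z (delta_mx ord0 i) (fun z => U (z + h) - U z)
      (heatconv (i :: g) u (enorm h ^+ 2) (z + h) - heatconv (i :: g) u (enorm h ^+ 2) z).
    apply: is_deriveB; last exact: (is_derive_heatconv mu_ uM).
    exact: (is_derive_translate (is_derive_heatconv mu_ uM g (z + h) i t0)).
  have H := partial_lipschitz dW lip x (x - h); rewrite subrK in H.
  apply: diff2_le; apply: le_trans H _.
  rewrite expr2 [leRHS](_ : _ = n%:R * K * (n%:R * enorm h)); last by ring.
  rewrite ler_wpM2l ?mulr_ge0//; have := sum_coord_le h.
  by under [X in _ -> X <= _]eq_bigr do rewrite !mxE subKr.
apply: le_trans (approx_diff2 second (heatlim_dist (x + h) gk' t01) (heatlim_dist (x - h) gk'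
    t01) (heatlim_dist x gk' t01)) _.
rewrite E_sq// gam1 divr1 powRr1 ?enorm_ge0//.
rewrite -[leRHS]mulrA [leLHS](_ : _ = (8 + n%:R ^+ 2) * (K * enorm h)); last by ring.
by rewrite ler_wpM2r ?mulr_ge0 ?enorm_ge0// lerD2r ler_nat.
Qed.

End heat_limit.

(** * Estimates with constants uniform in the solution *)

Section frac_solution.
Context (R : realType) (n : nat).
Notation Rn := 'rV[R]_n.
Implicit Types (x y z : Rn) (t s al M N : R) (g : seq 'I_n) (u f : Rn -> R).

(** The factor 2 in [sol_fH] lets one record serve both kinds of data: f with Hoelder norm N, or,
    for [al = 0], f bounded by N, whose oscillation is at most 2 N. *)
Record frac_solution s al u f M N : Prop := {
  sol_eq : heat_solution s u f;
  sol_mu : measurable_fun setT u;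
  sol_mf : measurable_fun setT f;
  sol_uM : forall x, `|u x| <= M;
  sol_fN : forall x, `|f x| <= N;
  sol_fH : forall x y, `|f x - f y| <= 2 * N * enorm (x - y) `^ al }.

Lemma sol_M_ge0 s al u f M N : frac_solution s al u f M N -> 0 <= M.
Proof. by move=> h; exact: le_trans (sol_uM h 0). Qed.

Lemma sol_N_ge0 s al u f M N : frac_solution s al u f M N -> 0 <= N.
Proof. by move=> h; exact: le_trans (sol_fN h 0). Qed.

(** There are finitely many words of length at most m. The induction sums the constants over the
    first letter, and monotonicity allows enlarging them. *)
Lemma words_bound m (P : seq 'I_n -> R -> Prop) :
  (forall g C C', C <= C' -> P g C -> P g C') ->
  (forall g, (size g <= m)%N -> exists2 C, 0 <= C & P g C) ->
  exists2 C, 0 <= C & forall g, (size g <= m)%N -> P g C.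
Proof.
elim: m P => [|m IH] P Pmono Pex.
  have [C C0 PC] := Pex [::] (leqnn _); exists C => // g.
  by rewrite leqn0 size_eq0 => /eqP ->.
have [C0 C00 PC0] := Pex [::] (leq0n _).
have /choice[C CP] : forall i, exists C, 0 <= C /\ forall g, (size g <= m)%N -> P (i :: g) C.
  move=> i; have [g C1 C2|g gm|C D DP] := IH (fun g => P (i :: g)); last by exists C.
    exact: Pmono.
  exact: Pex.
have sC : 0 <= \sum_i C i by apply: sumr_ge0 => i _; exact: (CP i).1.
exists (C0 + \sum_i C i) => [|[|i g] gm]; first by rewrite addr_ge0.
  by apply: Pmono PC0; rewrite lerDl.
apply: Pmono ((CP i).2 g gm); rewrite (bigD1 i)//= addrCA lerDl addr_ge0// sumr_ge0// => j _.
exact: (CP j).1.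
Qed.

Lemma frac_solution1_le s al g : exists2 C, 0 <= C & forall u f M N x,
  frac_solution s al u f M N -> `|heatconv g u 1 x| <= C * (M + N).
Proof.
have [C C0 CP] := @heatconv_le R n g; exists C => // u f M N x h.
apply: le_trans (CP u M 1 x (sol_mu h) (sol_uM h) ltr01) _.
by rewrite powR1 mulr1 ler_wpM2l// lerDl; exact: sol_N_ge0 h.
Qed.

Lemma frac_solution_decay s al g : 0 < s < 1 -> 0 <= al <= 1 -> al + 2 * s < (size g)%:R ->
  exists2 C, 0 <= C & forall u f M N t x, frac_solution s al u f M N -> 0 < t ->
  `|heatconv g u t x| <= C * (M + N) * t `^ ((al + 2 * s - (size g)%:R) / 2).
Proof.
move=> s01 al01 ag; have [C C0 CP] := heatconv_decay s01 al01 ag.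
exists (2 * C) => [|u f M N t x h t0]; first by rewrite mulr_ge0.
apply: le_trans (CP u f M N (2 * N) t x (sol_eq h) (sol_mu h) (sol_uM h) (sol_mf h) (sol_fN h)
    (sol_fH h) t0) _.
rewrite ler_wpM2r ?powR_ge0// mulrCA -mulrA ler_wpM2l// ler_wpM2l// lerDr.
exact: sol_M_ge0 h.
Qed.

Lemma frac_solution_al0 s al u f M N :
  frac_solution s al u f M N -> frac_solution s 0 u f M N.
Proof.
case=> e mu mf uM fN _; split=> // x y; rewrite powRr0 mulr1.
by apply: le_trans (ler_normB _ _) _; rewrite mulr_natl mulr2n; exact: lerD.
Qed.

(** For t <= 1 the decay of D^[i,i,g] u_t suffices because |g| <= k. It is available unless |g| + 2
    <= al + 2s < 3, that is, g is empty and k >= 1. Then [al] is replaced by 0 and the exponent s -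
    1 is still at least gam/2 - 1, since al <= 1 gives 2s >= gam. *)
Lemma lapconv_decay s al (k : nat) gam g : 0 < s < 1 -> 0 <= al <= 1 ->
  al + 2 * s = k%:R + gam -> 0 < gam <= 1 -> (size g <= k)%N ->
  exists2 C, 0 <= C & forall u f M N t x, frac_solution s al u f M N -> 0 < t <= 1 ->
  `|lapconv g u t x| <= C * (M + N) * t `^ (gam / 2 - 1).
Proof.
move=> s01 al01 asE gam01 gk; case/andP: (s01) => s0 s1; case/andP: (al01) => al0 al1.
case/andP: (gam01) => gam0 gam1.
suff /choice[C CP] : forall i, exists C, 0 <= C /\ forall u f M N t x,
    frac_solution s al u f M N -> 0 < t <= 1 ->
    `|heatconv [:: i, i & g] u t x| <= C * (M + N) * t `^ (gam / 2 - 1).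
  exists (\sum_i C i) => [|u f M N t x h t01]; first by apply: sumr_ge0 => i _; exact: (CP i).1.
  apply: le_trans (ler_norm_sum _ _ _) _; rewrite -mulrA mulr_suml.
  by apply: ler_sum => i _; rewrite mulrA; exact: (CP i).2 h t01.
move=> i; have [big|small] := ltP (al + 2 * s) (size [:: i, i & g])%:R.
  have [C C0 CP] := frac_solution_decay s01 al01 big.
  exists C; split=> // u f M N t x h /andP[t0 t1].
  apply: le_trans (CP u f M N t x h t0) _.
  rewrite ler_wpM2l//; first by rewrite mulr_ge0// addr_ge0//; [exact: sol_M_ge0 h|exact: sol_N_ge0 h].
  apply: ger_powR; first by rewrite t0.
  rewrite asE /= -(addn2 (size g)) natrD; have : (size g)%:R <= k%:R :> R by rewrite ler_nat.
  lra.
have g0 : size g = 0.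
  have : (size [:: i, i & g])%:R < 3 :> R by lra.
  by rewrite ltr_nat /=; case: (size g).
have k1 : (1 <= k)%N.
  have : 1 <= k%:R :> R by rewrite /= g0 in small; lra.
  by rewrite ler1n.
have k1R : 1 <= k%:R :> R by rewrite ler1n.
have al00 : 0 <= (0 : R) <= 1 by rewrite lexx ler01.
have big : 0 + 2 * s < (size [:: i, i & g])%:R by rewrite /= g0; lra.
have [C C0 CP] := frac_solution_decay s01 al00 big.
exists C; split=> // u f M N t x h /andP[t0 t1].
apply: le_trans (CP u f M N t x (frac_solution_al0 h) t0) _.
rewrite ler_wpM2l//; first by rewrite mulr_ge0// addr_ge0//; [exact: sol_M_ge0 h|exact: sol_N_ge0 h].
by apply: ger_powR; [rewrite t0|rewrite /= g0; lra].
Qed.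

Lemma frac_regularity s al (k : nat) gam : 0 < s < 1 -> 0 <= al <= 1 ->
  al + 2 * s = k%:R + gam -> 0 < gam <= 1 ->
  exists2 C, 0 < C & forall u f M N, frac_solution s al u f M N ->
  exists v : Rn -> R,
  [/\ continuously_derivable k v,
      forall g x, (size g <= k)%N -> `|partials g v x| <= C * (M + N),
      gam < 1 -> forall g x y, size g = k -> x != y ->
        `|partials g v x - partials g v y| <= C * (M + N) * enorm (x - y) `^ gam,
      gam = 1 -> forall g x h, size g = k -> h != 0 ->
        `|partials g v (x + h) + partials g v (x - h) - 2 * partials g v x| <=
        C * (M + N) * enorm h &
      forall x, heatconv [::] u (j.+1%:R^-1) x @[j --> \oo] --> v x].
Proof.
move=> s01 al01 asE gam01; case/andP: (gam01) => gam0 gam1.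
have MN0 u f M N : frac_solution s al u f M N -> 0 <= M + N.
  by move=> h; rewrite addr_ge0//; [exact: sol_M_ge0 h|exact: sol_N_ge0 h].
have [|g _|C1 C10 CP1] := @words_bound k (fun g C => forall u f M N x,
    frac_solution s al u f M N -> `|heatconv g u 1 x| <= C * (M + N)).
- move=> g C C' CC' CP u f M N x h; apply: le_trans (CP u f M N x h) _.
  by rewrite ler_wpM2r//; exact: MN0 h.
- exact: frac_solution1_le.
have [|g gk|C2 C20 CP2] := @words_bound k (fun g C => forall u f M N t x,
    frac_solution s al u f M N -> 0 < t <= 1 ->
    `|lapconv g u t x| <= C * (M + N) * t `^ (gam / 2 - 1)).
- move=> g C C' CC' CP u f M N t x h t01; apply: le_trans (CP u f M N t x h t01) _.
  by rewrite ler_wpM2r ?powR_ge0// ler_wpM2r//; exact: MN0 h.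
- exact: lapconv_decay gk.
(* Words of length k+1 enter the Hoelder estimate, words of length k+2 the Zygmund estimate. *)
have [|g _|C3 C30 CP3] := @words_bound k.+2 (fun g C => al + 2 * s < (size g)%:R ->
    forall u f M N t x, frac_solution s al u f M N -> 0 < t <= 1 ->
    `|heatconv g u t x| <= C * (M + N) * t `^ ((al + 2 * s - (size g)%:R) / 2)).
- move=> g C C' CC' CP ag u f M N t x h t01; apply: le_trans (CP ag u f M N t x h t01) _.
  by rewrite ler_wpM2r ?powR_ge0// ler_wpM2r//; exact: MN0 h.
- have [ag|ag] := ltP (al + 2 * s) (size g)%:R; last by exists 0.
  have [C C0 CP] := frac_solution_decay s01 al01 ag.
  by exists C => // _ u f M N t x h /andP[t0 _]; exact: CP h t0.
pose B := C1 + C2 + C3.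
have B0 : 0 <= B by rewrite !addr_ge0.
(* The sum of the constants of [heatlim_holder], [heatlim_bounded] and [heatlim_zygmund], so that it
   dominates each. *)
pose c := (2 * (1 + 2 / gam) + n%:R) + (1 + 2 / gam) + (12 + n%:R ^+ 2).
have g20 : 0 <= 2 / gam by rewrite divr_ge0// ltW.
have [c1 c2 c3] : [/\ 2 * (1 + 2 / gam) + n%:R <= c, 1 + 2 / gam <= c & 12 + n%:R ^+ 2 <= c].
  rewrite /c; move: (2 / gam) g20 (ler0n R n) (sqr_ge0 (n%:R : R)) => p p0.
  move: (n%:R ^+ 2 : R) (n%:R : R) => q r r0 q0.
  by split; lra.
exists (c * B + 1) => [|u f M N h]; first by rewrite ltr_wpDl// mulr_ge0// (le_trans _ c2)// addr_ge0.
have mn := MN0 _ _ _ _ h; pose K := B * (M + N).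
have K0 : 0 <= K by rewrite mulr_ge0.
have leK a : a <= c -> a * K <= (c * B + 1) * (M + N).
  move=> ac; apply: (@le_trans _ _ (c * K)); first by rewrite ler_wpM2r.
  by rewrite /K mulrA ler_wpM2r// lerDl.
have H1 g x : (size g <= k)%N -> `|heatconv g u 1 x| <= K.
  by move=> gk; apply: le_trans (CP1 g gk _ _ _ _ x h) _; rewrite ler_wpM2r// /B -addrA lerDl addr_ge0.
have H2 g t x : (size g <= k)%N -> 0 < t <= 1 -> `|lapconv g u t x| <= K * t `^ (gam / 2 - 1).
  move=> gk t01; apply: le_trans (CP2 g gk _ _ _ _ t x h t01) _.
  by rewrite ler_wpM2r ?powR_ge0// ler_wpM2r// /B addrAC lerDr addr_ge0.
have H3 g t x : (size g <= k.+2)%N -> al + 2 * s < (size g)%:R -> 0 < t <= 1 ->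
    `|heatconv g u t x| <= K * t `^ ((al + 2 * s - (size g)%:R) / 2).
  move=> gk ag t01; apply: le_trans (CP3 g gk ag _ _ _ _ t x h t01) _.
  by rewrite ler_wpM2r ?powR_ge0// ler_wpM2r// /B lerDr addr_ge0.
have um := sol_mu h; have uM := sol_uM h.
have pE := partials_heatlim um uM gam01 K0 H2.
exists (heatlim u gam K [::]); split.
- exact: (continuously_derivable_heatlim um uM gam01 K0 H2).
- move=> g x gk; rewrite pE//; apply: le_trans (leK _ c2).
  exact: (heatlim_bounded um uM gam01 K0 H1 H2).
- move=> gl1 g x y gk xy; rewrite pE ?gk//.
  apply: le_trans (heatlim_holder um uM gam01 K0 H1 H2 gk _ xy) _.
    move=> i t z t01; apply: le_trans (H3 (i :: g) t z _ _ t01) _.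
    + by rewrite /= gk.
    + by rewrite asE /= gk -(addn1 k) natrD ltrD2l.
    + by rewrite asE /= gk -(addn1 k) natrD (_ : _ + _ - _ = gam - 1)//; ring.
  by rewrite ler_wpM2r ?powR_ge0// leK.
- move=> gam1E g x y gk y0; rewrite pE ?gk//.
  apply: le_trans (heatlim_zygmund um uM gam01 K0 H1 H2 gam1E gk _ _ y0) _.
    move=> i j t z t01; apply: le_trans (H3 [:: i, j & g] t z _ _ t01) _.
    + by rewrite /= gk.
    + by rewrite asE /= gk gam1E -(addn2 k) natrD ltrD2l ltr1n.
    + by rewrite asE /= gk gam1E -(addn2 k) natrD (_ : (_ + _ - _) / 2 = - 2^-1)//; field.
  by rewrite ler_wpM2r ?enorm_ge0// leK.
- by move=> x; exact: (heatlim_cvg um uM gam01 K0 H2).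
Qed.

End frac_solution.

(** * Convergence to the initial value *)

Section measurability.
Context (R : realType) (n : nat).

Lemma measurable_rV_box (A : 'I_n -> set R) :
  (forall i, measurable (A i : set (measurableTypeR R))) ->
  measurable [set x : 'rV[R]_n | forall i, A i (x ord0 i)].
Proof.
move=> mA; rewrite (_ : [set x | _] = \bigcap_(i in [set: 'I_n])
    ((fun x : 'rV[R]_n => x ord0 i) @^-1` A i)); last first.
  by apply/seteqP; split => [x Bx i _|x Bx i]; exact: Bx.
apply: fin_bigcap_measurable => // i _; rewrite -[X in measurable X]setTI.
exact: (@measurable_rV_coord R n i).
Qed.

(** An open set is the union of the boxes with rational centre and half-width 1/(m+1) that it
    contains, a countable family. *)
Lemma open_measurable_rV (O : set 'rV[R]_n) : open O -> measurable O.
Proof.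
move=> oO.
pose box (p : {ffun 'I_n -> rat} * nat) : set 'rV[R]_n :=
  [set x | forall i, `]ratr (p.1 i) - p.2.+1%:R^-1, ratr (p.1 i) + p.2.+1%:R^-1[%classic (x ord0 i)].
pose F p := if `[< box p `<=` O >] then box p else set0.
have mF p : measurable (F p).
  rewrite /F; case: ifP => // _; apply: (@measurable_rV_box (fun i => `]ratr (p.1 i) -
      p.2.+1%:R^-1, ratr (p.1 i) + p.2.+1%:R^-1[%classic)) => i.
  exact: measurable_itv.
suff -> : O = \bigcup_p F p by apply: countable_bigcupT_measurable => //; exact: countableP.
apply/seteqP; split=> [x Ox|x [p _]]; last first.
  by rewrite /F; case: asboolP => // pO; exact: pO.
have /nbhs_ballP[e e0 eO] : nbhs x O by exact: open_nbhs_nbhs.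
have [m me] : exists m : nat, m.+1%:R^-1 < e / 2.
  have e20 : 0 < e / 2 by rewrite divr_gt0.
  by have [N _ NP] := near_infty_natSinv_lt (PosNum e20); exists N; apply: NP => /=.
have m0 : 0 < m.+1%:R^-1 :> R by rewrite invr_gt0 ltr0n.
have /choice[q qx] : forall i, exists q : rat, ratr q \in `]x ord0 i - m.+1%:R^-1, x ord0 i + m.+1%:R^-1[.
  by move=> i; apply: rat_in_itvoo; rewrite ltrBlDr -addrA ltrDl addr_gt0.
exists ([ffun i => q i], m) => //; rewrite /F; case: asboolP => [_ i|] /=.
  by have := qx i; rewrite !in_itv/= ffunE => /andP[q1 q2]; rewrite ltrBlDr q2 -ltrBlDr q1.
case=> y yb; apply: eO; split => // i j.
rewrite (ord1 i); have := qx j; have := yb j; rewrite /= !in_itv/= ffunE.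
move: me; move: (m.+1%:R^-1 : R) (ratr (q j) : R) => c r ce /andP[? ?] /andP[? ?].
rewrite /ball/= ltr_norml; apply/andP; split; lra.
Qed.

Lemma continuous_measurable_rV (w : 'rV[R]_n -> R) : continuous w -> measurable_fun setT w.
Proof.
move=> cw; apply: (measurability _ (RGenOInfty.measurableE R)) => //.
move=> _ [_ [a ->] <-]; rewrite setTI; apply: open_measurable_rV.
by apply: open_comp => // x _; exact: cw.
Qed.

(** Endpoints are extended reals so that conditions on a single coordinate, and the whole space,
    belong to the family; it is closed under intersection, as Dynkin's theorem requires. *)
Lemma measurable_rVE : @measurable _ 'rV[R]_n =
  <<s [set [set x : 'rV[R]_n | forall i, ((x ord0 i)%:E < a i)%E] | a in [set: 'I_n -> \bar R]] >>.
Proof.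
have mray (a : \bar R) : measurable ([set y : R | (y%:E < a)%E] : set (measurableTypeR R)).
  case: a => [r||].
  - rewrite (_ : [set y | _] = `]-oo, r[%classic); first exact: measurable_itv.
    by apply/seteqP; split => y; rewrite /= in_itv/= lte_fin.
  - rewrite (_ : [set y | _] = setT)//; apply/seteqP; split => // y _ /=; exact: ltry.
  - by rewrite (_ : [set y | _] = set0)//; apply/seteqP; split.
apply/seteqP; split; last first.
  apply: smallest_sub; first exact: sigma_algebra_measurable.
  by move=> _ [a _ <-]; apply: (@measurable_rV_box (fun i => [set y : R | (y%:E < a i)%E])) => i.
apply: smallest_sub; first exact: smallest_sigma_algebra.
rewrite -bigcup_seq; apply: bigcup_sub => i _ _ [B mB <-].
move: mB; set G := (X in <<s X>>).
suff : (measurable : set (set (measurableTypeR R))) `<=`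
    image_set_system setT (fun x : 'rV[R]_n => x ord0 i) <<s G >> by apply.
rewrite RGenInftyO.measurableE; apply: smallest_sub.
  by apply: sigma_algebra_image; exact: smallest_sigma_algebra.
move=> _ [r ->]; apply: sub_sigma_algebra.
exists (fun j => if j == i then r%:E else +oo%E) => //.
apply/seteqP; split=> x /= => [/(_ i)|[_]].
  by rewrite eqxx lte_fin in_itv.
by rewrite in_itv/= => xr j; case: eqP => [->|_]; rewrite ?lte_fin// ltry.
Qed.

End measurability.

(** * Weighted indicators of rays and their heat regularisation *)

Section mollified_rays.
Context (R : realType).
Notation mu := (@lebesgue_measure R).
Implicit Types (t x y z : R) (a : \bar R).

(** A product of these is the indicator of an orthant times [cauchyn 1], an integrable test function
    even when the orthant is the whole space. *)
Definition cauchy_ray a x : R := (x%:E < a)%E%:R * cauchy_ker 1 x.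

Lemma cauchy_ray_ge0 a x : 0 <= cauchy_ray a x.
Proof. by rewrite mulr_ge0// cauchy_ge0. Qed.

Lemma cauchy_ray_le a x : cauchy_ray a x <= cauchy_ker 1 x.
Proof. by rewrite /cauchy_ray; case: (_ < _)%E; rewrite ?mul1r// mul0r cauchy_ge0. Qed.

Lemma measurable_cauchy_ray a : measurable_fun setT (cauchy_ray a).
Proof.
apply: measurable_funM; last exact: continuous_measurable_fun (continuous_cauchy ltr01).
apply: (@measurableT_comp _ _ _ _ _ _ (fun b : bool => b%:R : R) _ (fun x : R => (x%:E < a)%E)) => //.
apply: (measurable_fun_bool true); rewrite setTI.
case: a => [r||].
- rewrite (_ : _ @^-1` _ = `]-oo, r[%classic); first exact: measurable_itv.
  by apply/seteqP; split => y; rewrite /= in_itv/= lte_fin.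
- rewrite (_ : _ @^-1` _ = setT)//; apply/seteqP; split => // y _ /=; exact: ltry.
- by rewrite (_ : _ @^-1` _ = set0)//; apply/seteqP; split.
Qed.

Lemma cauchy_ray_cvg a (x : nat -> R) y : y%:E != a -> x j @[j --> \oo] --> y ->
  cauchy_ray a (x j) @[j --> \oo] --> cauchy_ray a y.
Proof.
move=> ya xy; apply: cvgM; last first.
  by apply: continuous_cvg xy; exact: continuous_cauchy.
apply: (@cvg_near_cst _ _ _ _ \oo).
case: a ya => [r||] ya.
- have : y != r by apply: contra ya => /eqP ->.
  rewrite neq_lt => /orP[yr|ry].
    near=> j; have xr : x j < r by near: j; exact: (cvgr_lt y xy).
    by rewrite !lte_fin xr yr.
  near=> j; have xr : r < x j by near: j; exact: (cvgr_gt y xy).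
  by rewrite !lte_fin !ltNge !ltW.
- by near=> j; rewrite !ltry.
- by near=> j; rewrite !ltNge !leNye.
Unshelve. all: by end_near. Qed.

(** Peetre's inequality: the shift is paid for by a polynomial factor, which the Gaussian absorbs in
    [heat1_moment]. *)
Lemma cauchy_peetre y h : cauchy_ker 1 (y + h) <= 2 * (1 + h ^+ 2) * cauchy_ker 1 y.
Proof.
rewrite /cauchy_ker !expr1n !mul1r ler_pdivlMr; last by rewrite ltr_pwDl ?sqr_ge0.
rewrite mulrC ler_pdivrMr; last by rewrite ltr_pwDl ?sqr_ge0.
have := sqr_ge0 h; have := sqr_ge0 (y + h); have := sqr_ge0 (y + 2 * h).
have := mulr_ge0 (sqr_ge0 h) (sqr_ge0 (y + h)).
nra.
Qed.

Lemma heat1_0_ge0 t x : 0 <= heat1 0 t x.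
Proof.
by rewrite /heat1 /gauss hornerC mul1r !mulr_ge0 ?expR_ge0 ?exprn_ge0 ?invr_ge0 ?sqrtr_ge0.
Qed.

Lemma heat1_moment : exists2 C : R, 0 <= C &
  forall z, (1 + z ^+ 2) * heat1 0 1 z <= C * cauchy_ker 1 z.
Proof.
have [C CP] := gauss_bounded R 0 4.
have C0 : 0 <= C by apply: le_trans (CP 0); rewrite mulr_ge0// exprn_ge0// normr0 addr0.
exists ((Num.sqrt (4 * pi))^-1 * C) => [|z]; first by rewrite mulr_ge0// invr_ge0 sqrtr_ge0.
rewrite /heat1 sqrtr1 !divr1 mulrCA -mulrA ler_wpM2l ?invr_ge0 ?sqrtr_ge0//.
have z0 : 0 < 1 + z ^+ 2 by rewrite ltr_pwDl ?sqr_ge0.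
rewrite /cauchy_ker expr1n mul1r ler_pdivlMr//; apply: le_trans (CP z).
have z1 : 1 + z ^+ 2 <= (1 + `|z|) ^+ 2.
  by rewrite -(real_normK (num_real z)); have := normr_ge0 z; nra.
rewrite mulrC mulrA mulrC; apply: ler_pM => //.
- by rewrite /gauss hornerC mul1r expR_ge0.
- by rewrite mulr_ge0// ltW.
- exact: ler_norm.
- by rewrite -expr2 (_ : 4 = 2 * 2)%N// exprM; apply: lerXn2r; rewrite ?nnegrE ?(ltW z0)//
    exprn_ge0// addr_ge0.
Qed.

Definition mollified_ray a t y : R := \int[mu]_x (heat1 0 t (x - y) * cauchy_ray a x).

Lemma Rintegral_cauchy1 : \int[mu]_z cauchy_ker (1 : R) z = pi.
Proof.
rewrite -(@Rintegral_cauchy R 1 0 ltr01); apply: eq_Rintegral => z _.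
by rewrite sub0r cauchyN.
Qed.

Lemma measurable_heat1_shift t y : measurable_fun setT (fun x : R => heat1 0 t (x - y)).
Proof. by apply: measurable_heat1 => //; exact: measurable_funB. Qed.

Lemma rintegrable_heat1_ray a t y : 0 < t ->
  rintegrable mu (fun x => heat1 0 t (x - y) * cauchy_ray a x).
Proof.
move=> t0; have [ih _] := integrable_heat1_0 y t0.
apply: (le_rintegrable _ ih) => [|x].
  by apply: measurable_funM; [exact: measurable_heat1_shift|exact: measurable_cauchy_ray].
have p0 : 0 <= heat1 0 t (y - x) * cauchy_ray a x.
  by apply: mulr_ge0; [exact: heat1_0_ge0|exact: cauchy_ray_ge0].
rewrite -(opprB y x) heat1N0 (ger0_norm p0).
have h0 := heat1_0_ge0 t (y - x); rewrite ler_piMr//.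
apply: le_trans (cauchy_ray_le a x) _.
by rewrite /cauchy_ker expr1n ler_pdivrMr ?mul1r ?lerDl ?sqr_ge0// ltr_pwDl ?sqr_ge0.
Qed.

(** Substituting x = sqrt t z + y moves t from the kernel into the test function, so that dominated
    convergence as t -> 0 has a fixed kernel. *)
Lemma mollified_rayE a t y : 0 < t ->
  mollified_ray a t y = \int[mu]_z (heat1 0 1 z * cauchy_ray a (Num.sqrt t * z + y)).
Proof.
move=> t0; have s0 : 0 < Num.sqrt t by rewrite sqrtr_gt0.
have ia := rintegrable_heat1_ray a y t0.
have E := Rintegral_affine y s0 ia; rewrite -/(mollified_ray a t y) in E.
have -> : mollified_ray a t y = Num.sqrt t * ((Num.sqrt t)^-1 * mollified_ray a t y).
  by rewrite mulVKf ?gt_eqF.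
rewrite -E -(RintegralZl _ measurableT (rintegrable_affine y s0 ia)).
apply: eq_Rintegral => z _; rewrite mulrA addrK; congr (_ * _).
rewrite /heat1 sqrtr1 !divr1 [Num.sqrt t * z]mulrC mulfK ?gt_eqF//.
by field; rewrite !gt_eqF// sqrtr_gt0 mulr_gt0// pi_gt0.
Qed.

Let peetre_bound a t y z C : 0 < t -> t <= 1 ->
  (forall z, (1 + z ^+ 2) * heat1 0 1 z <= C * cauchy_ker 1 z) ->
  `|heat1 0 1 z * cauchy_ray a (Num.sqrt t * z + y)| <= 2 * C * cauchy_ker 1 y * cauchy_ker 1 z.
Proof.
move=> t0 t1 CP.
rewrite ger0_norm; last by rewrite mulr_ge0 ?heat1_0_ge0 ?cauchy_ray_ge0.
apply: (@le_trans _ _ (heat1 0 1 z * (2 * (1 + z ^+ 2) * cauchy_ker 1 y))).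
  rewrite ler_wpM2l ?heat1_0_ge0//; apply: le_trans (cauchy_ray_le _ _) _.
  rewrite addrC; apply: le_trans (cauchy_peetre _ _) _.
  rewrite ler_wpM2r ?cauchy_ge0// ler_wpM2l// lerD2l exprMn sqr_sqrtr ?(ltW t0)//.
  by rewrite ler_piMl ?sqr_ge0.
rewrite [leLHS](_ : _ = 2 * cauchy_ker 1 y * ((1 + z ^+ 2) * heat1 0 1 z)); last by ring.
rewrite [leRHS](_ : _ = 2 * cauchy_ker 1 y * (C * cauchy_ker 1 z)); last by ring.
by apply: ler_wpM2l; [rewrite mulr_ge0 ?cauchy_ge0|exact: CP].
Qed.

Let measurable_scaled_ray a t y :
  measurable_fun [set: measurableTypeR R] (fun z : R => heat1 0 1 z * cauchy_ray a (Num.sqrt t * z + y)).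
Proof.
apply: measurable_funM; first exact: measurable_heat1.
apply: (measurableT_comp (measurable_cauchy_ray a)).
by apply: measurable_funD => //; exact: measurable_funM.
Qed.

Lemma mollified_ray_ge0 a t y : 0 <= mollified_ray a t y.
Proof. by apply: Rintegral_ge0 => x _; rewrite mulr_ge0 ?heat1_0_ge0 ?cauchy_ray_ge0. Qed.

Lemma mollified_ray_le : exists2 C : R, 0 <= C & forall a t y, 0 < t -> t <= 1 ->
  mollified_ray a t y <= C * cauchy_ker 1 y.
Proof.
have [C C0 CP] := heat1_moment; have ic := rintegrable_cauchy1 R.
exists (2 * C * pi) => [|a t y t0 t1]; first by rewrite !mulr_ge0// pi_ge0.
apply: le_trans (ler_norm _) _; rewrite mollified_rayE//.
have ic' := rintegrableZl (2 * C * cauchy_ker 1 y) ic.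
have := le_norm_Rintegral (measurable_scaled_ray a t y) ic' (fun z => peetre_bound a y z t0 t1 CP).
by rewrite (RintegralZl _ measurableT ic) Rintegral_cauchy1 mulrAC.
Qed.

Lemma mollified_ray_cvg a y : y%:E != a ->
  mollified_ray a j.+1%:R^-1 y @[j --> \oo] --> cauchy_ray a y.
Proof.
move=> ya; have j0 j : 0 < j.+1%:R^-1 :> R by rewrite invr_gt0 ltr0n.
have j1 j : j.+1%:R^-1 <= 1 :> R by rewrite invf_le1 ?ler1n ?ltr0n.
have [C C0 CP] := heat1_moment; have ic := rintegrable_cauchy1 R.
have [ih hE] := integrable_heat1_0 0 (@ltr01 R).
have ih' : rintegrable mu (fun z : R => heat1 0 1 z) /\ \int[mu]_z heat1 0 1 z = 1 :> R.
  have E : heat1 0 1 = fun z : R => heat1 0 1 (0 - z).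
    by apply/funext => z; rewrite sub0r heat1N0.
  by split; rewrite E.
have -> : cauchy_ray a y = \int[mu]_z (heat1 0 1 z * cauchy_ray a y).
  under eq_Rintegral do rewrite mulrC.
  by rewrite (RintegralZl _ measurableT ih'.1) ih'.2 mulr1.
under eq_fun do rewrite mollified_rayE//.
apply: (@cvg_Rintegral R _ _ mu (fun j z => heat1 0 1 z * cauchy_ray a (Num.sqrt j.+1%:R^-1 * z + y))
  (fun z => heat1 0 1 z * cauchy_ray a y) (fun z => 2 * C * cauchy_ker 1 y * cauchy_ker 1 z)).
- by move=> j; exact: measurable_scaled_ray.
- by apply: measurable_funM => //; exact: measurable_heat1.
- apply: aeW => z; apply: cvgM; first exact: cvg_cst.
  apply: cauchy_ray_cvg => //; rewrite -[X in _ --> X]add0r.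
  apply: cvgD; last exact: cvg_cst.
  rewrite -[X in _ --> X](mul0r z); apply: cvgM; last exact: cvg_cst.
  rewrite -(sqrtr0 R); apply: continuous_cvg; first exact: sqrt_continuous.
  exact: cvg_harmonic.
- exact: rintegrableZl.
- by move=> j z; exact: peetre_bound.
Qed.

End mollified_rays.

Section heat_initial_value.
Context (R : realType) (n : nat).
Notation mu := (@lebesgue_measure R).
Notation lam := (@lebesgue_rV R n).
Notation Rn := 'rV[R]_n.
Implicit Types (x y z : Rn) (t : R) (a : 'I_n -> \bar R).

Lemma lebesgue_rV_hyperplane (i : 'I_n) (c : R) :
  lam [set x : Rn | x ord0 i = c] = 0%E /\ measurable [set x : Rn | x ord0 i = c].
Proof.
pose A j : set R := if j == i then [set c] else setT.
have mA j : measurable (A j : set (measurableTypeR R)).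
  by rewrite /A; case: ifP => // _; exact: measurable_set1.
have E : [set x : Rn | x ord0 i = c] = [set x : Rn | forall j, A j (x ord0 j)].
  apply/seteqP; split=> x /= => [xc j|/(_ i)]; last by rewrite /A eqxx.
  by rewrite /A; case: eqP => [->|].
rewrite E; split; last exact: measurable_rV_box.
(* The hyperplane is a box with one side a point, and 0 times the infinite lengths of the other
   sides is 0. *)
rewrite (lebesgue_rV_box mA) (bigD1 i)//= {1}/A eqxx lebesgue_measure_set1 mul0e//.
Qed.

Lemma cvg_prod (I : Type) (r : seq I) (f : I -> nat -> R) (l : I -> R) :
  (forall i, f i j @[j --> \oo] --> l i) ->
  \prod_(i <- r) f i j @[j --> \oo] --> \prod_(i <- r) l i.
Proof.
move=> fl; elim: r => [|i r IH].
  by rewrite big_nil; under eq_fun do rewrite big_nil; exact: cvg_cst.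
by rewrite big_cons; under eq_fun do rewrite big_cons; exact: cvgM.
Qed.

Let ray_prod a x : R := \prod_i cauchy_ray (a i) (x ord0 i).
Let moll_prod a t y : R := \prod_i mollified_ray (a i) t (y ord0 i).

Let rintegrable_cauchyn1 : rintegrable lam (cauchyn (1 : R)).
Proof.
apply: (@Rintegral_rV_prod R n (fun _ => cauchy_ker 1) _).1 => _.
exact: rintegrable_cauchy1.
Qed.

Let ray_prod_le a x : `|ray_prod a x| <= cauchyn 1 x.
Proof.
rewrite /ray_prod normr_prod; apply: ler_prod => i _; rewrite normr_ge0/=.
by rewrite ger0_norm ?cauchy_ray_ge0// cauchy_ray_le.
Qed.

Let measurable_ray_prod a : measurable_fun setT (ray_prod a).
Proof.
apply: measurable_prod => i _.
exact: (measurableT_comp (measurable_cauchy_ray (a i)) (measurable_rV_coord i)).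
Qed.

Variables (u : Rn -> R) (M : R).
Hypotheses (mu_ : measurable_fun setT u) (uM : forall x, `|u x| <= M).

Let M0 : 0 <= M. Proof. by apply: le_trans (uM 0). Qed.

(** Fubini moves the heat kernel from u onto the test function; the measurability of both integrands
    comes out of the same exchange. *)
Let dual a t : 0 < t -> t <= 1 ->
  [/\ measurable_fun setT (fun y => u y * moll_prod a t y),
      measurable_fun setT (fun x => ray_prod a x * heatconv [::] u t x) &
      \int[lam]_y (u y * moll_prod a t y) = \int[lam]_x (ray_prod a x * heatconv [::] u t x)].
Proof.
move=> t0 t1.
pose F y x := u y * \prod_i (heat1 0 t (x ord0 i - y ord0 i) * cauchy_ray (a i) (x ord0 i)).
have iP y := @Rintegral_rV_prod R n (fun i (c : R) => heat1 0 t (c - y ord0 i) * cauchy_ray (a i) c)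
  (fun i => rintegrable_heat1_ray (a i) (y ord0 i) t0).
have iF y : rintegrable lam (F y) by apply: rintegrableZl; exact: (iP y).1.
have [C C0 CP] := mollified_ray_le R.
have FE y : \int[lam]_x F y x = u y * moll_prod a t y.
  by rewrite (RintegralZl _ measurableT (iP y).1) (iP y).2.
have mF : measurable_fun setT (fun p : Rn * Rn => F p.1 p.2).
  apply: measurable_funM; first exact: (measurableT_comp mu_ measurable_fst).
  apply: measurable_prod => i _; apply: measurable_funM.
    apply: measurable_heat1 => //; apply: measurable_funB.
      exact: (measurableT_comp (measurable_rV_coord i) measurable_snd).
    exact: (measurableT_comp (measurable_rV_coord i) measurable_fst).
  apply: (measurableT_comp (measurable_cauchy_ray (a i))).
  exact: (measurableT_comp (measurable_rV_coord i) measurable_snd).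
have iFF : rintegrable (lam \x lam)%E (fun p => F p.1 p.2).
  apply: (rintegrable_prod mF iF (rintegrableZl (M * C ^+ n) rintegrable_cauchyn1)) => y.
  have nF x : `|F y x| = `|u y| * \prod_i (heat1 0 t (x ord0 i - y ord0 i) * cauchy_ray (a i) (x ord0 i)).
    rewrite normrM; congr (_ * _); rewrite ger0_norm// prodr_ge0// => i _.
    by rewrite mulr_ge0 ?heat1_0_ge0 ?cauchy_ray_ge0.
  under eq_Rintegral do rewrite nF.
  rewrite (RintegralZl _ measurableT (iP y).1) (iP y).2 -mulrA; apply: ler_pM => //.
    by apply: prodr_ge0 => i _; exact: mollified_ray_ge0.
  rewrite -[X in C ^+ X]card_ord -prodr_const -big_split/=; apply: ler_prod => i _.
  by rewrite mollified_ray_ge0/= CP.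
have ih x := rintegrable_heat mu_ uM [::] x t0.
have Fx x : F^~ x = fun y => ray_prod a x * (heat [::] t (x - y) * u y).
  apply/funext => y; rewrite /F big_split/= -/(ray_prod a x).
  rewrite (_ : heat [::] t (x - y) = \prod_i heat1 0 t (x ord0 i - y ord0 i)); first by ring.
  by apply: eq_bigr => i _; rewrite !mxE.
have FE2 x : \int[lam]_y F y x = ray_prod a x * heatconv [::] u t x.
  rewrite /heatconv -(RintegralZl _ measurableT (ih x)); apply: eq_Rintegral => y _.
  exact: (congr1 (fun h => h y) (Fx x)).
split.
- have := measurable_Rintegral_param iFF; congr (measurable_fun _ _); apply/funext => y; exact: FE.
- have := measurable_int _ (integrable_fubini_G iFF).
  have -> : fubini_G lam (EFin \o (fun p => F p.1 p.2)) = EFin \o (fun x => ray_prod a x *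
      heatconv [::] u t x).
    apply/funext => x; rewrite /= -FE2 EFin_Rintegral//.
    by rewrite Fx; exact: rintegrableZl.
  by move/measurable_EFinP.
- by have := RFubini iFF; under eq_Rintegral do rewrite FE; under [RHS]eq_Rintegral do rewrite FE2.
Qed.

Lemma heatconv0_bounded : exists2 C : R, 0 <= C & forall t x, 0 < t -> `|heatconv [::] u t x| <= C.
Proof.
have [C C0 CP] := @heatconv_le R n [::]; exists (C * M) => [|t x t0]; first by rewrite mulr_ge0.
by have := CP u M t x mu_ uM t0; rewrite mul0r oppr0 powRr0 mulr1.
Qed.

(** Tested on weighted orthants, u_t converges to u by regularity of the test functions and to v by
    dominated convergence. Hence the weighted difference has integral 0 on orthants, then on all
    measurable sets by Dynkin's theorem, and it vanishes almost everywhere. *)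
Lemma heat_initial_value (v : Rn -> R) : measurable_fun setT v ->
  (forall x, heatconv [::] u j.+1%:R^-1 x @[j --> \oo] --> v x) ->
  {ae lam, forall x, u x = v x}.
Proof.
move=> mv uv; have j0 j : 0 < j.+1%:R^-1 :> R by rewrite invr_gt0 ltr0n.
have j1 j : j.+1%:R^-1 <= 1 :> R by rewrite invf_le1 ?ler1n ?ltr0n.
have [B B0 BP] := heatconv0_bounded.
have [C C0 CP] := mollified_ray_le R.
have vB x : `|v x| <= B.
  have h : `|heatconv [::] u j.+1%:R^-1 x| @[j --> \oo] --> `|v x| by apply: cvg_norm; exact: uv.
  rewrite -(cvg_lim _ h)//; apply: limr_le; first by apply/cvg_ex; exists `|v x|.
  by near=> j; exact: BP.
have iw := rintegrable_cauchyn1.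
(* The positive weight makes the bounded difference integrable without changing its zeros. *)
pose q x := (u x - v x) * cauchyn 1 x.
have mw := rintegrable_measurable iw.
have ub x : `|u x - v x| <= M + B by apply: le_trans (ler_normB _ _) _; exact: lerD.
have w0 x : 0 < cauchyn 1 x.
  by apply: prodr_gt0 => i _; rewrite /cauchy_ker expr1n divr_gt0// ltr_pwDl ?sqr_ge0.
have iq : rintegrable lam q.
  apply: (le_rintegrable _ (rintegrableZl (M + B) iw)) => [|x].
    by apply: measurable_funM => //; exact: measurable_funB.
  by rewrite normrM (gtr0_norm (w0 x)) ler_wpM2r// ltW.
have boxE a : \int[lam]_x (u x * ray_prod a x) = \int[lam]_x (ray_prod a x * v x).
  have lim1 : \int[lam]_y (u y * moll_prod a j.+1%:R^-1 y) @[j --> \oo] --> \int[lam]_x (u x * ray_prod a x).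
    apply: (@cvg_Rintegral R _ _ lam (fun j y => u y * moll_prod a j.+1%:R^-1 y)
      (fun y => u y * ray_prod a y) (fun y => M * C ^+ n * cauchyn 1 y)).
    - by move=> j; have [] := dual a (j0 j) (j1 j).
    - exact: measurable_funM.
    (* The regularised test function converges off the hyperplanes y_i = a_i, where it jumps; they
       are finitely many and null. *)
    - have : {ae lam, forall y : Rn, forall i, (y ord0 i)%:E != a i}.
        apply: filter_forall => i; case: (a i) => [r||]; [|exact: aeW|exact: aeW].
        have [h0 mh] := lebesgue_rV_hyperplane i r.
        exists [set x : Rn | x ord0 i = r]; split => // y /=.
        by move=> /negP; rewrite negbK => /eqP[].
      apply: filterS => y ya; apply: cvgM; first exact: cvg_cst.
      by apply: cvg_prod => i; exact: mollified_ray_cvg.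
    - exact: rintegrableZl.
    - move=> j y; rewrite normrM -mulrA; apply: ler_pM => //.
      rewrite -[X in C ^+ X]card_ord -prodr_const -big_split/= normr_prod.
      apply: ler_prod => i _; rewrite normr_ge0/= ger0_norm ?mollified_ray_ge0//.
      exact: CP.
  have lim2 : \int[lam]_x (ray_prod a x * heatconv [::] u j.+1%:R^-1 x) @[j --> \oo] -->
      \int[lam]_x (ray_prod a x * v x).
    apply: (@cvg_Rintegral R _ _ lam (fun j x => ray_prod a x * heatconv [::] u j.+1%:R^-1 x)
      (fun x => ray_prod a x * v x) (fun x => B * cauchyn 1 x)).
    - by move=> j; have [] := dual a (j0 j) (j1 j).
    - exact: measurable_funM.
    - by apply: aeW => x; apply: cvgM; [exact: cvg_cst|exact: uv].
    - exact: rintegrableZl.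
    - by move=> j x; rewrite normrM mulrC; apply: ler_pM => //; exact: BP.
  have EE j : \int[lam]_y (u y * moll_prod a j.+1%:R^-1 y) = \int[lam]_x (ray_prod a x * heatconv
      [::] u j.+1%:R^-1 x).
    by have [] := dual a (j0 j) (j1 j).
  by move: lim1; under eq_fun do rewrite EE; move=> /cvg_lim <-//; apply/cvg_lim.
have box0 a : (\int[lam]_(x in [set x : Rn | forall i, ((x ord0 i)%:E < a i)%E]) (q x)%:E = 0)%E.
  set A := [set x | _].
  have qA : (fun x => (q x)%:E) \_ A = EFin \o (fun x => u x * ray_prod a x - ray_prod a x * v x).
    apply/funext => x; rewrite patchE /q /=; case: ifPn => [/set_mem Ax|xA].
      congr (_%:E); rewrite [cauchyn _ _](_ : _ = ray_prod a x); first by ring.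
      by apply: eq_bigr => i _; rewrite /cauchy_ray Ax mul1r.
    have -> : ray_prod a x = 0; last by rewrite mulr0 mul0r subr0.
    have [i xi] : exists i, ~~ ((x ord0 i)%:E < a i)%E.
      apply/existsP; apply: contraNT xA; rewrite negb_exists => /forallP h.
      by apply/mem_set => i; have := h i; rewrite negbK.
    by rewrite /ray_prod (bigD1 i)//= /cauchy_ray (negPf xi) mul0r mul0r.
  have i1 : rintegrable lam (fun x => u x * ray_prod a x).
    apply: (le_rintegrable _ (rintegrableZl M iw)) => [|x]; first exact: measurable_funM.
    by rewrite normrM; apply: ler_pM.
  have i2 : rintegrable lam (fun x => ray_prod a x * v x).
    apply: (le_rintegrable _ (rintegrableZl B iw)) => [|x]; first exact: measurable_funM.
    by rewrite normrM mulrC; apply: ler_pM.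
  rewrite integral_mkcond qA -EFin_Rintegral; last exact: rintegrableB.
  by rewrite RintegralB// boxE subrr.
have all0 A : measurable A -> (\int[lam]_(x in A) (q x)%:E = 0)%E.
  rewrite measurable_rVE; move: A; apply: dynkin_induction.
  - exact: measurable_rVE.
  - move=> _ _ [a _ <-] [b _ <-]; exists (fun i => Order.min (a i) (b i)) => //.
    apply/seteqP; split=> x /= => [h|[ha hb] i]; last by rewrite lt_min ha hb.
    by split=> i; have := h i; rewrite lt_min => /andP[].
  - have := box0 (fun=> +oo%E); congr (integral lam _ _ = _).
    by apply/seteqP; split=> // x _ i; exact: ltry.
  - by move=> _ [a _ <-]; exact: box0.
  (* Complements: the integral over the whole space is zero, being the orthant with all endpoints
     infinite. *)
  - move=> S mS S0; have mC := measurableC mS.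
    have mq : measurable_fun (S `|` ~` S) (EFin \o q).
      by apply: measurable_funS (measurable_int _ iq).
    have dS : [disjoint S & ~` S] by apply/disj_setPS => x [].
    have := integral_setU lam mS mC mq dS; rewrite setUv S0 add0e => <-.
    have := box0 (fun=> +oo%E); congr (integral lam _ _ = _).
    by apply/seteqP; split=> // x _ i; exact: ltry.
  - move=> F mF tF F0; rewrite integral_bigcup//; first by rewrite eseries0.
    by apply: integrableS iq => //; exact: bigcup_measurable.
have : ae_eq lam setT (EFin \o q) (cst 0%E).
  apply: integral_ae_eq => // E _ mE.
  by rewrite integral_cst// mul0e all0.
apply: filterS => x /(_ I) /= [] /eqP; rewrite mulf_eq0 (gt_eqF (w0 x)) orbF subr_eq0.
by move/eqP.
Unshelve. all: by end_near. Qed.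

End heat_initial_value.

(** * The norms of the statement *)

Section norms.
Context (R : realType) (n : nat).
Notation lam := (@lebesgue_rV R n).
Notation Rn := 'rV[R]_n.
Implicit Types (x y z : Rn) (u v f : Rn -> R) (g : seq 'I_n) (M N K : R).

(** The infinity norm is the essential supremum only on a space of positive measure. *)
Lemma lebesgue_rV_setT_gt0 : (0 < lam setT)%E.
Proof.
pose A (i : 'I_n) : set R := `[0, 1]%classic.
have mA i : measurable (A i : set (measurableTypeR R)) by exact: measurable_itv.
apply: (@lt_le_trans _ _ (lam [set x : Rn | forall i, A i (x ord0 i)])); last first.
  by apply: le_measure; rewrite ?inE//; exact: measurable_rV_box.
rewrite (lebesgue_rV_box mA) big1// => i _.
by rewrite lebesgue_measure_itv/= lte_fin ltr01 oppr0 adde0.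
Qed.

Lemma Linfty_normE u : Linfty_norm u = ess_sup lam (abse \o (EFin \o u)).
Proof. by rewrite /Linfty_norm unlock lebesgue_rV_setT_gt0. Qed.

(** Setting u to 0 where it exceeds its essential bound gives a representative bounded everywhere by
    the norm, as the pointwise estimates require. *)
Lemma Linfty_truncation u : Linfty u -> exists M u',
  [/\ Linfty_norm u = M%:E, measurable_fun setT u, measurable_fun setT u',
      forall x, `|u' x| <= M & ae_equal u u'].
Proof.
move=> /andP[/= mu_ fu]; rewrite inE in mu_.
have {}fu : (Linfty_norm u < +oo)%E by move: fu; rewrite inE.
have u0 : (0 <= Linfty_norm u)%E by exact: Lnorm_ge0.
pose M := fine (Linfty_norm u).
have uM : Linfty_norm u = M%:E by rewrite fineK// ge0_fin_numE.
have M0 : 0 <= M by rewrite -lee_fin -uM.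
exists M, (fun x => if `|u x| <= M then u x else 0); split => //.
- apply: measurable_fun_ifT => //; apply: measurable_fun_ler => //.
  exact: measurableT_comp.
- by move=> x; case: ifP => //; rewrite normr0.
- have : (ess_sup lam (abse \o (EFin \o u)) <= M%:E)%E by rewrite -uM Linfty_normE.
  by move=> /ess_supP; apply: filterS => x /=; rewrite lee_fin => ->.
Qed.

Lemma Linfty_bounded v K : measurable_fun setT v -> (forall x, `|v x| <= K) ->
  Linfty v /\ (Linfty_norm v <= K%:E)%E.
Proof.
move=> mv vK.
have vn : (Linfty_norm v <= K%:E)%E.
  by rewrite Linfty_normE; apply/ess_supP; apply: aeW => x /=; rewrite lee_fin.
split => //; apply/andP; split; rewrite inE//.
exact: le_lt_trans vn (ltry _).
Qed.

Lemma Ck_norm_le k v K : (forall g x, (size g <= k)%N -> `|partials g v x| <= K) ->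
  (Ck_norm k v <= K%:E)%E.
Proof. by move=> vK; apply: ge_ereal_sup => _ [[g x] /= gk <-]; rewrite lee_fin vK. Qed.

Lemma holder_seminorm_le b v K :
  (forall x y, x != y -> `|v x - v y| <= K * enorm (x - y) `^ b) ->
  (holder_seminorm b v <= K%:E)%E.
Proof.
move=> vK; apply: ge_ereal_sup => _ [[x y] /= xy <-]; rewrite lee_fin ler_pdivrMr; first exact: vK.
by rewrite powR_gt0// enorm_gt0// subr_eq0.
Qed.

Lemma zygmund_seminorm_le v K :
  (forall x h, h != 0 -> `|v (x + h) + v (x - h) - 2 * v x| <= K * enorm h) ->
  (zygmund_seminorm v <= K%:E)%E.
Proof.
move=> vK; apply: ge_ereal_sup => _ [[x h] /= h0 <-]; rewrite lee_fin ler_pdivrMr; first exact: vK.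
by rewrite enorm_gt0.
Qed.

Lemma holder_bounded k b v K : continuously_derivable k v ->
  (forall g x, (size g <= k)%N -> `|partials g v x| <= K) ->
  (forall g x y, size g = k -> x != y ->
     `|partials g v x - partials g v y| <= K * enorm (x - y) `^ b) ->
  holder k b v /\ (holder_norm k b v <= (2 * K)%:E)%E.
Proof.
move=> cv vK vH.
have hn : (holder_norm k b v <= (2 * K)%:E)%E.
  rewrite mulr_natl mulr2n EFinD; apply: leeD; first exact: Ck_norm_le.
  by apply: ge_ereal_sup => _ [g /= gk <-]; apply: holder_seminorm_le => x y; exact: vH.
by split => //; split => //; exact: le_lt_trans hn (ltry _).
Qed.

Lemma zygmund_bounded k v K : continuously_derivable k v ->
  (forall g x, (size g <= k)%N -> `|partials g v x| <= K) ->
  (forall g x h, size g = k -> h != 0 ->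
     `|partials g v (x + h) + partials g v (x - h) - 2 * partials g v x| <= K * enorm h) ->
  zygmund k.+1 v /\ (zygmund_norm k.+1 v <= (2 * K)%:E)%E.
Proof.
move=> [dv cv] vK vZ.
have Z1 g : size g = k -> Linfty (partials g v) /\ (Linfty_norm (partials g v) <= K%:E)%E.
  move=> gk; apply: Linfty_bounded => [|x]; last by apply: vK; rewrite gk.
  by apply: continuous_measurable_rV; apply: cv; rewrite gk.
have S1 g : size g = k -> (zygmund_seminorm (partials g v) <= K%:E)%E.
  by move=> gk; apply: zygmund_seminorm_le => x h; exact: vZ.
have Z2 g : size g = k -> zygmund1 (partials g v).
  by move=> gk; split; [exact: (Z1 g gk).1|exact: le_lt_trans (S1 g gk) (ltry _)].
(* The Zygmund space of order 1 is built on the essential norm, the higher ones on the norm of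
   C^k. *)
case: k => [|k] in dv cv vK vZ Z1 S1 Z2 *.
  split; first exact: (Z2 [::]).
  by rewrite mulr_natl mulr2n EFinD; apply: leeD; [exact: (Z1 [::] _).2|exact: (S1 [::])].
have Cn := Ck_norm_le vK.
split.
  by split; [split => //; exact: le_lt_trans Cn (ltry _)|exact: Z2].
rewrite mulr_natl mulr2n EFinD; apply: leeD => //.
by apply: ge_ereal_sup => _ [g /= gk <-]; exact: S1.
Qed.

Lemma holder0_bounds al f : (1 <= n)%N -> holder 0 al f -> exists N,
  [/\ holder_norm 0 al f = N%:E, continuous f, forall x, `|f x| <= N &
      forall x y, `|f x - f y| <= N * enorm (x - y) `^ al].
Proof.
move=> n1 [[_ cf] fn].
have fC x : (`|f x|%:E <= Ck_norm 0 f)%E by apply: ereal_sup_ubound; exists ([::], x).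
have fS x y : x != y -> ((`|f x - f y| / enorm (x - y) `^ al)%:E <=
    ereal_sup [set holder_seminorm al (partials g f) | g in [set g | size g = 0%N]])%E.
  move=> xy; apply: (@le_trans _ _ (holder_seminorm al f)).
    by apply: ereal_sup_ubound; exists (x, y).
  by apply: ereal_sup_ubound; exists [::].
(* Two distinct points keep the Hoelder seminorm from being the supremum of the empty set, that is
   -oo. *)
have [x0 [y0 xy0]] : exists x y : Rn, x != y.
  exists 0, (const_mx 1); apply/negP => /eqP/rowP/(_ (Ordinal n1)); rewrite !mxE => /eqP.
  by rewrite eq_sym oner_eq0.
have C0 : (0 <= Ck_norm 0 f)%E by apply: le_trans (fC 0); rewrite lee_fin.
have S0 : (0 <= ereal_sup [set holder_seminorm al (partials g f) | g in [set g | size g = 0%N]])%E.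
  by apply: le_trans (fS x0 y0 xy0); rewrite lee_fin divr_ge0// powR_ge0.
have fN0 : (0 <= holder_norm 0 al f)%E by exact: adde_ge0.
pose N := fine (holder_norm 0 al f).
have NE : holder_norm 0 al f = N%:E by rewrite fineK// ge0_fin_numE.
exists N; split => //.
- exact: (cf [::]).
- by move=> x; rewrite -lee_fin -NE; apply: le_trans (fC x) _; exact: leeDl.
- move=> x y; have [->|xy] := eqVneq x y.
    by rewrite subrr normr0 mulr_ge0 ?powR_ge0// -lee_fin -NE.
  rewrite -ler_pdivrMr ?powR_gt0 ?enorm_gt0 ?subr_eq0//.
  by rewrite -lee_fin -NE; apply: le_trans (fS x y xy) _; exact: leeDr.
Qed.

End norms.

(** * From the distributional equation to the norm estimates *)

Section frac_laplacian_solutions.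
Context (R : realType) (n : nat).
Notation lam := (@lebesgue_rV R n).
Notation Rn := 'rV[R]_n.
Implicit Types (x y z : Rn) (u v f : Rn -> R) (s al gam M N : R).

Lemma holder_frac_solution s al u f : (1 <= n)%N -> 0 < s < 1 ->
  Linfty u -> holder 0 al f -> frac_laplacian_eq s u f ->
  exists u' M N, [/\ ae_equal u u', frac_solution s al u' f M N,
    Linfty_norm u = M%:E & holder_norm 0 al f = N%:E].
Proof.
move=> n1 s01 /Linfty_truncation[M [u' [uM mu mu' u'M uu']]].
move=> /(holder0_bounds n1)[N [fN cf fb fH]] equf.
have mf := continuous_measurable_rV cf.
have N0 : 0 <= N by apply: le_trans (fb 0).
exists u', M, N; split => //; split => //.
- by apply: (frac_laplacian_heat_solution s01 equf mu mf mu' mf u'M fb uu'); exact: aeW.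
- move=> x y; apply: le_trans (fH x y) _.
  by rewrite ler_wpM2r ?powR_ge0// ler_peMl// ler1n.
Qed.

Lemma Linfty_frac_solution s u f : 0 < s < 1 ->
  Linfty u -> Linfty f -> frac_laplacian_eq s u f ->
  exists u' f' M N, [/\ ae_equal u u', frac_solution s 0 u' f' M N,
    Linfty_norm u = M%:E & Linfty_norm f = N%:E].
Proof.
move=> s01 /Linfty_truncation[M [u' [uM mu mu' u'M uu']]].
move=> /Linfty_truncation[N [f' [fN mf mf' f'N ff']]] equf.
exists u', f', M, N; split => //; split => //.
- exact: (frac_laplacian_heat_solution s01 equf mu mf mu' mf' u'M f'N uu' ff').
- move=> x y; rewrite powRr0 mulr1 mulr_natl mulr2n; apply: le_trans (ler_normB _ _) _.
  exact: lerD.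
Qed.

Lemma frac_regularity_ae s al k gam : 0 < s < 1 -> 0 <= al <= 1 ->
  al + 2 * s = k%:R + gam -> 0 < gam <= 1 ->
  exists2 C, 0 < C & forall u0 u f M N, ae_equal u0 u -> frac_solution s al u f M N ->
  exists v, ae_equal u0 v /\
    (gam < 1 -> holder k gam v /\ (holder_norm k gam v <= C%:E * (M%:E + N%:E))%E) /\
    (gam = 1 -> zygmund k.+1 v /\ (zygmund_norm k.+1 v <= C%:E * (M%:E + N%:E))%E).
Proof.
move=> s01 al01 asE gam01; have [C C0 CP] := @frac_regularity R n s al k gam s01 al01 asE gam01.
(* Each norm is a sum of two quantities bounded by C (M + N). *)
exists (2 * C) => [|u0 u f M N uu h]; first by rewrite mulr_gt0.
have [v [cv vb vH vZ vl]] := CP u f M N h.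
have mv : measurable_fun setT v by apply: continuous_measurable_rV; exact: (cv.2 [::]).
have uv := heat_initial_value (sol_mu h) (sol_uM h) mv vl.
rewrite -EFinD -EFinM -mulrA; exists v; split; last split.
- by apply: filterS2 uu uv => x ->.
- by move=> gl1; apply: holder_bounded => // g x y; exact: vH.
- by move=> ge1; apply: zygmund_bounded => // g x y; exact: vZ.
Qed.

End frac_laplacian_solutions.

Theorem theorem15 (R : realType) (n : nat) (n_ge1 : (1 <= n)%N)
    (s : R) (s_gt0 : 0 < s) (s_lt1 : s < 1) :
  (* (a) *)
  (forall alpha : R, 0 < alpha -> alpha <= 1 ->
    (* (i) *)
    (alpha + 2 * s < 1 ->
      exists C : R, 0 < C /\ forall u f : 'rV[R]_n -> R,
        Linfty u -> holder 0 alpha f -> frac_laplacian_eq s u f ->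
        exists v : 'rV[R]_n -> R,
          [/\ ae_equal u v,
              holder 0 (alpha + 2 * s) v &
              (holder_norm 0 (alpha + 2 * s) v
               <= C%:E * (Linfty_norm u + holder_norm 0 alpha f))%E]) /\
    (* (ii) *)
    (1 < alpha + 2 * s -> alpha + 2 * s < 2 ->
      exists C : R, 0 < C /\ forall u f : 'rV[R]_n -> R,
        Linfty u -> holder 0 alpha f -> frac_laplacian_eq s u f ->
        exists v : 'rV[R]_n -> R,
          [/\ ae_equal u v,
              holder 1 (alpha + 2 * s - 1) v &
              (holder_norm 1 (alpha + 2 * s - 1) v
               <= C%:E * (Linfty_norm u + holder_norm 0 alpha f))%E]) /\
    (* (iii) *)
    (2 < alpha + 2 * s -> alpha + 2 * s < 3 ->
      exists C : R, 0 < C /\ forall u f : 'rV[R]_n -> R,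
        Linfty u -> holder 0 alpha f -> frac_laplacian_eq s u f ->
        exists v : 'rV[R]_n -> R,
          [/\ ae_equal u v,
              holder 2 (alpha + 2 * s - 2) v &
              (holder_norm 2 (alpha + 2 * s - 2) v
               <= C%:E * (Linfty_norm u + holder_norm 0 alpha f))%E]) /\
    (* (iv) *)
    (forall k : nat, k = 1%N \/ k = 2%N -> alpha + 2 * s = k%:R ->
      exists C : R, 0 < C /\ forall u f : 'rV[R]_n -> R,
        Linfty u -> holder 0 alpha f -> frac_laplacian_eq s u f ->
        exists v : 'rV[R]_n -> R,
          [/\ ae_equal u v,
              zygmund k v &
              (zygmund_norm k v
               <= C%:E * (Linfty_norm u + holder_norm 0 alpha f))%E])) /\
  (* (b) *)
  ((* (i) *)
    (2 * s < 1 ->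
      exists C : R, 0 < C /\ forall u f : 'rV[R]_n -> R,
        Linfty u -> Linfty f -> frac_laplacian_eq s u f ->
        exists v : 'rV[R]_n -> R,
          [/\ ae_equal u v,
              holder 0 (2 * s) v &
              (holder_norm 0 (2 * s) v
               <= C%:E * (Linfty_norm u + Linfty_norm f))%E]) /\
    (* (ii) *)
    (2 * s = 1 ->
      exists C : R, 0 < C /\ forall u f : 'rV[R]_n -> R,
        Linfty u -> Linfty f -> frac_laplacian_eq s u f ->
        exists v : 'rV[R]_n -> R,
          [/\ ae_equal u v,
              zygmund 1 v &
              (zygmund_norm 1 v
               <= C%:E * (Linfty_norm u + Linfty_norm f))%E]) /\
    (* (iii) *)
    (1 < 2 * s ->
      exists C : R, 0 < C /\ forall u f : 'rV[R]_n -> R,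
        Linfty u -> Linfty f -> frac_laplacian_eq s u f ->
        exists v : 'rV[R]_n -> R,
          [/\ ae_equal u v,
              holder 1 (2 * s - 1) v &
              (holder_norm 1 (2 * s - 1) v
               <= C%:E * (Linfty_norm u + Linfty_norm f))%E])).
Proof.
have s01 : 0 < s < 1 by rewrite s_gt0.
(* Cases (i) to (iii) of (a) differ only in the integer part [k] of al + 2s. *)
have holderA al k gam : 0 < al <= 1 -> al + 2 * s = k%:R + gam -> 0 < gam < 1 ->
    exists C : R, 0 < C /\ forall u f : 'rV[R]_n -> R,
      Linfty u -> holder 0 al f -> frac_laplacian_eq s u f ->
      exists v : 'rV[R]_n -> R, [/\ ae_equal u v, holder k gam v &
        (holder_norm k gam v <= C%:E * (Linfty_norm u + holder_norm 0 al f))%E].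
  move=> /andP[al0 al1] asE /andP[g0 g1].
  have al01 : 0 <= al <= 1 by rewrite ltW.
  have gam01 : 0 < gam <= 1 by rewrite g0 ltW.
  have [C C0 CP] := frac_regularity_ae n s01 al01 asE gam01.
  exists C; split=> // u f uL fH equf.
  have [u' [M [N [uu' h -> ->]]]] := holder_frac_solution n_ge1 s01 uL fH equf.
  by have [v [uv [/(_ g1)[? ?] _]]] := CP _ _ _ _ _ uu' h; exists v.
have holderB k gam : 2 * s = k%:R + gam -> 0 < gam < 1 ->
    exists C : R, 0 < C /\ forall u f : 'rV[R]_n -> R,
      Linfty u -> Linfty f -> frac_laplacian_eq s u f ->
      exists v : 'rV[R]_n -> R, [/\ ae_equal u v, holder k gam v &
        (holder_norm k gam v <= C%:E * (Linfty_norm u + Linfty_norm f))%E].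
  move=> asE /andP[g0 g1].
  have al01 : 0 <= (0 : R) <= 1 by rewrite lexx ler01.
  have gam01 : 0 < gam <= 1 by rewrite g0 ltW.
  have [|C C0 CP] := @frac_regularity_ae R n s 0 k gam s01 al01 _ gam01; first by rewrite add0r.
  exists C; split=> // u f uL fL equf.
  have [u' [f' [M [N [uu' h -> ->]]]]] := Linfty_frac_solution s01 uL fL equf.
  by have [v [uv [/(_ g1)[? ?] _]]] := CP _ _ _ _ _ uu' h; exists v.
have one01 : 0 < (1 : R) <= 1 by rewrite ltr01 lexx.
split; [move=> al al0 al1; split; [|split; [|split]]|split; [|split]].
- by move=> b1; apply: (holderA _ 0%N); rewrite ?al0//; lra.
- by move=> b1 b2; apply: (holderA _ 1%N); rewrite ?al0//; lra.
- by move=> b1 b2; apply: (holderA _ 2%N); rewrite ?al0//; lra.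
- move=> [|k] k12 asE; first by case: k12.
  have al01 : 0 <= al <= 1 by rewrite ltW.
  (* An integer value k+1 of al + 2s is split as k + 1 with [gam = 1], so u has k derivatives and
     the last ones are in the Zygmund class. *)
  have [|C C0 CP] := @frac_regularity_ae R n s al k 1 s01 al01 _ one01.
    by rewrite asE -addn1 natrD.
  exists C; split=> // u f uL fH equf.
  have [u' [M [N [uu' h -> ->]]]] := holder_frac_solution n_ge1 s01 uL fH equf.
  by have [v [uv [_ /(_ erefl)[? ?]]]] := CP _ _ _ _ _ uu' h; exists v.
- by move=> b1; apply: (holderB 0%N); lra.
- move=> b1; have al01 : 0 <= (0 : R) <= 1 by rewrite lexx ler01.
  have [|C C0 CP] := @frac_regularity_ae R n s 0 0%N 1 s01 al01 _ one01; first by rewrite b1 add0r.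
  exists C; split=> // u f uL fL equf.
  have [u' [f' [M [N [uu' h -> ->]]]]] := Linfty_frac_solution s01 uL fL equf.
  by have [v [uv [_ /(_ erefl)[? ?]]]] := CP _ _ _ _ _ uu' h; exists v.
- by move=> b1; apply: (holderB 1%N); lra.
Qed.
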